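(* Let $\{x_t\}$ be generated by the auto-conditioned stochastic projected gradient (AC-SPG) method described in the context, run for $k$ iterations; let $m$ be the number of segments of $\{x_0,\dots,x_k\}$, $s_i$ the length of segment $i$, $\gamma_t^{(i)}$ the value of $\gamma$ at the $t$-th iteration of segment $i$, and $x_R=x_{R(k)}$ the random output (all defined in the context). Let $$M_k:=\sum_{i=1}^m\sum_{t=2}^{s_i}\big(\tfrac{3t}{16}-\tfrac14\big)\tfrac1{\gamma_t^{(i)}}\ \ge\ \frac{(k-m)^2}{128\,\hat{\mathcal L}_{k-1}}.$$ (a) Suppose Estimator I is used to define $\gamma_t$. For any $b_t'\ge1$, $$\mathbb E\big[M_k\|g_{X,R}\|^2\big]\le\tfrac{(10+k-m)\hat{\mathcal L}D_X^2}{2}+\tfrac{k\,l\,D_X^2}{2}+\mathbb E\Big[\sum_{t=1}^k\big(\tfrac{11I(t-1)}{8}+\tfrac78\big)\tfrac{\sigma^2}{b_t\gamma_t}\Big].\quad(1)$$ Specifically, if one chooses an adaptive batch size $b_t=\max\{1,\lceil(\tfrac{11I(t-1)}{8}+\tfrac78)\tfrac{\alpha}{\gamma_t}\rceil\}$ with some $\alpha>0$, then $$\mathbb E\big[\|g_{X,R}\|^2\big]\le\tfrac{64(10+k-m)\hat{\mathcal L}^2D_X^2}{(k-m)^2}+\tfrac{64k\,l\,\hat{\mathcal L}D_X^2}{(k-m)^2}+\tfrac{128k\hat{\mathcal L}\sigma^2}{\alpha(k-m)^2}.\quad(2)$$ If one chooses a constant batch size $b_t=b$, then $$\mathbb E\big[\|g_{X,R}\|^2\big]\le\tfrac{64(10+k-m)\hat{\mathcal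 L}^2D_X^2}{(k-m)^2}+\tfrac{64k\,l\,\hat{\mathcal L}D_X^2}{(k-m)^2}+\tfrac{2(11k+3)k\hat{\mathcal L}\sigma^2}{b\bar{\mathcal L}_0(k-m)^2}.\quad(3)$$ (b) Suppose Estimator II is used to define $\gamma_t$. For any $b_t'\ge1$ and the same premises on $b_t$, inequalities (1), (2), (3) hold. Moreover, if $b_t'\ge\hat b\ge2\log_{1/\beta}(k+1)$, then $$\mathbb E\big[M_k\|g_{X,R}\|^2\big]\le\tfrac{21\hat{\mathcal L}D_X^2}{4}+\tfrac{k\,l\,D_X^2}{2}+\mathbb E\Big[\sum_{t=1}^k\big(\tfrac{11I(t-1)}{8}+\tfrac78\big)\tfrac{\sigma^2}{b_t\gamma_t}\Big].$$ Specifically, if one chooses an adaptive batch size $b_t=\max\{1,\lceil(\tfrac{11I(t-1)}{8}+\tfrac78)\tfrac{\alpha}{\gamma_t}\rceil\}$ with some $\alpha>0$, then $$\mathbb E\big[\|g_{X,R}\|^2\big]\le\tfrac{672\hat{\mathcal L}^2D_X^2}{(k-m)^2}+\tfrac{64k\,l\,\hat{\mathcal L}D_X^2}{(k-m)^2}+\tfrac{128k\hat{\mathcal L}\sigma^2}{\alpha(k-m)^2}.$$ If one chooses a constant batch size $b_t=b$, then $$\mathbb E\big[\|g_{X,R}\|^2\big]\le\tfrac{672\hat{\mathcal L}^2D_X^2}{(k-m)^2}+\tfrac{64k\,l\,\hat{\mathcal L}D_X^2}{(k-m)^2}+\tfrac{2(11k+3)k\hat{\mathcal L}\sigma^2}{b\bar{\mathcal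 L}_0(k-m)^2}.$$
   Context: $\|\cdot\|$, $\langle\cdot,\cdot\rangle$ are Euclidean; convention $\tfrac00=0$. $X\subseteq\mathbb R^n$ is a convex compact set with diameter $D_X=\max_{x,y\in X}\|x-y\|$; $f:X\to\mathbb R$ is continuously differentiable with $\|\nabla f(x)-\nabla f(y)\|\le L\|x-y\|$ for all $x,y\in X$ (hence $f(x)-f(y)-\langle\nabla f(y),x-y\rangle\le\tfrac L2\|x-y\|^2$), and, for some $l\in[0,L]$, $f(x)-f(y)-\langle\nabla f(y),x-y\rangle\ge-\tfrac l2\|x-y\|^2$ for all $x,y\in X$. Stochastic oracle: given $x\in X$ it returns $\mathcal F(x,\xi)$ and $\mathcal G(x,\xi)=\nabla\mathcal F(x,\xi)$, $\xi\in\Xi$ random; all samples are i.i.d. Assumptions, for all $x,y\in X$: $\mathbb E_\xi[\mathcal F(x,\xi)]=f(x)$, $\mathbb E_\xi[\mathcal G(x,\xi)]=\nabla f(x)$; $\mathbb E_\xi\|\mathcal G(x,\xi)-\nabla f(x)\|^2\le\sigma^2$ with $\sigma^2>0$; for each $\xi\in\Xi$ there is $\mathcal L(\xi)\ge0$ with $\|\mathcal G(x,\xi)-\mathcal G(y,\xi)\|\le\mathcal L(\xi)\|x-y\|$ and $\mathcal F(x,\xi)-\mathcal F(y,\xi)-\langle\mathcal G(y,\xi),x-y\rangle\le\tfrac{\mathcal L(\xi)}2\|x-y\|^2$, where $\mathcal L(\xi)\le\hat{\mathcal L}$ almost surely and $\mathbb E[\mathcal L(\xi)^2]\le\bar{\mathcal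 L}^2$. For $x,y\in X$: $\mathcal L_{x,y}(\xi):=\frac{2(\mathcal F(x,\xi)-\mathcal F(y,\xi)-\langle\nabla\mathcal F(y,\xi),x-y\rangle)}{\|x-y\|^2}$ and $L_{x,y}:=\frac{2(f(x)-f(y)-\langle\nabla f(y),x-y\rangle)}{\|x-y\|^2}$. Local Lipschitz estimators, from $b_t'$ i.i.d. samples $\bar\xi^t_1,\dots,\bar\xi^t_{b_t'}$ ($t\ge1$), with $0<\bar{\mathcal L}_0\le\hat{\mathcal L}$ given. Estimator I: $\bar{\mathcal L}_t:=\tfrac1{b_t'}\sum_{j=1}^{b_t'}\mathcal L_{x_t,x_{t-1}}(\bar\xi^t_j)$. Estimator II: $\bar{\mathcal L}_t:=\max\{\bar{\mathcal L}_0,\max_{1\le j\le b_t'}\mathcal L_{x_t,x_{t-1}}(\bar\xi^t_j)\}$. $\beta:=\max_{x,y\in X}\mathbb P\big(\max\{\bar{\mathcal L}_0,\mathcal L_{x,y}(\xi)\}\le\tfrac12L_{x,y}\big)<1$. AC-SPG method: given $x_0\in X$, for $t=1,\dots,k$: draw i.i.d. samples $\xi^t_1,\dots,\xi^t_{b_t}$, set $\hat G_t(x)=\tfrac1{b_t}\sum_{j=1}^{b_t}\mathcal G(x,\xi_j^t)$, $\gamma_t:=4\hat{\mathcal L}_{t-1}$ with $\hat{\mathcal L}_{t-1}:=\max\{\bar{\mathcal L}_0,\dots,\bar{\mathcal L}_{t-1}\}$, and $x_t=\arg\min_{x\in X}\{\langle\hat G_t(x_{t-1}),x\rangle+\tfrac{\gamma_t}2\|x_{t-1}-x\|^2\}$;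 then draw i.i.d. samples $\bar\xi^t_1,\dots,\bar\xi^t_{b_t'}$ and compute $\bar{\mathcal L}_t$ by the chosen estimator. Here $b_t$ is a positive integer measurable with respect to all samples drawn in iterations $1,\dots,t-1$; $b_t'$ is a positive integer. Segments: $x_0,x_1$ are in segment 1; for $t\ge2$ a new segment starts at $x_t$ whenever $\bar{\mathcal L}_t>\tfrac32\hat{\mathcal L}_{t-1}$. So $\{x_0,\dots,x_k\}=\{x_0^{(1)},x_1^{(1)},\dots,x_{s_1}^{(1)},x_1^{(2)},\dots,x_{s_2}^{(2)},\dots,x_1^{(m)},\dots,x_{s_m}^{(m)}\}$, and the number of segments satisfies $m\le\lfloor\log_{3/2}(\hat{\mathcal L}/\bar{\mathcal L}_0)\rfloor+1$. $S(t)$ is the segment index and $I(t)$ the within-segment index of $x_t$, i.e. $x_t=x^{(S(t))}_{I(t)}$ (so $I(0)=0$, $I(1)=1$). Other iteration quantities are re-indexed the same way, e.g. $\gamma^{(S(t))}_{I(t)}=\gamma_t$. Random output: $W(t):=\tfrac{3I(t)}{16}-\tfrac14$ if $I(t)\ge2$ and $W(t):=0$ if $I(t)=1$; $x_{R(k)}$ is randomly selected from $\{x_1,\dots,x_{k-1}\}$ with $\mathbb P(x_{R(k)}=x_{t-1})=\big(\sum_{j=1}^k\tfrac{W(j)}{\gamma_j}\big)^{-1}\tfrac{W(t)}{\gamma_t}$. Projected gradient: $P_X(x,g,\gamma):=\gamma(x-x^+)$, $x^+=\arg\min_{u\in X}\{\langle g,u\rangle+\tfrac\gamma2\|x-u\|^2\}$;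 $g_{X,t}:=P_X(x_t,\nabla f(x_t),\gamma_{t+1})$.
   Formalization: The number of segments m is random, so the bounds are ill-defined as displayed: in (1)-(3) the term 10+k-m is put under an expectation, and in the bounds on E‖g_{X,R}‖² the denominator (k-m)² becomes (k-m')² for any deterministic m'<k with m≤m' almost surely. *)

(* Defs.v *)
From HB Require Import structures.
From mathcomp Require Import all_boot all_order all_algebra.
From mathcomp Require Import all_classical all_reals all_analysis.

Set Implicit Arguments.
Unset Strict Implicit.
Unset Printing Implicit Defensive.

Import Order.TTheory GRing.Theory Num.Theory.
Import numFieldNormedType.Exports.

Local Open Scope classical_set_scope.
Local Open Scope ring_scope.

Section Euclidean.
Context {R : realType} {n : nat}.
Implicit Types (x y u v g : 'rV[R]_n) (X : set 'rV[R]_n).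

Definition dotp u v : R := \sum_(i < n) u 0 i * v 0 i.

(* The norm that the library puts on matrices is the sup norm. *)
Definition enorm u : R := Num.sqrt (dotp u u).

Definition diam X : R :=
  sup [set d : R | exists x y, [/\ X x, X y & d = enorm (x - y)]].

(* First-order expansion relative to X, so that X may have empty interior and
   one-sided behaviour is meant at boundary points. *)
Definition is_gradient_on X (f : 'rV[R]_n -> R) (gradf : 'rV[R]_n -> 'rV[R]_n)
    : Prop :=
  forall x, X x -> forall e : R, 0 < e ->
    \forall y \near within X (nbhs x),
      `|f y - f x - dotp (gradf x) (y - x)| <= e * enorm (y - x).

(* L_{x,y}; it is 0 at x = y since division by 0 returns 0. *)
Definition curvature (f : 'rV[R]_n -> R) (gradf : 'rV[R]_n -> 'rV[R]_n) x y : R :=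
  2 * (f x - f y - dotp (gradf y) (x - y)) / enorm (x - y) ^+ 2.

(* argmin over u in X of <g,u> + (c/2) |x - u|^2; the minimizer exists and is
   unique when X is nonempty, convex and compact and 0 < c. *)
Definition prox X x g (c : R) : 'rV[R]_n :=
  let obj u := dotp g u + c / 2 * enorm (x - u) ^+ 2 in
  xget 0 [set u | X u /\ forall v, X v -> obj u <= obj v].

Definition proj_grad X x g (c : R) : 'rV[R]_n := c *: (x - prox X x g c).

End Euclidean.

Definition logb {R : realType} (a x : R) : R := ln x / ln a.

Section Problem.
Context {R : realType} {n : nat}.
Local Open Scope ereal_scope.

Record smooth_problem (X : set 'rV[R]_n) (f : 'rV[R]_n -> R)
    (gradf : 'rV[R]_n -> 'rV[R]_n) (L l : R) : Prop := SmoothProblem {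
  domain_convex : convex_set (X : set (convex_lmodType 'rV[R]_n)) ;
  domain_compact : compact X ;
  objective_gradient : is_gradient_on X f gradf ;
  gradient_lipschitz : forall x y, X x -> X y ->
    (enorm (gradf x - gradf y) <= L * enorm (x - y))%R ;
  lower_curvature_bounds : (0 <= l <= L)%R ;
  lower_curvature : forall x y, X x -> X y ->
    (f x - f y - dotp (gradf y) (x - y) >= - (l / 2) * enorm (x - y) ^+ 2)%R
}.

(* mu is the law of a sample xi; calL is the sample-wise Lipschitz constant. *)
Record stochastic_oracle d (Xi : measurableType d) (mu : probability Xi R)
    (X : set 'rV[R]_n) (f : 'rV[R]_n -> R) (gradf : 'rV[R]_n -> 'rV[R]_n)
    (F : 'rV[R]_n -> Xi -> R) (G : 'rV[R]_n -> Xi -> 'rV[R]_n)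
    (calL : Xi -> R) (sigma Lhat Lbar : R) : Prop := StochasticOracle {
  oracle_gradient : forall z, is_gradient_on X (F ^~ z) (G ^~ z) ;
  value_integrable : forall x, X x -> mu.-integrable setT (EFin \o F x) ;
  value_unbiased : forall x, X x -> 'E_mu[F x] = (f x)%:E ;
  gradient_integrable : forall x i, X x ->
    mu.-integrable setT (fun z => (G x z 0%R i)%:E) ;
  gradient_unbiased : forall x i, X x ->
    'E_mu[fun z => G x z 0%R i] = (gradf x 0%R i)%:E ;
  sigma_gt0 : (0 < sigma)%R ;
  gradient_variance : forall x, X x ->
    'E_mu[fun z => (enorm (G x z - gradf x) ^+ 2)%R] <= (sigma ^+ 2)%:E ;
  sample_lipschitz_measurable : measurable_fun setT calL ;
  sample_lipschitz_ge0 : forall z, (0 <= calL z)%R ;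
  sample_lipschitz : forall x y z, X x -> X y ->
    (enorm (G x z - G y z) <= calL z * enorm (x - y))%R ;
  sample_upper_curvature : forall x y z, X x -> X y ->
    (F x z - F y z - dotp (G y z) (x - y) <= calL z / 2 * enorm (x - y) ^+ 2)%R ;
  sample_lipschitz_bounded : {ae mu, forall z, (calL z <= Lhat)%R} ;
  sample_lipschitz_moment2 :
    'E_mu[fun z => (calL z ^+ 2)%R] <= (Lbar ^+ 2)%:E
}.

(* The maximum over x, y is taken as a supremum. *)
Definition underestimation_prob d (Xi : measurableType d) (mu : probability Xi R)
    (X : set 'rV[R]_n) (f : 'rV[R]_n -> R) (gradf : 'rV[R]_n -> 'rV[R]_n)
    (F : 'rV[R]_n -> Xi -> R) (G : 'rV[R]_n -> Xi -> 'rV[R]_n) (Lbar0 : R) : R :=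
  sup [set p : R | exists x y, [/\ X x, X y &
    p = fine (mu [set z | (Num.max Lbar0 (curvature (F ^~ z) (G ^~ z) x y)
                           <= curvature f gradf x y / 2)%R])]].

End Problem.

(* Quantities determined by one realization e = (Lbar_0, Lbar_1, ...) of the
   local estimates. *)
Section Segments.
Context {R : realType}.
Implicit Types (e : nat -> R) (t k i j : nat).

Definition runmax e t : R := \big[Num.max/e 0%N]_(i < t.+1) e i.

(* Meaningful for 1 <= t. *)
Definition gam e t : R := 4 * runmax e t.-1.

Definition new_segment e t : bool := (2 <= t)%N && (3 / 2 * runmax e t.-1 < e t).

Fixpoint seg_index e t : nat :=
  if t is t'.+1 then (seg_index e t' + new_segment e t)%N else 1%N.

Fixpoint in_index e t : nat :=
  if t is t'.+1 then if new_segment e t then 1%N else (in_index e t').+1 else 0%N.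

Definition num_segments e k : nat := seg_index e k.

(* s_i, the last within-segment index in segment i: x_0, which has index 0 in
   segment 1, is not counted. *)
Definition seg_length e k i : nat :=
  (\sum_(1 <= t < k.+1) (seg_index e t == i))%N.

(* The t <= k such that x_t is x^{(i)}_j. *)
Definition iteration_of e k i j : nat :=
  find (fun t => (seg_index e t == i) && (in_index e t == j)) (iota 0 k.+1).

Definition gam_seg e k i j : R := gam e (iteration_of e k i j).

Definition Msum e k : R :=
  \sum_(1 <= i < (num_segments e k).+1)
    \sum_(2 <= t < (seg_length e k i).+1)
      (3 * t%:R / 16 - 1 / 4) * (gam_seg e k i t)^-1.

Definition weight e t : R :=
  if (2 <= in_index e t)%N then 3 * (in_index e t)%:R / 16 - 1 / 4 else 0.

Definition output_prob e k t : R :=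
  (\sum_(1 <= j < k.+1) weight e j / gam e j)^-1 * (weight e t / gam e t).

Definition noise_coef e t : R := 11 * (in_index e t.-1)%:R / 8 + 7 / 8.

End Segments.

Inductive estimator := EstimatorI | EstimatorII.

Definition estimate {R : realType} (est : estimator) (Lbar0 : R) (N : nat)
    (c : nat -> R) : R :=
  match est with
  | EstimatorI => (\sum_(j < N) c j) / N%:R
  | EstimatorII => \big[Num.max/Lbar0]_(j < N) c j
  end.

Section Method.
Context {R : realType} {n : nat}.
Context {dXi : measure_display} {Xi : measurableType dXi}.
Context {dOm : measure_display} {Om : measurableType dOm}.
Local Open Scope ereal_scope.

Record iid_with_law (P : probability Om R) (mu : probability Xi R)
    (I : eqType) (Y : I -> Om -> Xi) : Prop := IIDWithLaw {
  iid_measurable : forall i, measurable_fun setT (Y i) ;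
  iid_law : forall i B, measurable B -> P (Y i @^-1` B) = mu B ;
  iid_independent : forall (s : seq I) (B : I -> set Xi), uniq s ->
    (forall i, measurable (B i)) ->
    P (\bigcap_(i in [set` s]) (Y i @^-1` B i)) = \prod_(i <- s) P (Y i @^-1` B i)
}.

(* Since the batch sizes b_t are random, the samples are the initial entries of
   infinite i.i.d. arrays: iteration t draws xi t j for j < b_t and xibar t j
   for j < b'_t. *)
Definition all_samples (xi xibar : nat -> nat -> Om -> Xi)
    (i : (nat * nat) + (nat * nat)) : Om -> Xi :=
  match i with
  | inl (t, j) => xi t j
  | inr (t, j) => xibar t j
  end.

(* The sigma-algebra generated by the samples drawn in iterations 1, ..., t. *)
Definition drawn (xi xibar : nat -> nat -> Om -> Xi) (b : Om -> nat -> nat)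
    (b' : nat -> nat) (t : nat) : set (set Om) :=
  <<s [set A | exists s j B, [/\ (1 <= s <= t)%N, measurable B &
         A = [set w | (j < b w s)%N /\ B (xi s j w)]
         \/ (j < b' s)%N /\ A = xibar s j @^-1` B]] >>.

(* k iterations of the method; x w t and Lb w t are x_t and Lbar_t in the
   outcome w. *)
Record acspg_run (P : probability Om R) (mu : probability Xi R)
    (X : set 'rV[R]_n)
    (F : 'rV[R]_n -> Xi -> R) (G : 'rV[R]_n -> Xi -> 'rV[R]_n)
    (Lbar0 : R) (est : estimator) (k : nat)
    (xi xibar : nat -> nat -> Om -> Xi) (b : Om -> nat -> nat) (b' : nat -> nat)
    (x0 : 'rV[R]_n) (x : Om -> nat -> 'rV[R]_n) (Lb : Om -> nat -> R)
    : Prop := ACSPGRun {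
  samples_iid : iid_with_law P mu (all_samples xi xibar) ;
  batch_gt0 : forall t w, (1 <= t <= k)%N -> (0 < b w t)%N ;
  batch_adapted : forall t N, (1 <= t <= k)%N ->
    drawn xi xibar b b' t.-1 [set w | b w t = N] ;
  est_batch_gt0 : forall t, (1 <= t <= k)%N -> (0 < b' t)%N ;
  start_in_domain : X x0 ;
  start : forall w, x w 0%N = x0 ;
  estimate_start : forall w, Lb w 0%N = Lbar0 ;
  iterate : forall t w, (1 <= t <= k)%N ->
    x w t = prox X (x w t.-1)
      ((b w t)%:R^-1 *: (\sum_(j < b w t) G (x w t.-1) (xi t j w)))%R
      (gam (Lb w) t) ;
  estimate_step : forall t w, (1 <= t <= k)%N ->
    Lb w t = estimate est Lbar0 (b' t)
      (fun j => curvature (F ^~ (xibar t j w)) (G ^~ (xibar t j w))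
                  (x w t) (x w t.-1))
}.

(* The index R(k): conditionally on all the samples drawn, it is t-1 with
   probability output_prob _ k t. Nothing is imposed on it when all the weights
   vanish, i.e. when there are k segments. *)
Record random_output (P : probability Om R) (k : nat)
    (xi xibar : nat -> nat -> Om -> Xi) (b : Om -> nat -> nat) (b' : nat -> nat)
    (Lb : Om -> nat -> R) (out : Om -> nat) : Prop := RandomOutput {
  output_measurable : forall N, measurable [set w | out w = N] ;
  output_law : forall t A, (2 <= t <= k)%N -> drawn xi xibar b b' k A ->
    P (A `&` [set w | out w = t.-1]) =
      \int[P]_(w in A) (output_prob (Lb w) k t)%:E
}.

(* |g_{X,R}|^2 in the outcome w. *)
Definition output_sqgrad (X : set 'rV[R]_n) (gradf : 'rV[R]_n -> 'rV[R]_n)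
    (x : Om -> nat -> 'rV[R]_n) (Lb : Om -> nat -> R) (out : Om -> nat)
    (w : Om) : R :=
  enorm (proj_grad X (x w (out w)) (gradf (x w (out w)))
           (gam (Lb w) (out w).+1)) ^+ 2.

End Method.

(* Main.v *)
Require Import Defs.
From HB Require Import structures.
From mathcomp Require Import all_boot all_order all_algebra.
From mathcomp Require Import finmap.
From mathcomp Require Import all_classical all_reals all_analysis.
From mathcomp Require Import measurable_realfun.
From mathcomp Require Import ring lra zify.

Set Implicit Arguments.
Unset Strict Implicit.
Unset Printing Implicit Defensive.

Import Order.TTheory GRing.Theory Num.Theory.
Import numFieldNormedType.Exports.

Local Open Scope classical_set_scope.
Local Open Scope ring_scope.

(** Fix an outcome. The optimality condition of step t, tested against a minimizer
z of f, bounds the gap f(x_t) - f(z); tested against x_(t-1), it is a descent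
inequality. The first plus I(t) - 1 copies of the second ([step_inequality]) make
the weighted gaps I(t) (f(x_t) - f(z)) telescope inside each segment, and the
terms gamma_t |x_t - z|^2 telescope because gamma is nondecreasing
([trajectory_inequality]). What the step gains pays for the squared projected
gradient with weight 3 I(t) / 16 - 1/4 and for a curvature along the step of up to
three times the running maximum of the estimates. What remains are the error of
the gradient estimate and the excess of the curvature over that maximum.

In expectation, the gradient error is centered and its square is at most
sigma^2 / b_t; that b_t is random does no harm, since it is fixed before the batch
is drawn ([gradient_error_mean]). If the curvature c is in excess, either the
estimate Lbar_t falls short of c, or it opens a new segment. In the first case the
loss is a multiple of c - Lbar_t; the curvature samples are drawn once the step is
known, so their mean is unbiased for c and the loss has nonpositive expectation
([curvature_gap_mean]). The second case costs the new maximum and half the length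
of the segment that ends. The maxima that open segments grow by factors 3/2 and
sum to at most 3 Lhat ([sum_runmax_first]); the lengths sum to at most k - m
([sum_closed_lengths]). When the estimate is the largest sample, an excess in the
interior of a segment requires all samples to be below c / 2, which has
probability at most beta^(b'_t) <= (k + 1)^(-2) ([all_underestimated]), and the
lengths disappear from the bound.

Conditioning on the past is done with Fubini's theorem for the product law of the
past and one sample ([ge0_integral_fresh]). This needs the iterates to be
measurable for the past; the oracle is measurable in the sample and continuous in
the point, so it can be evaluated at a random point
([measurable_fun_caratheodory]).

The output is x_(t-1) with conditional probability proportional to the weight of
iteration t over gamma_t, and M_k is the sum of these quotients, so multiplying by
M_k turns the squared gradient at the output into the weighted sum bounded before
([output_le_trajectory]). A lower bound for M_k, in which the closed segments are
amplified by the growth of the maximum ([Msum_lower]), then removes the factor. *)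

(** * Segments and the weights of the output *)

Section Segments.
Context {R : realType}.
Implicit Types (e : nat -> R) (t k i j : nat).

Lemma sum_nat1_recr (V : nmodType) (h : nat -> V) t :
  \sum_(1 <= s < t.+2) h s = \sum_(1 <= s < t.+1) h s + h t.+1.
Proof. by rewrite big_nat_recr. Qed.

Lemma runmaxP e t c : (runmax e t <= c) <-> (forall s, (s <= t)%N -> e s <= c).
Proof.
rewrite /runmax; split=> [h s st|h].
  apply: le_trans h; exact: (le_bigmax _ (fun i : 'I_t.+1 => e i) (Ordinal (st : (s < t.+1)%N))).
by apply: bigmax_le => [|i _]; apply: h => //; rewrite -ltnS.
Qed.

Lemma runmax_ge e s t : (s <= t)%N -> e s <= runmax e t.
Proof. by move=> st; have /runmaxP := lexx (runmax e t); exact. Qed.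

Lemma runmax0 e : runmax e 0 = e 0%N.
Proof.
apply/le_anti/andP; split; last exact: runmax_ge.
by apply/runmaxP => s; rewrite leqn0 => /eqP ->.
Qed.

Lemma runmaxS e t : runmax e t.+1 = Num.max (runmax e t) (e t.+1).
Proof.
apply/le_anti/andP; split.
  apply/runmaxP => s; rewrite leq_eqVlt => /predU1P[->|st].
    by rewrite le_max lexx orbT.
  by rewrite le_max runmax_ge.
by rewrite ge_max runmax_ge// andbT; apply/runmaxP => s st; apply: runmax_ge; exact: leqW.
Qed.

Lemma runmax_homo e : {homo runmax e : s t / (s <= t)%N >-> s <= t}.
Proof. by move=> s t st; apply/runmaxP => r rs; apply: runmax_ge; exact: leq_trans st. Qed.

Lemma runmax_gt0 e t : 0 < e 0%N -> 0 < runmax e t.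
Proof. by move=> e0; apply: lt_le_trans e0 (runmax_ge _ _). Qed.

Lemma gam_gt0 e t : 0 < e 0%N -> 0 < gam e t.
Proof. by move=> e0; rewrite /gam mulr_gt0// runmax_gt0. Qed.

Lemma gam_homo e : {homo gam e : s t / (s <= t)%N >-> s <= t}.
Proof. by move=> s t st; rewrite /gam ler_pM2l// runmax_homo// -!subn1 leq_sub2r. Qed.

Lemma new_segment_runmax e t : 0 < e 0%N -> new_segment e t -> runmax e t = e t.
Proof.
move=> e0 /andP[]; case: t => // t _ /=; have := runmax_gt0 t e0.
by rewrite runmaxS => r0 h; apply/max_idPr; lra.
Qed.

Lemma in_index_gt0 e t : (0 < t)%N -> (0 < in_index e t)%N.
Proof. by case: t => //= t _; case: ifP. Qed.

Lemma in_index_le e t : (in_index e t <= t)%N.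
Proof. by elim: t => //= t ih; case: ifP. Qed.

Lemma in_index_eq1 e t : in_index e t.+1 = 1%N -> (t.+1 = 1%N) \/ new_segment e t.+1.
Proof.
rewrite /=; case: ifP => [|_ [h]]; first by right.
by case: t h => [|t /= h]; [left|have := @in_index_gt0 e t.+1 isT; rewrite /= h].
Qed.

Lemma seg_index_gt0 e t : (0 < seg_index e t)%N.
Proof. by elim: t => //= t ih; rewrite addn_gt0 ih. Qed.

Lemma seg_index_homo e : {homo seg_index e : s t / (s <= t)%N >-> (s <= t)%N}.
Proof.
move=> s t; elim: t => [|t ih]; first by rewrite leqn0 => /eqP->.
rewrite leq_eqVlt => /predU1P[->//|/ih]/leq_trans; apply.
by rewrite /= leq_addr.
Qed.

Lemma seg_index_le e t : (0 < t)%N -> (seg_index e t <= t)%N.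
Proof.
elim: t => // -[//|t] /(_ isT) ih _.
by apply: leq_trans (leq_add ih (leq_b1 _)) _; rewrite addn1.
Qed.

(** The pair of a segment number and a position inside the segment grows
lexicographically along the run, so it determines the iteration. *)
Lemma segment_position_inj e s t : seg_index e s = seg_index e t ->
  in_index e s = in_index e t -> s = t.
Proof.
wlog st : s t / (s <= t)%N.
  by move=> h; case: (leqP s t) => [/h//|/ltnW/h h1 h2 h3]; rewrite h1.
move: st; rewrite leq_eqVlt => /predU1P[//|st] sE iE; exfalso.
suff : (in_index e s < in_index e t)%N by rewrite iE ltnn.
elim: t st sE {iE} => // t ih; rewrite ltnS leq_eqVlt => /predU1P[->|st] /=.
  by case: new_segment => //; rewrite ?addn1 ?addn0 => // /eqP; lia.
have := seg_index_homo e (ltnW st).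
case: ifP => [nt|nt]; first by lia.
by rewrite addn0 => _ /(ih st) /ltnW.
Qed.

Lemma iteration_ofE e k t : (t <= k)%N ->
  iteration_of e k (seg_index e t) (in_index e t) = t.
Proof.
move=> tk; rewrite /iteration_of.
set a := (fun _ => _).
have ha : has a (iota 0 k.+1) by apply/hasP; exists t; rewrite /a ?eqxx// mem_iota.
have := nth_find 0%N ha; rewrite /a => /andP[/eqP h1 /eqP h2].
have hf : (find a (iota 0 k.+1) < k.+1)%N by rewrite has_find size_iota in ha.
rewrite nth_iota// add0n in h1 h2.
exact: segment_position_inj h1 h2.
Qed.

Lemma seg_lengthS e t i : seg_length e t.+1 i =
  (seg_length e t i + (seg_index e t.+1 == i))%N.
Proof. by rewrite /seg_length big_nat_recr. Qed.

Lemma seg_length0 e i : seg_length e 0 i = 0%N.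
Proof. by rewrite /seg_length big_geq. Qed.

Lemma seg_length_future e t i : (seg_index e t < i)%N -> seg_length e t i = 0%N.
Proof.
elim: t => [|t ih] ti; first exact: seg_length0.
rewrite seg_lengthS ih; last by apply: leq_ltn_trans ti; exact: seg_index_homo.
by rewrite (ltn_eqF ti).
Qed.

Lemma seg_length_current e t : seg_length e t (seg_index e t) = in_index e t.
Proof.
elim: t => [|t ih]; first by rewrite seg_length0.
rewrite seg_lengthS eqxx addn1 /=; case: ifP => nt; last by rewrite addn0 ih.
by rewrite addn1 seg_length_future.
Qed.

(** The double sum over segments and positions enumerates each iteration once,
except for the first iteration of every segment. *)
Lemma sum_segments e (phi : nat -> nat -> R) t :
  \sum_(1 <= i < (seg_index e t).+1) \sum_(2 <= j < (seg_length e t i).+1) phi i j =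
  \sum_(1 <= s < t.+1)
    (if (2 <= in_index e s)%N then phi (seg_index e s) (in_index e s) else 0).
Proof.
elim: t => [|t ih].
  by rewrite [RHS]big_geq// big_nat1 seg_length0 big_geq.
rewrite [RHS]big_nat_recr//= -ih.
have S0 := seg_index_gt0 e t.
have [nt|/negbTE nt] := boolP (new_segment e t.+1); rewrite ?nt.
  rewrite addn1 addr0 big_nat_recr//= -[RHS]addr0; congr +%R.
    apply: eq_big_nat => i /andP[_ it]; rewrite seg_lengthS /= nt addn1.
    by rewrite gtn_eqF ?addn0.
  by rewrite seg_lengthS /= nt addn1 eqxx seg_length_future// big_geq.
rewrite addn0 big_nat_recr//= [in RHS]big_nat_recr//= -addrA; congr +%R.
  apply: eq_big_nat => i /andP[_ it]; rewrite seg_lengthS /= nt addn0.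
  by rewrite gtn_eqF ?addn0.
rewrite seg_lengthS /= nt addn0 eqxx seg_length_current addn1.
case: ltnP => h; first by rewrite big_nat_recr.
by rewrite addr0 !big_geq//; lia.
Qed.

Lemma MsumE e k : Msum e k = \sum_(1 <= t < k.+1) weight e t / gam e t.
Proof.
rewrite /Msum /num_segments.
rewrite (sum_segments e (fun i j => (3 * j%:R / 16 - 1 / 4) * (gam_seg e k i j)^-1)).
apply: eq_big_nat => t /andP[_ tk]; rewrite /weight /gam_seg iteration_ofE//.
by case: ifP; rewrite ?mul0r.
Qed.

Lemma weight_ge0 e t : 0 <= weight e t.
Proof.
rewrite /weight; case: ifP => // h.
have : (2 : R) <= (in_index e t)%:R by rewrite (ler_nat _ 2).
by lra.
Qed.

Lemma Msum_term_ge0 e t : 0 < e 0%N -> 0 <= weight e t / gam e t.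
Proof. by move=> e0; rewrite divr_ge0 ?weight_ge0// ltW// gam_gt0. Qed.

Lemma Msum_ge0 e k : 0 < e 0%N -> 0 <= Msum e k.
Proof. by move=> e0; rewrite MsumE sumr_ge0// => t _; exact: Msum_term_ge0. Qed.

(** State of the proof of the lower bound on [Msum] after iteration t.+1: c
counts the iterations of the closed segments other than their first ones, q is
what these contribute, and rho is the normalization of the closed segments,
which the open one exceeds by a factor 3/2. *)
Definition segment_budget e t (c : nat) (q rho : R) :=
  let a : R := (in_index e t.+1).-1%:R in
  [/\ (c + (in_index e t.+1).-1 + seg_index e t.+1 = t.+1)%N,
      c%:R ^+ 2 <= q * rho,
      [/\ 0 <= q, 0 <= rho <= runmax e t & 3 / 2 * rho <= runmax e t.+1],
      (1 < in_index e t.+1)%N -> 3 / 2 * rho <= runmax e t &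
      q + a * (3 * a + 1) / runmax e t <= 128 * Msum e t.+1 ].

(** Since the running maximum grows by a factor 3/2 at every new segment, the
contributions of the closed segments are amplified geometrically, and
(c + a)^2 <= 3/2 c^2 + 3 a^2 lets one segment at a time be absorbed. *)
Lemma segment_budget_close e t c q rho : 0 < e 0%N -> segment_budget e t c q rho ->
  (t.+1%:R - (seg_index e t.+1)%:R) ^+ 2 <= 128 * Msum e t.+1 * runmax e t.
Proof.
move=> e0 [cE cq [q0 /andP[rho0 rhoL] _] a0 qM].
have L0 := runmax_gt0 t e0.
have -> : t.+1%:R - (seg_index e t.+1)%:R = c%:R + (in_index e t.+1).-1%:R :> R.
  by rewrite -{1}cE !natrD; ring.
move: a0 qM; set a : R := _.-1%:R => a0 qM.
have {}qM : q * runmax e t + a * (3 * a + 1) <= 128 * Msum e t.+1 * runmax e t.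
  by rewrite -ler_pdivrMr// mulrDl mulfK ?gt_eqF.
apply: le_trans qM; have a_ge0 : 0 <= a by rewrite ler0n.
have [i1|i1] := ltnP 1 (in_index e t.+1).
  have := a0 i1; have c0 : 0 <= (c%:R : R) by rewrite ler0n.
  move=> h; have : 3 / 2 * c%:R ^+ 2 <= q * runmax e t by nra.
  have := sqr_ge0 (c%:R - 2 * a); nra.
have -> : a = 0 by rewrite /a; case: (in_index _ _) i1 => [|[]].
by nra.
Qed.

Lemma segment_budget_exists e t : 0 < e 0%N -> exists c q rho, segment_budget e t c q rho.
Proof.
move=> e0; elim: t => [|t [c [q [rho H]]]].
  exists 0%N, 0, 0; have := runmax_gt0 0 e0; have := runmax_gt0 1 e0.
  split=> //=; first by rewrite mulr0 lexx ltW// ltW.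
  by rewrite !mul0r addr0 mulr_ge0// Msum_ge0.
have L0 := runmax_gt0 t.+1 e0.
have LL := runmax_homo e (leqnSn t).
have hM := Msum_ge0 t.+1 e0.
have [nt|nt] := boolP (new_segment e t.+2).
  have h := segment_budget_close e0 H; have [cE _ _ _ _] := H.
  have i1 : in_index e t.+2 = 1%N by rewrite /= nt.
  have s1 : seg_index e t.+2 = (seg_index e t.+1).+1 by rewrite /= nt addn1.
  exists (c + (in_index e t.+1).-1)%N, (128 * Msum e t.+1), (runmax e t.+1).
  split; rewrite ?i1 ?s1//=.
  - by rewrite addn0 addnS cE.
  - have -> : (c + (in_index e t.+1).-1)%:R = t.+1%:R - (seg_index e t.+1)%:R :> R.
      by have := congr1 (fun j => j%:R : R) cE; rewrite !natrD => <-; ring.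
    by apply: le_trans h _; rewrite ler_wpM2l// mulr_ge0.
  - split; [by rewrite mulr_ge0|by rewrite lexx ltW|].
    by rewrite (new_segment_runmax e0 nt); move: nt => /andP[_ /ltW].
  - rewrite mul0r mul0r addr0 !MsumE [in leRHS]big_nat_recr//=.
    by rewrite ler_pM2l// lerDl Msum_term_ge0.
have [cE cq [q0 /andP[rho0 rhoL] rhoL'] _ qM] := H.
have i1 : in_index e t.+2 = (in_index e t.+1).+1 by rewrite /= (negbTE nt).
have s1 : seg_index e t.+2 = seg_index e t.+1 by rewrite /= (negbTE nt) addn0.
have i0 := @in_index_gt0 e t.+1 isT.
exists c, q, rho; split; rewrite ?i1 ?s1//.
- by rewrite succnK -[in LHS](prednK i0) addnS addSn cE.
- split=> //; first by rewrite rho0 (le_trans rhoL).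
  exact: le_trans rhoL' (runmax_homo e (leqnSn _)).
- move: qM; rewrite !MsumE [in X in _ -> X]big_nat_recr//.
  have -> : weight e t.+2 = 3 * ((in_index e t.+1).-1%:R + 2) / 16 - 1 / 4.
    by rewrite /weight i1 ltnS i0 -{1}(prednK i0) -[_.-1.+2]addn2 natrD.
  rewrite succnK (_ : (in_index e t.+1)%:R = (in_index e t.+1).-1%:R + 1); last first.
    by rewrite -[in LHS](prednK i0) -addn1 natrD.
  rewrite /gam succnK; set a : R := _.-1%:R; set S := \sum_(_ <= _ < _) _.
  have a_ge0 : 0 <= a by rewrite ler0n.
  move=> qM.
  have : a * (3 * a + 1) / runmax e t.+1 <= a * (3 * a + 1) / runmax e t.
    rewrite ler_wpM2l ?lef_pV2 ?posrE ?runmax_gt0//; nra.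
  have -> : (a + 1) * (3 * (a + 1) + 1) / runmax e t.+1 =
    a * (3 * a + 1) / runmax e t.+1 +
    128 * ((3 * (a + 2) / 16 - 1 / 4) / (4 * runmax e t.+1)).
    by field; rewrite gt_eqF.
  by move=> h; rewrite [leRHS](mulrDr _ S); lra.
Qed.

Lemma Msum_lower e k : 0 < e 0%N -> (1 <= k)%N ->
  (k%:R - (num_segments e k)%:R) ^+ 2 / (128 * runmax e k.-1) <= Msum e k.
Proof.
case: k => // t e0 _ /=; have [c [q [rho H]]] := segment_budget_exists t e0.
have := segment_budget_close e0 H; rewrite /num_segments.
rewrite ler_pdivrMr; last by rewrite mulr_gt0// runmax_gt0.
by rewrite [X in _ -> _ <= X]mulrCA mulrA.
Qed.

(** Every new segment opens above 3/2 of the previous maximum, so the maxima at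
which the segments open are dominated by a geometric series. *)
Lemma sum_runmax_first e T : 0 < e 0%N ->
  \sum_(1 <= t < T.+1) (if in_index e t == 1%N then runmax e t else 0)
    <= 3 * runmax e T.
Proof.
move=> e0; have L0 t := runmax_gt0 t e0.
elim: T => [|T ih]; first by rewrite big_geq// mulr_ge0// ltW.
rewrite big_nat_recr//; have LL := runmax_homo e (leqnSn T).
have [nt|nt] := boolP (new_segment e T.+1).
  have -> : in_index e T.+1 == 1%N by rewrite /= nt.
  move: nt (new_segment_runmax e0 nt) => /andP[_ /=]; have := L0 T; lra.
case: ifPn => [/eqP/in_index_eq1[[T0]|]|_]; rewrite ?(negbTE nt)//; last by simpl; lra.
by rewrite T0 big_geq//=; have := L0 1%N; lra.
Qed.

(** Every iteration either starts a segment or adds 1 to the length of its own. *)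
Lemma sum_closed_lengths e T : (0 < T)%N ->
  (\sum_(1 <= t < T.+1) (if new_segment e t then (in_index e t.-1).-1 else 0)
    + (in_index e T).-1 + seg_index e T = T)%N.
Proof.
elim: T => // -[|T] ih _; first by rewrite big_nat1.
rewrite big_nat_recr//=; have := ih isT; have := @in_index_gt0 e T.+1 isT.
rewrite /=; set I := (if _ then 1%N else _); set S := (\sum_(_ <= _ < _) _)%N.
by case: (new_segment e T.+2); case: (new_segment e T.+1) => /=; lia.
Qed.

End Segments.

(** * Euclidean norm and projections *)

Section EuclideanSpace.
Context {R : realType} {n : nat}.
Implicit Types (x y u v w g : 'rV[R]_n) (X : set 'rV[R]_n) (c : R).

Lemma dotpC u v : dotp u v = dotp v u.
Proof. by apply: eq_bigr => i _; rewrite mulrC. Qed.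

Lemma dotpDl u v w : dotp (u + v) w = dotp u w + dotp v w.
Proof. by rewrite /dotp -big_split; apply: eq_bigr => i _; rewrite mxE mulrDl. Qed.

Lemma dotpZl c u v : dotp (c *: u) v = c * dotp u v.
Proof. by rewrite /dotp mulr_sumr; apply: eq_bigr => i _; rewrite mxE mulrA. Qed.

Lemma dotpDr u v w : dotp w (u + v) = dotp w u + dotp w v.
Proof. by rewrite !(dotpC w) dotpDl. Qed.

Lemma dotpZr c u v : dotp v (c *: u) = c * dotp v u.
Proof. by rewrite !(dotpC v) dotpZl. Qed.

Lemma dotpNl u v : dotp (- u) v = - dotp u v.
Proof. by rewrite -scaleN1r dotpZl mulN1r. Qed.

Lemma dotpNr u v : dotp v (- u) = - dotp v u.
Proof. by rewrite !(dotpC v) dotpNl. Qed.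

Lemma dotpBl u v w : dotp (u - v) w = dotp u w - dotp v w.
Proof. by rewrite dotpDl dotpNl. Qed.

Definition dotpE := (dotpDl, dotpDr, dotpNl, dotpNr, dotpZl, dotpZr).

Lemma dotp0l u : dotp 0 u = 0.
Proof. by rewrite -[0](scale0r u) dotpZl mul0r. Qed.

Lemma dotp0r u : dotp u 0 = 0.
Proof. by rewrite dotpC dotp0l. Qed.

Lemma dotp_sumr I (s : seq I) (P : pred I) (h : I -> 'rV[R]_n) u :
  dotp u (\sum_(i <- s | P i) h i) = \sum_(i <- s | P i) dotp u (h i).
Proof. by elim/big_rec2: _ => [|i a b _ <-]; rewrite ?dotp0r// dotpDr. Qed.

Lemma dotp_suml I (s : seq I) (P : pred I) (h : I -> 'rV[R]_n) u :
  dotp (\sum_(i <- s | P i) h i) u = \sum_(i <- s | P i) dotp (h i) u.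
Proof. by rewrite dotpC dotp_sumr; apply: eq_bigr => i _; rewrite dotpC. Qed.

Lemma dotpp_ge0 u : 0 <= dotp u u.
Proof. by apply: sumr_ge0 => i _; rewrite -expr2 sqr_ge0. Qed.

Lemma enorm_ge0 u : 0 <= enorm u.
Proof. exact: sqrtr_ge0. Qed.

Lemma enorm2E u : enorm u ^+ 2 = dotp u u.
Proof. by rewrite sqr_sqrtr// dotpp_ge0. Qed.

Lemma enorm0 : enorm (0 : 'rV[R]_n) = 0.
Proof. by rewrite /enorm dotp0l sqrtr0. Qed.

Lemma enormN u : enorm (- u) = enorm u.
Proof. by rewrite /enorm dotpNl dotpNr opprK. Qed.

Lemma enormC u v : enorm (u - v) = enorm (v - u).
Proof. by rewrite -enormN opprB. Qed.

Lemma enorm_le u c : 0 <= c -> (enorm u <= c) = (dotp u u <= c ^+ 2).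
Proof. by move=> c0; rewrite -enorm2E ler_pXn2r// ?nnegrE// enorm_ge0. Qed.

Lemma enorm_gt0 u : u != 0 -> 0 < dotp u u.
Proof.
move=> u0; rewrite lt_neqAle dotpp_ge0 andbT eq_sym.
apply: contra u0; rewrite /dotp psumr_eq0; last by move=> i _; rewrite -expr2 sqr_ge0.
move=> /allP h; apply/eqP/rowP => i; rewrite mxE.
by have := h i (mem_index_enum i); rewrite mulf_eq0 orbb => /eqP.
Qed.

Lemma enorm_eq0 u : (enorm u ^+ 2 == 0) = (u == 0).
Proof.
apply/idP/eqP => [|->]; last by rewrite enorm0 expr0n.
by rewrite enorm2E; apply: contraTeq => /enorm_gt0; exact: lt0r_neq0.
Qed.

Lemma dotp_young c u v : 0 < c ->
  dotp u v <= c / 2 * enorm u ^+ 2 + (2 * c)^-1 * enorm v ^+ 2.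
Proof.
move=> c0; have := dotpp_ge0 (c *: u - v).
have -> : dotp (c *: u - v) (c *: u - v) =
    c ^+ 2 * dotp u u - 2 * c * dotp u v + dotp v v.
  by rewrite !dotpE (dotpC v u); ring.
rewrite !enorm2E => h; rewrite -subr_ge0.
have -> : c / 2 * dotp u u + (2 * c)^-1 * dotp v v - dotp u v =
    (c ^+ 2 * dotp u u - 2 * c * dotp u v + dotp v v) / (2 * c).
  by field; rewrite gt_eqF.
by rewrite divr_ge0// mulr_ge0// ltW.
Qed.

Lemma cauchy_schwarz u v : dotp u v <= enorm u * enorm v.
Proof.
have [->|v0] := eqVneq v 0; first by rewrite dotp0r enorm0 mulr0.
have [->|u0] := eqVneq u 0; first by rewrite dotp0l enorm0 mul0r.
have pu : 0 < enorm u by rewrite sqrtr_gt0 enorm_gt0.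
have pv : 0 < enorm v by rewrite sqrtr_gt0 enorm_gt0.
have := dotp_young u v (divr_gt0 pv pu).
have -> : enorm v / enorm u / 2 * enorm u ^+ 2 +
  (2 * (enorm v / enorm u))^-1 * enorm v ^+ 2 = enorm u * enorm v by field; rewrite !gt_eqF.
by [].
Qed.

Lemma enormD u v : enorm (u + v) <= enorm u + enorm v.
Proof.
rewrite enorm_le ?addr_ge0 ?enorm_ge0// !dotpE sqrrD !enorm2E (dotpC v u).
by have := cauchy_schwarz u v; lra.
Qed.

Lemma enormD2 u v : enorm (u + v) ^+ 2 <= 2 * enorm u ^+ 2 + 2 * enorm v ^+ 2.
Proof. by rewrite !enorm2E; have := dotpp_ge0 (u - v); rewrite !dotpE (dotpC v u); lra. Qed.

Lemma coord_le_enorm u (i : 'I_n) : `|u 0 i| <= enorm u.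
Proof.
rewrite -(@ler_pXn2r _ 2)// ?nnegrE ?enorm_ge0//.
rewrite enorm2E real_normK ?num_real// /dotp (bigD1 i)//= -expr2 lerDl.
by apply: sumr_ge0 => j _; rewrite -expr2 sqr_ge0.
Qed.

Lemma nbhs_enorm x (A : set 'rV[R]_n) : nbhs x A ->
  exists2 d : R, 0 < d & forall y, enorm (y - x) < d -> A y.
Proof.
move=> /nbhs_ballP[d /= d0 dA]; exists d => // y yd; apply: dA.
split=> // i j; rewrite (ord1 i) /ball /= distrC.
by apply: le_lt_trans yd; have := coord_le_enorm (y - x) j; rewrite !mxE.
Qed.

Lemma enorm_continuous : continuous (@enorm R n).
Proof.
have cd : continuous (fun v : 'rV[R]_n => dotp v v).
  apply: continuous_big => [|i _ v]; first exact: add_continuous.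
  by have cv := @coord_continuous R 1 n 0 i v; exact: (cvgM cv cv).
by move=> u; apply: continuous_comp; [exact: cd|exact: sqrt_continuous].
Qed.

(** Continuity at x relative to X, measured with the Euclidean norm. *)
Definition continuous_on_at X (h : 'rV[R]_n -> R) x :=
  forall e : R, 0 < e -> exists2 d : R, 0 < d &
    forall y, X y -> enorm (y - x) < d -> `|h y - h x| < e.

Lemma continuous_on_within X h :
  (forall x, X x -> continuous_on_at X h x) -> {within X, continuous h}.
Proof.
move=> ch; apply/subspace_continuousP => x Xx; apply/cvgrPdist_lt => e e0.
have [d d0 dh] := ch x Xx e e0.
rewrite near_withinE; near=> y => Xy; rewrite distrC; apply: dh => //.
near: y.
have cs : continuous (fun y : 'rV[R]_n => y - x).
  by move=> y; exact: (cvgB cvg_id (cvg_cst _)).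
have /cvgrPdist_lt/(_ d d0) : enorm (y - x) @[y --> x] --> enorm (x - x).
  exact: (continuous_comp (cs x) (@enorm_continuous _)).
rewrite subrr enorm0.
apply: filterS => z; rewrite sub0r normrN ger0_norm// enorm_ge0.
Unshelve. all: by end_near. Qed.

Lemma lipschitz_continuous_on X h (K : R) x :
  (forall y, X y -> `|h y - h x| <= K * enorm (y - x)) -> continuous_on_at X h x.
Proof.
move=> hK e e0; have K0 : 0 < `|K| + 1 by rewrite ltr_wpDl.
exists (e / (`|K| + 1)); first exact: divr_gt0.
move=> y Xy yd; apply: le_lt_trans (hK y Xy) _.
have := enorm_ge0 (y - x); move: yd; rewrite ltr_pdivlMr// => yd p.
by have := ler_norm K; nra.
Qed.

Lemma continuous_on_argmin X h : X !=set0 -> compact X ->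
  (forall x, X x -> continuous_on_at X h x) ->
  exists2 x, X x & forall y, X y -> h x <= h y.
Proof.
move=> X0 cX ch; have [x] := EVT_min_rV X0 cX (continuous_on_within ch).
by rewrite inE => Xx hx; exists x => // y Xy; apply: hx; rewrite inE.
Qed.

Lemma enorm_dist_lipschitz p x y : `|enorm (p - y) - enorm (p - x)| <= 1 * enorm (y - x).
Proof.
rewrite mul1r ler_norml; apply/andP; split.
  have := enormD (p - y) (y - x); rewrite addrA subrK; lra.
by have := enormD (p - x) (x - y); rewrite addrA subrK (enormC x y); lra.
Qed.

Lemma le_diam X x y : compact X -> X x -> X y -> enorm (x - y) <= diam X.
Proof.
move=> cX Xx Xy; have X0 : X !=set0 by exists x.
have [z _ zmin] : exists2 z, X z & forall u, X u -> - enorm (x - z) <= - enorm (x - u).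
  apply: continuous_on_argmin => // u Xu; apply: (@lipschitz_continuous_on _ _ 1) => v _.
  by rewrite -opprD normrN; exact: enorm_dist_lipschitz.
apply: sup_upper_bound; last by exists x, y.
split; first by exists (enorm (x - y)), x, y.
exists (enorm (x - z) + enorm (x - z)) => _ [u [v [Xu Xv ->]]].
have := zmin u Xu; have := zmin v Xv; have := enormD (u - x) (x - v).
by rewrite addrA subrK (enormC u x); lra.
Qed.

Lemma diam_ge0 X : compact X -> X !=set0 -> 0 <= diam X.
Proof. by move=> cX [x Xx]; apply: le_trans (le_diam cX Xx Xx); exact: enorm_ge0. Qed.

(** A first-order expansion on X forces continuity on X. *)
Lemma gradient_continuous_on X f gradf x :
  is_gradient_on X f gradf -> X x -> continuous_on_at X f x.
Proof.
move=> df Xx e e0; have [d d0 hd] := nbhs_enorm (df x Xx 1 ltr01).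
have K0 : 0 < enorm (gradf x) + 1 by rewrite ltr_wpDl// enorm_ge0.
exists (Num.min d (e / (enorm (gradf x) + 1))); first by rewrite lt_min d0 divr_gt0.
move=> y Xy; rewrite lt_min ltr_pdivlMr// => /andP[/hd/(_ Xy) h1 h2].
rewrite mul1r in h1.
have := ler_normD (f y - f x - dotp (gradf x) (y - x)) (dotp (gradf x) (y - x)).
rewrite subrK => /le_lt_trans; apply; apply: le_lt_trans (lerD h1 (lexx _)) _.
suff : `|dotp (gradf x) (y - x)| <= enorm (gradf x) * enorm (y - x) by lra.
rewrite ler_norml cauchy_schwarz andbT lerNl -dotpNl -(enormN (gradf x)).
exact: cauchy_schwarz.
Qed.

End EuclideanSpace.

Section Projection.
Context {R : realType} {n : nat} (X : set 'rV[R]_n).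
Hypotheses (X0 : X !=set0) (cX : compact X)
  (convX : convex_set (X : set (convex_lmodType 'rV[R]_n))).
Implicit Types (x y u v w g p q : 'rV[R]_n) (c : R).

Definition euclid_proj p : 'rV[R]_n :=
  xget 0 [set u | X u /\ forall v, X v -> enorm (p - u) <= enorm (p - v)].

Lemma projP p : X (euclid_proj p) /\ forall v, X v -> enorm (p - euclid_proj p) <= enorm (p - v).
Proof.
have [z Xz zm] : exists2 z, X z & forall v, X v -> enorm (p - z) <= enorm (p - v).
  apply: continuous_on_argmin => // u Xu.
  by apply: (@lipschitz_continuous_on _ _ _ _ 1) => v _; exact: enorm_dist_lipschitz.
by rewrite /euclid_proj; case: xgetP => [u -> []//|/(_ z)[]].
Qed.

Lemma proj_in p : X (euclid_proj p). Proof. by have [] := projP p. Qed.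

Lemma segment_in u v (t : R) : 0 <= t <= 1 -> X u -> X v -> X (u + t *: (v - u)).
Proof.
move=> t01 Xu Xv; have t_ : Itv.spec (@Itv.num_sem R) (Itv.Real `[0%Z, 1%Z]) t.
  by rewrite /Itv.spec /= /Itv.num_sem num_real /= in_itv /=.
have := @convX v u (Itv.mk t_); rewrite !inE => /(_ Xv Xu).
rewrite /conv /= /isConvexSpace.conv /=.
by rewrite /unstable.onem scalerBl scale1r scalerBr addrCA.
Qed.

(** Otherwise a short step from the projection towards v would come closer to p. *)
Lemma proj_obtuse p v : X v -> dotp (p - euclid_proj p) (v - euclid_proj p) <= 0.
Proof.
move=> Xv; have [Xz zm] := projP p; set z := euclid_proj p in Xz zm *.
rewrite leNgt; apply/negP => a0; set a := dotp _ _ in a0.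
have vz0 : 0 <= dotp (v - z) (v - z) by exact: dotpp_ge0.
(* a step towards v small enough for its first-order gain to win *)
pose t := a / (a + dotp (v - z) (v - z)).
have pd : 0 < a + dotp (v - z) (v - z) by rewrite ltr_wpDr.
have t0 : 0 < t by rewrite divr_gt0.
have t1 : t <= 1 by rewrite ler_pdivrMr// mul1r lerDl.
have := zm _ (segment_in (introT andP (conj (ltW t0) t1)) Xz Xv).
rewrite enorm_le ?enorm_ge0// enorm2E opprD addrA.
have -> : dotp (p - z - t *: (v - z)) (p - z - t *: (v - z)) =
    dotp (p - z) (p - z) - 2 * t * a + t * (t * dotp (v - z) (v - z)).
  by rewrite /a; move: (p - z) (v - z) => y w; rewrite !dotpE (dotpC w y); ring.
have : t * (a + dotp (v - z) (v - z)) = a by rewrite mulfVK// gt_eqF.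
by move: (dotp (v - z) _) vz0 {pd t1} => d vz0 tE h; clearbody t; nra.
Qed.

Lemma proj_nonexpansive p q : enorm (euclid_proj p - euclid_proj q) <= enorm (p - q).
Proof.
have := proj_obtuse p (proj_in q); have := proj_obtuse q (proj_in p).
set a := euclid_proj p; set b := euclid_proj q => h1 h2.
rewrite enorm_le ?enorm_ge0// enorm2E.
have := dotpp_ge0 ((p - q) - (a - b)).
move: h1 h2; rewrite !dotpE !(dotpC b) !(dotpC a) !(dotpC q p); lra.
Qed.

Lemma proj_id p : X p -> euclid_proj p = p.
Proof.
move=> Xp; have [_ /(_ p Xp)] := projP p; rewrite subrr enorm0 => h.
by apply/esym/subr0_eq/eqP; rewrite -enorm_eq0 expf_eq0/= eq_le h enorm_ge0.
Qed.

(** Completing the square: the prox-mapping is the projection of a gradient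
step. *)
Lemma prox_proj x g c : 0 < c -> prox X x g c = euclid_proj (x - c^-1 *: g).
Proof.
move=> c0; rewrite /prox /euclid_proj; congr (xget 0 _); apply/seteqP.
set p := x - _; have E u : dotp g u + c / 2 * enorm (x - u) ^+ 2 =
    c / 2 * enorm (p - u) ^+ 2 + (dotp g x - (2 * c)^-1 * dotp g g).
  rewrite /p !enorm2E !dotpE !(dotpC u) !(dotpC g); field; exact: lt0r_neq0.
have H u v : (dotp g u + c / 2 * enorm (x - u) ^+ 2 <=
    dotp g v + c / 2 * enorm (x - v) ^+ 2) = (enorm (p - u) <= enorm (p - v)).
  by rewrite !E lerD2r ler_pM2l ?divr_gt0// ler_pXn2r ?nnegrE ?enorm_ge0.
by split=> u [Xu hu]; split=> // v Xv; move: (hu v Xv); rewrite H.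
Qed.

Lemma prox_in x g c : 0 < c -> X (prox X x g c).
Proof. by move=> c0; rewrite prox_proj//; exact: proj_in. Qed.

(** The obtuse angle at the projection is the strong convexity of the objective at
its minimizer. *)
Lemma prox_three_point x g c v : 0 < c -> X v ->
  dotp g (prox X x g c - v) + c / 2 * enorm (x - prox X x g c) ^+ 2 +
    c / 2 * enorm (prox X x g c - v) ^+ 2 <= c / 2 * enorm (x - v) ^+ 2.
Proof.
move=> c0 Xv; rewrite prox_proj//; have := proj_obtuse (x - c^-1 *: g) Xv.
set z := euclid_proj _ => h; rewrite -subr_ge0.
suff -> : c / 2 * enorm (x - v) ^+ 2 - (dotp g (z - v) + c / 2 * enorm (x - z) ^+ 2 +
    c / 2 * enorm (z - v) ^+ 2) = - (c * dotp (x - c^-1 *: g - z) (v - z)).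
  by rewrite oppr_ge0 pmulr_rle0.
by rewrite !enorm2E !dotpE !(dotpC v) !(dotpC z) ?(dotpC g x); field; exact: lt0r_neq0.
Qed.

Lemma prox_lipschitz x g g' c : 0 < c ->
  enorm (prox X x g c - prox X x g' c) <= c^-1 * enorm (g - g').
Proof.
move=> c0; rewrite !prox_proj//; apply: le_trans (proj_nonexpansive _ _) _.
rewrite opprB addrC addrA subrK -scalerN -scalerDr addrC.
rewrite enorm_le; last by rewrite mulr_ge0 ?enorm_ge0// invr_ge0 ltW.
by rewrite dotpZl dotpZr exprMn enorm2E mulrA -expr2 !dotpE (dotpC g' g); lra.
Qed.

End Projection.

(** * Descent along a trajectory *)

Section Trajectory.
Context {R : realType} {n : nat}.
Variables (X : set 'rV[R]_n) (f : 'rV[R]_n -> R) (gradf : 'rV[R]_n -> 'rV[R]_n)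
  (L l : R).
Hypothesis Hproblem : smooth_problem X f gradf L l.
Implicit Types (x y z : 'rV[R]_n) (xs gs : nat -> 'rV[R]_n) (e : nat -> R).

Lemma objective_argmin : X !=set0 -> exists2 z, X z & forall y, X y -> f z <= f y.
Proof.
move=> X0; apply: continuous_on_argmin => //; first exact: domain_compact Hproblem.
by move=> x Xx; apply: gradient_continuous_on Xx; exact: objective_gradient Hproblem.
Qed.

Lemma curvatureK (h : 'rV[R]_n -> R) (gradh : 'rV[R]_n -> 'rV[R]_n) x y :
  curvature h gradh x y * enorm (x - y) ^+ 2 =
  2 * (h x - h y - dotp (gradh y) (x - y)).
Proof.
have [->|xy] := eqVneq x y; first by rewrite !subrr enorm0 dotp0r subrr !mulr0 expr0n mulr0.
by rewrite /curvature divfK// enorm_eq0 subr_eq0.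
Qed.

(** What the curvature along step t costs when the running maximum does not
dominate it: in the interior of a segment gamma_t = 4 runmax absorbs curvatures
up to 3 runmax. *)
Definition curvature_excess e (c : R) t : R :=
  if in_index e t == 1%N then Num.max 0 c
  else (in_index e t)%:R * Num.max 0 (c - 3 * runmax e t.-1).

(** The error of the gradient estimate moves the step by at most delta/gamma, so
the exact projected gradient is controlled by the step taken. *)
Lemma proj_grad_le x g g' c : X x -> 0 < c ->
  enorm (proj_grad X x g c) ^+ 2 / c <=
  2 * (c * enorm (prox X x g' c - x) ^+ 2) + 2 * (enorm (g' - g) ^+ 2 / c).
Proof.
move=> Xx c0; have X0 : X !=set0 by exists x.
have cX := domain_compact Hproblem; have cvX := domain_convex Hproblem.
rewrite /proj_grad enorm2E dotpZl dotpZr -enorm2E.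
set p := prox X x g c; set p' := prox X x g' c.
have h1 : enorm (x - p) ^+ 2 <= 2 * enorm (p' - x) ^+ 2 + 2 * enorm (p' - p) ^+ 2.
  have := enormD2 (x - p') (p' - p); rewrite addrA subrK enormC => h.
  by rewrite (enormC p' x) in h *.
have h2 : enorm (p' - p) ^+ 2 <= c ^- 2 * enorm (g' - g) ^+ 2.
  have := prox_lipschitz X0 cX cvX x g' g c0; rewrite -/p -/p' => h.
  rewrite -exprVn -exprMn ler_pXn2r ?nnegrE ?enorm_ge0//.
  by rewrite mulr_ge0 ?enorm_ge0// invr_ge0 ltW.
have -> : c * (c * enorm (x - p) ^+ 2) / c = c * enorm (x - p) ^+ 2.
  by field; exact: lt0r_neq0.
have -> : 2 * (enorm (g' - g) ^+ 2 / c) = c * (2 * (c ^- 2 * enorm (g' - g) ^+ 2)).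
  by field; exact: lt0r_neq0.
by rewrite (mulrCA 2 c) -mulrDr ler_pM2l//; lra.
Qed.

(** One iteration. The optimality condition of the step, tested against z and
against the previous iterate x, gives a bound on the gap f - f(z) and a descent
inequality; they are added with weights 1 and I(t) - 1. *)
Lemma step_inequality e t x z g (c := gam e t) (x' := prox X x g c)
    (delta := g - gradf x) : 0 < e 0%N -> (0 < t)%N -> X x -> X z ->
  (in_index e t)%:R * (f x' - f z) - ((in_index e t)%:R - 1) * (f x - f z) +
    weight e t / c * enorm (proj_grad X x (gradf x) c) ^+ 2 <=
  l / 2 * enorm (x - z) ^+ 2
  + c / 2 * (enorm (x - z) ^+ 2 - enorm (x' - z) ^+ 2)
  - dotp delta (x - z) + noise_coef e t * (enorm delta ^+ 2 / c)
  + curvature_excess e (curvature f gradf x' x) t * enorm (x' - x) ^+ 2 / 2.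
Proof.
move=> e0 t0 Xx Xz; have c0 : 0 < c by exact: gam_gt0.
have X0 : X !=set0 by exists x.
have cX := domain_compact Hproblem; have cvX := domain_convex Hproblem.
have h1 := prox_three_point X0 cX cvX x g c0 Xz.
have h2 := prox_three_point X0 cX cvX x g c0 Xx.
have h3 := curvatureK f gradf x' x.
have h4 := lower_curvature Hproblem Xz Xx.
have h6 := proj_grad_le (gradf x) g Xx c0.
rewrite -/x' in h1 h2 h6; rewrite -/delta in h6.
have gE v : dotp g v = dotp (gradf x) v + dotp delta v.
  by rewrite -dotpDl addrCA subrr addr0.
have E1 v : dotp v (x' - z) = dotp v (x' - x) + dotp v (x - z).
  by rewrite -dotpDr addrA subrK.
have E2 : z - x = - (x - z) by rewrite opprB.
rewrite (enormC z x) E2 dotpNr in h4; rewrite gE !E1 in h1.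
rewrite gE (enormC x x') subrr enorm0 expr0n mulr0 in h2; rewrite (enormC x x') in h1.
have I0 := in_index_gt0 e t0.
have y1 (eta : R) : 0 < eta -> - dotp delta (x' - x) <=
    (2 * eta)^-1 * (enorm delta ^+ 2 / c) + eta / 2 * (c * enorm (x' - x) ^+ 2).
  move=> eta0; have ec0 : 0 < (eta * c)^-1 by rewrite invr_gt0 mulr_gt0.
  have := dotp_young (- delta) (x' - x) ec0; rewrite enormN dotpNl.
  by congr (_ <= _ + _); field; rewrite !lt0r_neq0.
move: h1 h2 h3 h4 h6.
move: (dotp (gradf x) (x' - x)) (dotp (gradf x) (x - z)) (dotp delta (x - z)) y1 => A B C.
move: (dotp delta (x' - x)) (enorm (x' - x) ^+ 2) (sqr_ge0 (enorm (x' - x))) => E r r0.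
move: (enorm (x - z) ^+ 2) (enorm (x' - z) ^+ 2) => d d'.
move: (enorm delta ^+ 2 / c) (divr_ge0 (sqr_ge0 (enorm delta)) (ltW c0)) => s s0.
move: (enorm (proj_grad _ _ _ _) ^+ 2) => gg y1 h1 h2 h3 h4 h6.
set kap := curvature f gradf x' x in h3 *.
have -> : weight e t / c * gg = weight e t * (gg / c) by rewrite mulrAC mulrA.
rewrite /curvature_excess /weight /noise_coef.
have [i1|i1] := eqVneq (in_index e t) 1%N.
  rewrite i1 /= mul0r.
  have hk : kap * r <= Num.max 0 kap * r by rewrite ler_wpM2r// le_max lexx orbT.
  have := y1 1 ltr01; have : 0 <= (in_index e t.-1)%:R * s by rewrite mulr_ge0.
  by move: (Num.max 0 kap) hk => kp hk; lra.
have nt : in_index e t = (in_index e t.-1).+1.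
  by case: t t0 i1 {c c0 x' h1 h2 h3 h4 h6 y1 I0 kap E1 E2 gE s s0} => //= t _; case: ifP.
have i2 : (2 <= in_index e t)%N by rewrite ltn_neqAle eq_sym i1.
rewrite i2 nt -natr1.
have : (1 : R) <= (in_index e t.-1)%:R by rewrite (ler_nat _ 1) -ltnS -nt.
have cE : c = 4 * runmax e t.-1 by [].
move: (in_index e t.-1)%:R => j j1.
have hk : kap * r <= (3 / 4 * c + Num.max 0 (kap - 3 * runmax e t.-1)) * r.
  rewrite ler_wpM2r// cE; set M := Num.max _ _.
  have : kap - 3 * runmax e t.-1 <= M by rewrite le_max lexx orbT.
  lra.
move: (Num.max 0 _) hk => M hk.
have := y1 2^-1; rewrite invr_gt0 => /(_ ltac:(by [])) y.
(* With I(t) = j + 1 and r the squared step, the step gains (j + 1/2) c r. Per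
   unit of I(t), 3/8 pays for the curvature, 1/4 for the error term of Young's
   inequality, and the rest, 3/8 I(t) - 1/2, is twice the weight of the projected
   gradient. *)
have D : j * (f x' - f x) <= j * (- E - c * r + kap * r / 2).
  by rewrite ler_wpM2l//; lra.
have Y : (j + 1) * - E <= (j + 1) * (s + c * r / 4) by rewrite ler_wpM2l//; lra.
have K : (j + 1) * (kap * r) <= (j + 1) * ((3 / 4 * c + M) * r) by rewrite ler_wpM2l//; lra.
have G : (3 * (j + 1) / 16 - 1 / 4) * (gg / c) <=
    (3 * (j + 1) / 16 - 1 / 4) * (2 * (c * r) + 2 * s) by rewrite ler_wpM2l//; lra.
lra.
Qed.

(** The terms telescope inside a segment; the gap left over where a segment ends has
weight I(t-1) >= 0, since the next one restarts with weights 1 and 0. *)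
Lemma sum_gap_ge0 e (gap : nat -> R) T : (forall t, 0 <= gap t) ->
  0 <= \sum_(1 <= t < T.+1)
    ((in_index e t)%:R * gap t - ((in_index e t)%:R - 1) * gap t.-1).
Proof.
move=> g0; apply: (@le_trans _ _ ((in_index e T)%:R * gap T)); first by rewrite mulr_ge0.
elim: T => [|T ih]; first by rewrite mul0r big_geq.
rewrite sum_nat1_recr /=.
have IT : 0 <= (in_index e T)%:R * gap T by rewrite mulr_ge0.
have := le_trans IT ih; move: ih IT; set S := \sum_(_ <= _ < _) _.
move=> ih IT S0; case: ifP => _; first by lra.
by rewrite -natr1; lra.
Qed.

Lemma sum_gam_telescope e (d : nat -> R) (D : R) T : 0 < e 0%N -> (0 < T)%N ->
  (forall t, (t <= T)%N -> 0 <= d t <= D) ->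
  \sum_(1 <= t < T.+1) gam e t / 2 * (d t.-1 - d t) <= gam e T / 2 * D.
Proof.
move=> e0 T0 hd; apply: (@le_trans _ _ (gam e T / 2 * (D - d T))); last first.
  have [d0 _] := andP (hd T (leqnn _)).
  by rewrite ler_wpM2l ?gerBl// divr_ge0// ltW// gam_gt0.
elim: T T0 hd => // -[|T] ih _ hd.
  have /andP[_ d0] := hd 0%N isT.
  by rewrite big_nat1/= ler_wpM2l ?lerD2r// divr_ge0// ltW// gam_gt0.
rewrite sum_nat1_recr.
have {}ih := ih isT (fun t tT => hd t (leqW tT)).
have /andP[_ dD] := hd T.+1 (leqnSn _).
have gg : gam e T.+1 <= gam e T.+2 by exact: gam_homo.
apply: le_trans (lerD ih (lexx _)) _; rewrite succnK.
have : 0 <= (gam e T.+2 - gam e T.+1) * (D - d T.+1) by rewrite mulr_ge0 ?subr_ge0.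
by lra.
Qed.

(** Summing the iterations: the weighted gaps telescope inside a segment and
have a favourable sign where a segment ends, and the distances to the minimizer
z telescope because gamma is nondecreasing. *)
Lemma trajectory_inequality e xs gs z k (D := diam X)
    (delta := fun t => gs t - gradf (xs t.-1)) :
  0 < e 0%N -> (0 < k)%N -> X (xs 0%N) ->
  (forall t, (1 <= t <= k)%N -> xs t = prox X (xs t.-1) (gs t) (gam e t)) ->
  X z -> (forall y, X y -> f z <= f y) ->
  \sum_(1 <= t < k.+1)
    weight e t / gam e t *
      enorm (proj_grad X (xs t.-1) (gradf (xs t.-1)) (gam e t)) ^+ 2 <=
  k%:R * l * D ^+ 2 / 2 + gam e k * D ^+ 2 / 2 +
  \sum_(1 <= t < k.+1) (- dotp (delta t) (xs t.-1 - z)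
     + noise_coef e t * (enorm (delta t) ^+ 2 / gam e t)
     + curvature_excess e (curvature f gradf (xs t) (xs t.-1)) t *
         enorm (xs t - xs t.-1) ^+ 2 / 2).
Proof.
move=> e0 k0 X0 xsE Xz zmin.
have cX := domain_compact Hproblem; have cvX := domain_convex Hproblem.
have nX : X !=set0 by exists z.
have Xs t : (t <= k)%N -> X (xs t).
  case: t => // t tk; rewrite xsE//; apply: prox_in => //; exact: gam_gt0.
pose gap t := f (xs (minn t k)) - f z.
have gap0 t : 0 <= gap t by rewrite subr_ge0; apply: zmin; apply: Xs; exact: geq_minr.
pose d t := enorm (xs t - z) ^+ 2.
have D0 : 0 <= D by exact: diam_ge0.
have hd t : (t <= k)%N -> 0 <= d t <= D ^+ 2.
  move=> tk; rewrite /d sqr_ge0 ler_pXn2r ?nnegrE ?enorm_ge0//.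
  by apply: le_diam => //; exact: Xs.
have hg := sum_gam_telescope e0 k0 hd.
have hl : \sum_(1 <= t < k.+1) l / 2 * d t.-1 <= k%:R * l * D ^+ 2 / 2.
  have -> : k%:R * l * D ^+ 2 / 2 = \sum_(1 <= t < k.+1) l / 2 * D ^+ 2.
    by rewrite sumr_const_nat subn1/= -mulr_natl; ring.
  rewrite ler_sum_nat// => t /andP[_ tk]; have /andP[l0 _] := lower_curvature_bounds Hproblem.
  have /andP[_ dD] := hd t.-1 (leq_trans (leq_pred t) (tk : (t <= k)%N)).
  by rewrite ler_wpM2l// divr_ge0.
pose err t := - dotp (delta t) (xs t.-1 - z)
   + noise_coef e t * (enorm (delta t) ^+ 2 / gam e t)
   + curvature_excess e (curvature f gradf (xs t) (xs t.-1)) t *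
         enorm (xs t - xs t.-1) ^+ 2 / 2.
pose grad t := weight e t / gam e t *
      enorm (proj_grad X (xs t.-1) (gradf (xs t.-1)) (gam e t)) ^+ 2.
pose gaps t := (in_index e t)%:R * gap t - ((in_index e t)%:R - 1) * gap t.-1.
have stepE t : (1 <= t < k.+1)%N ->
  gaps t + grad t <= l / 2 * d t.-1 + gam e t / 2 * (d t.-1 - d t) + err t.
  rewrite /gaps /grad /err.
  case: t => // t /andP[_ tk].
  have := step_inequality (gs t.+1) e0 (ltn0Sn t) (Xs t (ltnW tk)) Xz.
  rewrite -(xsE t.+1 tk) -/(delta t.+1) /gap /d succnK.
  rewrite (minn_idPl (tk : (t.+1 <= k)%N)) (minn_idPl (ltnW tk : (t <= k)%N)).
  by lra.
have S : \sum_(1 <= t < k.+1) gaps t + \sum_(1 <= t < k.+1) grad t <=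
    \sum_(1 <= t < k.+1) l / 2 * d t.-1 +
    \sum_(1 <= t < k.+1) gam e t / 2 * (d t.-1 - d t) + \sum_(1 <= t < k.+1) err t.
  by rewrite -!big_split; exact: ler_sum_nat.
have : 0 <= \sum_(1 <= t < k.+1) gaps t by exact: sum_gap_ge0.
move=> G; rewrite -[leLHS]/(\sum_(1 <= t < k.+1) grad t).
rewrite -[X in _ <= _ + X]/(\sum_(1 <= t < k.+1) err t).
by lra.
Qed.

End Trajectory.

(** * Curvatures beyond the running maximum *)

Section CurvatureExcess.
Context {R : realType}.
Implicit Types (e : nat -> R) (c : R) (t : nat).

(** Below this value the curvature along step t needs no compensation from the
estimate. *)
Definition curvature_threshold e t : R :=
  if t == 1%N then 0 else 3 * runmax e t.-1.

(** When the curvature c exceeds the threshold, the estimate e t is a gain of the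
form c - e t, which is nonpositive on average, unless it is large enough to open
a new segment; that is paid by the new maximum and by the length of the segment
that closes. *)
Lemma curvature_excess_le_estimate e c M t : 0 < e 0%N -> (0 < t)%N -> e t <= M ->
  curvature_excess e c t / 2 <=
  (if curvature_threshold e t < c then ((in_index e t.-1)%:R + 1) / 2 * (c - e t) else 0)
  + (if in_index e t == 1%N then runmax e t else 0)
  + (if new_segment e t then (in_index e t.-1).-1%:R / 2 * M else 0).
Proof.
move=> e0; case: t => // -[_|t _] eM; rewrite /curvature_excess /curvature_threshold.
  have := runmax_ge e (leqnn 1); have := runmax_gt0 1 e0.
  by rewrite /=; have [c0|c0] := ltP 0 c; lra.
have L0 := runmax_gt0 t.+1 e0; have i0 := @in_index_gt0 _ e t.+1 isT.
rewrite succnK (_ : (t.+2 == 1%N) = false)//.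
have [nt|nt] := boolP (new_segment e t.+2).
  have -> : in_index e t.+2 = 1%N by rewrite /= nt.
  rewrite eqxx (new_segment_runmax e0 nt); move: nt => /andP[_ nt]; rewrite succnK in nt.
  have [i iE] : exists i, in_index e t.+1 = i.+1 by case: in_index i0 => // i; exists i.
  rewrite iE succnK -[i.+1%:R]natr1; have j0 : 0 <= (i%:R : R) by [].
  have h : i%:R * e t.+2 <= i%:R * M by rewrite ler_wpM2l.
  have [c3|c3] := ltP (3 * runmax e t.+1) c.
    have -> : Num.max 0 c = c by apply/max_idPr; lra.
    have : 0 <= i%:R * c by rewrite mulr_ge0//; lra.
    lra.
  have : Num.max 0 c <= 3 * runmax e t.+1 by rewrite ge_max c3 andbT; lra.
  have : 0 <= i%:R * M by apply: le_trans h; rewrite mulr_ge0//; lra.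
  by lra.
have -> : in_index e t.+2 = (in_index e t.+1).+1 by rewrite /= (negbTE nt).
rewrite eqSS (gtn_eqF i0) -[_.+1%:R]natr1; move: nt; rewrite /new_segment -leNgt succnK => nt.
have j0 : 0 <= ((in_index e t.+1)%:R : R) by [].
have [c3|c3] := ltP (3 * runmax e t.+1) c.
  have -> : Num.max 0 (c - 3 * runmax e t.+1) = c - 3 * runmax e t.+1.
    by apply/max_idPr; lra.
  have : (in_index e t.+1)%:R * (c - 3 * runmax e t.+1) <= (in_index e t.+1)%:R * (c - e t.+2).
    by rewrite ler_wpM2l//; lra.
  by lra.
have -> : Num.max 0 (c - 3 * runmax e t.+1) = 0 by apply/max_idPl; lra.
by rewrite mulr0 mul0r !addr0.
Qed.

(** If the estimate is at least half the curvature, a curvature beyond the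
threshold would have opened a new segment. *)
Lemma curvature_excess_le_underestimate e c M t : 0 < e 0%N -> (0 < t)%N -> c <= M -> 0 <= M ->
  curvature_excess e c t / 2 <=
  (if in_index e t == 1%N then runmax e t else 0) +
  (if e t <= c / 2 then t%:R / 2 * M else 0).
Proof.
move=> e0; case: t => // t _ cM M0; rewrite /curvature_excess.
have L1 := runmax_gt0 t.+1 e0; have L0 := runmax_gt0 t e0.
have et := runmax_ge e (leqnn t.+1).
have t1 : (1 : R) <= t.+1%:R by rewrite (ler_nat _ 1).
have tM : 1 * M <= t.+1%:R * M by rewrite ler_wpM2r.
have [i1|i1] := eqVneq (in_index e t.+1) 1%N.
  have [ec|ec] := leP (e t.+1) (c / 2).
    have : Num.max 0 c <= M by rewrite ge_max M0.
    by lra.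
  have : Num.max 0 c <= 2 * runmax e t.+1 by rewrite ge_max; lra.
  by lra.
have nt : ~~ new_segment e t.+1 by apply: contra i1 => nt; rewrite /= nt.
have iE : in_index e t.+1 = (in_index e t).+1 by rewrite /= (negbTE nt).
have iT : (in_index e t.+1)%:R <= t.+1%:R :> R by rewrite ler_nat in_index_le.
have [ec|ec] := leP (e t.+1) (c / 2).
  have h : 0 <= Num.max 0 (c - 3 * runmax e t) <= M.
    by rewrite le_max lexx ge_max M0/=; lra.
  have /andP[h1 h2] := h.
  have : (in_index e t.+1)%:R * Num.max 0 (c - 3 * runmax e t) <= t.+1%:R * M.
    by apply: ler_pM.
  by rewrite succnK; lra.
have t2 : (2 <= t.+1)%N by case: t i1 {L1 L0 et t1 tM nt iE iT ec}.
move: nt; rewrite /new_segment t2 /= -leNgt => nt.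
have -> : Num.max 0 (c - 3 * runmax e t) = 0 by apply/max_idPl; lra.
by rewrite mulr0 mul0r addr0.
Qed.

End CurvatureExcess.

(** * Measurability at a random point *)

Section Caratheodory.
Context d (T : measurableType d) {R : realType}.

Lemma measurable_fun_countable_index d' (U : measurableType d') (V : countType)
    (K : T -> V) (g : V -> T -> U) :
  (forall v, measurable (K @^-1` [set v])) ->
  (forall v, measurable_fun setT (g v)) -> measurable_fun setT (fun w => g (K w) w).
Proof.
move=> mK mg _ B mB; rewrite setTI.
have -> : (fun w => g (K w) w) @^-1` B =
    \bigcup_(v in [set: V]) (K @^-1` [set v] `&` g v @^-1` B).
  by apply/seteqP; split=> [w /= gB|w [v _ [/= <-]]//]; exists (K w).
apply: countable_bigcupT_measurable; first exact: countableP.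
by move=> v; apply: measurableI => //; rewrite -[X in measurable X]setTI; exact: mg.
Qed.

Definition grid_index n (m : nat) (u : 'rV[R]_n) : {ffun 'I_n -> int} :=
  [ffun i => Num.floor (m.+1%:R * u 0 i)].

Definition grid_point n (m : nat) (v : {ffun 'I_n -> int}) : 'rV[R]_n :=
  \row_i ((v i)%:~R / m.+1%:R).

Lemma grid_point_dist n (m : nat) (u : 'rV[R]_n) :
  enorm (grid_point m (grid_index m u) - u) <= n%:R / m.+1%:R.
Proof.
have m0 : 0 < m.+1%:R :> R by rewrite ltr0n.
rewrite enorm_le ?divr_ge0// /dotp.
apply: (@le_trans _ _ (\sum_(i < n) m.+1%:R ^- 2)).
  apply: ler_sum => i _; rewrite !mxE ffunE -expr2.
  set y := u 0 i; set z := (Num.floor _)%:~R.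
  have /andP[h1 h2] := floor_itv (m.+1%:R * y); rewrite intrD1 -/z in h1 h2.
  rewrite -exprVn -[_ ^+ 2]sqrrN opprB.
  have : y - z / m.+1%:R = (m.+1%:R * y - z) / m.+1%:R by field; rewrite gt_eqF.
  move=> ->; rewrite ler_pXn2r ?nnegrE ?invr_ge0//.
    by rewrite -[leRHS]mul1r ler_pM2r ?invr_gt0//; lra.
  by rewrite divr_ge0//; lra.
rewrite sumr_const card_ord -(mulr_natl (m.+1%:R ^- 2)) exprMn exprVn ler_wpM2r ?invr_ge0 ?sqr_ge0//.
by rewrite -natrX ler_nat; case: (n) => // a; rewrite -mulnn leq_pmulr.
Qed.

(** The random point u is approximated by countably many grid points, at each of
which g is measurable; the retraction rho brings them back into Y. *)
Lemma measurable_fun_caratheodory n (Y : set 'rV[R]_n) (rho : 'rV[R]_n -> 'rV[R]_n)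
    (g : 'rV[R]_n -> T -> R) (u : T -> 'rV[R]_n) :
  (forall q, Y (rho q)) -> (forall p q, enorm (rho p - rho q) <= enorm (p - q)) ->
  (forall i, measurable_fun setT (fun w => u w 0 i)) -> (forall w, rho (u w) = u w) ->
  (forall q, Y q -> measurable_fun setT (g q)) ->
  (forall w, continuous_on_at Y (g ^~ w) (u w)) ->
  measurable_fun setT (fun w => g (u w) w).
Proof.
move=> Yrho lrho mu ru mg cg.
apply: (@measurable_fun_cvg _ _ _ _
    (fun m w => g (rho (grid_point m (grid_index m (u w)))) w)).
  move=> m; apply: (@measurable_fun_countable_index _ _ _ (fun w => grid_index m (u w))
    (fun v => g (rho (grid_point m v)))) => v; last exact: mg.
  have -> : (fun w => grid_index m (u w)) @^-1` [set v] = \bigcap_(i in [set: 'I_n])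
      ((fun w => m.+1%:R * u w 0 i) @^-1` `[(v i)%:~R, (v i + 1)%:~R[%classic).
    apply/seteqP; split=> w /=.
      by move=> <- i _; rewrite /= ffunE in_itv/= floor_itv.
    move=> h; apply/ffunP => i; rewrite ffunE; apply/floor_def.
    by have := h i I; rewrite /= in_itv.
  apply: fin_bigcap_measurable => // i _; rewrite -[X in measurable X]setTI.
  by apply: measurable_funM.
move=> w _; apply/cvgrPdist_lt => e e0; have [r r0 hr] := cg w e e0.
have /cvgrPdist_lt/(_ _ r0) h : (n%:R / m.+1%:R : R) @[m --> \oo] --> (0 : R).
  by rewrite -[X in _ --> X](mulr0 n%:R); apply: cvgMr; exact: cvg_harmonic.
near=> m; rewrite distrC; apply: hr => //; rewrite -[X in _ - X](ru w).
apply: le_lt_trans (lrho _ _) _; apply: le_lt_trans (grid_point_dist _ _) _.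
have : `|0 - n%:R / m.+1%:R| < r by near: m; exact: h.
by rewrite sub0r normrN; apply: le_lt_trans; exact: ler_norm.
Unshelve. all: by end_near. Qed.

End Caratheodory.

(** * Integrals, independence and conditional laws *)

Section IntegralComparison.
Context d (T : measurableType d) {R : realType} (mu : {measure set T -> \bar R}).

Import HBNNSimple.

(** The smaller function need not be measurable: its integral is then the
supremum of the integrals of the simple functions below it. *)
Lemma le_integral_off_null (N : set T) (f g : T -> R) :
  measurable N -> mu N = 0%E -> measurable_fun setT g ->
  (forall w, 0 <= f w) -> (forall w, 0 <= g w) -> (forall w, ~ N w -> f w <= g w) ->
  (\int[mu]_w (f w)%:E <= \int[mu]_w (g w)%:E)%E.
Proof.
move=> mN N0 mg f0 g0 fg; pose h w := if w \in N then +oo%E else (g w)%:E.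
have mN' : measurable_fun setT (fun w => w \in N).
  apply: (measurable_fun_bool true); rewrite setTI.
  by rewrite (_ : _ @^-1` _ = N)//; apply/seteqP; split=> w; [move/set_mem|move/mem_set].
have mh : measurable_fun setT h.
  by apply: measurable_fun_ifT => //; exact/measurable_EFinP.
have h0 w : (0 <= h w)%E by rewrite /h; case: ifP => // _; rewrite lee_fin.
have -> : (\int[mu]_w (g w)%:E = \int[mu]_w h w)%E.
  apply: ge0_ae_eq_integral => //; first exact/measurable_EFinP.
    by move=> w _; rewrite lee_fin.
  exists N; split=> // w /= /not_implyP[_] hw; apply: contrapT => Nw; apply: hw.
  by rewrite /h memNset.
have fh w : ((f w)%:E <= h w)%E.
  by rewrite /h; case: ifPn; rewrite ?leey// notin_setE => /fg; rewrite lee_fin.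
rewrite !ge0_integralTE//.
apply/ge_ereal_sup => _ [s /= sf <-]; apply: ereal_sup_ubound; exists s => //= w.
exact: le_trans (sf w) (fh w).
Qed.

Lemma ae_le_integrable (f g : T -> R) : measurable_fun setT f ->
  mu.-integrable setT (EFin \o g) -> {ae mu, forall w, `|f w| <= g w} ->
  mu.-integrable setT (EFin \o f).
Proof.
move=> mf ig fg; apply/integrableP; split; first exact/measurable_EFinP.
have /integrableP[mg gfin] := ig; apply: le_lt_trans gfin.
apply: ae_ge0_le_integral => //.
- by apply: measurableT_comp => //; exact/measurable_EFinP.
- exact: measurableT_comp.
- apply: filterS fg => w /= fg _; rewrite lee_fin.
  exact: le_trans fg (ler_norm _).
Qed.

Lemma ae_le_Rintegral (f g : T -> R) :
  mu.-integrable setT (EFin \o f) -> mu.-integrable setT (EFin \o g) ->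
  {ae mu, forall w, f w <= g w} -> \int[mu]_w f w <= \int[mu]_w g w.
Proof.
move=> fi gi fg; have mf := measurable_int _ fi; have mg := measurable_int _ gi.
have mf' : measurable_fun setT f by exact/measurable_EFinP.
have mg' : measurable_fun setT g by exact/measurable_EFinP.
have mi : mu.-integrable setT (EFin \o (fun w => Num.min (f w) (g w))).
  apply: (ae_le_integrable (g := fun w => `|f w| + `|g w|)).
  - exact: measurable_minr.
  - have := integrableD measurableT (integrable_abse fi) (integrable_abse gi).
    by apply: eq_integrable.
  - apply: nearW => w; rewrite minEle; case: ifP => _.
      by rewrite lerDl.
    by rewrite lerDr.
(* the minimum is f almost everywhere, and below g everywhere *)
rewrite {1}/Rintegral (ae_eq_integral (fun w => (Num.min (f w) (g w))%:E))//.
- by apply: le_Rintegral => // w _; rewrite ge_min lexx orbT.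
- exact: measurable_int mi.
- by apply: filterS fg => w /= fg _; rewrite min_l.
Qed.

Lemma integral_piece (K : T -> nat) (f : T -> R) N :
  (\int[mu]_(w in K @^-1` [set N]) (f w)%:E = \int[mu]_w ((K w == N)%:R * f w)%:E)%E.
Proof.
rewrite integral_mkcond; apply: eq_integral => w _; rewrite patchE.
case: eqP => KN; first by rewrite mem_set ?mul1r.
by rewrite memNset ?mul0r.
Qed.

(** For a batch of random size K: each size can be treated separately. *)
Lemma le_integral_pieces (K : T -> nat) (f g : T -> R) :
  (forall N, measurable (K @^-1` [set N])) ->
  measurable_fun setT f -> measurable_fun setT g ->
  (forall w, 0 <= f w) -> (forall w, 0 <= g w) ->
  (forall N, (\int[mu]_w ((K w == N)%:R * f w)%:E <=
    \int[mu]_w ((K w == N)%:R * g w)%:E)%E) ->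
  (\int[mu]_w (f w)%:E <= \int[mu]_w (g w)%:E)%E.
Proof.
move=> mK mf mg f0 g0 fg.
have KT : setT = \bigcup_N (K @^-1` [set N]).
  by apply/seteqP; split=> w // _; exists (K w).
have tK : trivIset setT (fun N => K @^-1` [set N]).
  apply/trivIsetP => i j _ _ /eqP ij; rewrite -subset0 => w [/= Ki Kj].
  by apply: ij; rewrite -Ki -Kj.
rewrite KT !ge0_integral_bigcup//; first last.
- by move=> w _; rewrite lee_fin.
- by rewrite -KT; exact/measurable_EFinP.
- by move=> w _; rewrite lee_fin.
- by rewrite -KT; exact/measurable_EFinP.
apply: lee_nneseries => // [N _ _|N _]; last by rewrite !integral_piece.
by apply: integral_ge0 => w _; rewrite lee_fin.
Qed.

Lemma integral_pieces0 (K : T -> nat) (f : T -> R) :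
  (forall N, measurable (K @^-1` [set N])) ->
  mu.-integrable setT (EFin \o f) ->
  (forall N, (\int[mu]_w ((K w == N)%:R * f w)%:E = 0)%E) ->
  \int[mu]_w f w = 0.
Proof.
move=> mK fi f0.
have KT : setT = \bigcup_N (K @^-1` [set N]).
  by apply/seteqP; split=> w // _; exists (K w).
have tK : trivIset setT (fun N => K @^-1` [set N]).
  apply/trivIsetP => i j _ _ /eqP ij; rewrite -subset0 => w [/= Ki Kj].
  by apply: ij; rewrite -Ki -Kj.
rewrite /Rintegral KT (integral_bigcup tK mK); last by rewrite -KT.
by rewrite eseries0// => N _ _; rewrite integral_piece.
Qed.

Lemma integral_EFin (f : T -> R) : mu.-integrable setT (EFin \o f) ->
  (\int[mu]_w (f w)%:E = (\int[mu]_w f w)%:E)%E.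
Proof. by move=> fi; rewrite /Rintegral fineK// integrable_fin_num. Qed.

Lemma integrable_of_ge0_le (f g : T -> R) : measurable_fun setT f -> (forall w, 0 <= f w) ->
  mu.-integrable setT (EFin \o g) ->
  (\int[mu]_w (f w)%:E <= \int[mu]_w (g w)%:E)%E -> mu.-integrable setT (EFin \o f).
Proof.
move=> mf f0 gi fg; apply/integrableP; split; first exact/measurable_EFinP.
have -> : (\int[mu]_w `|(EFin \o f) w| = \int[mu]_w (f w)%:E)%E.
  by apply: eq_integral => w _; rewrite /= ger0_norm.
exact: le_lt_trans fg (integrable_lty measurableT gi).
Qed.

Lemma Rintegral_sum I (s : seq I) (f : I -> T -> R) :
  (forall i, mu.-integrable setT (EFin \o f i)) ->
  mu.-integrable setT (EFin \o (fun w => \sum_(i <- s) f i w)) /\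
  \int[mu]_w (\sum_(i <- s) f i w) = \sum_(i <- s) \int[mu]_w f i w.
Proof.
move=> fi; have E w : ((\sum_(i <- s) f i w)%:E = \sum_(i <- s) (f i w)%:E)%E.
  by rewrite sumEFin.
have is_ : mu.-integrable setT (fun w => \sum_(i <- s) (f i w)%:E)%E.
  by apply: integrable_sum => // i _; exact: fi.
split; first by apply: eq_integrable is_ => // w _; rewrite /= E.
elim: s {E is_} => [|i s ih].
  by under eq_Rintegral do rewrite big_nil; rewrite big_nil /Rintegral integral0_eq.
under eq_Rintegral do rewrite big_cons; rewrite big_cons RintegralD ?ih//.
have := @integrable_sum _ _ _ mu setT measurableT _ s xpredT (fun i w => (f i w)%:E)
  (fun i _ => fi i).
by apply: eq_integrable => // w _; rewrite /= sumEFin.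
Qed.

End IntegralComparison.

Section ProbabilityConstant.
Context d (T : measurableType d) {R : realType} (P : probability T R).

Lemma integral_probability_cst (c : R) : (\int[P]_w c%:E = c%:E)%E.
Proof. by have := expectation_cst P c; rewrite unlock. Qed.

Lemma Rintegral_probability_cst (c : R) : \int[P]_w c = c.
Proof. by rewrite /Rintegral integral_probability_cst. Qed.

End ProbabilityConstant.

Section FreshSample.
Context d d1 d2 (T : measurableType d) (T1 : measurableType d1)
  (T2 : measurableType d2) {R : realType} (P : probability T R)
  (mu : probability T2 R) (past : {mfun T >-> T1}) (Y : {mfun T >-> T2}).
Hypothesis indep : forall A B, measurable A -> measurable B ->
  P (past @^-1` A `&` Y @^-1` B) = (P (past @^-1` A) * mu B)%E.

Let joint w := (past w, Y w).

Let joint_measurable : measurable_fun setT joint.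
Proof. by apply: measurable_fun_pair; exact: measurable_funP. Qed.

HB.instance Definition _ := isMeasurableFun.Build _ _ _ _ joint joint_measurable.

Let joint_law (A : set (T1 * T2)) : measurable A ->
  (distribution P past \x mu)%E A = distribution P joint A.
Proof.
by move=> mA; exact: product_measure_unique.
Qed.

(** By independence the past and the sample have a product law, so Fubini's theorem
applies. The inner integral, at a frozen past, is the conditional expectation given
the past. *)
Lemma ge0_integral_fresh (h : T1 * T2 -> R) : measurable_fun setT h ->
  (forall v, 0 <= h v) ->
  (\int[P]_w (h (past w, Y w))%:E = \int[P]_w \int[mu]_z (h (past w, z))%:E)%E.
Proof.
move=> mh h0; have mh' : measurable_fun setT (EFin \o h) by exact/measurable_EFinP.
rewrite -(ge0_integral_distribution joint mh')//.
rewrite (eq_measure_integral (distribution P past \x mu)%E); last first.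
  by move=> A mA _; apply/esym; exact: joint_law.
rewrite fubini_tonelli1//.
rewrite /fubini_F ge0_integral_distribution//; first last.
- by move=> v; apply: integral_ge0 => z _; rewrite lee_fin.
- exact: measurable_fun_fubini_tonelli_F.
Qed.

Lemma integrable_fresh (h : T1 * T2 -> R) : measurable_fun setT h ->
  (\int[P]_w \int[mu]_z (`|h (past w, z)|)%:E < +oo)%E ->
  P.-integrable setT (fun w => (h (past w, Y w))%:E).
Proof.
move=> mh hfin; apply/integrableP; split.
  by apply/measurable_EFinP; exact: measurableT_comp.
have := @ge0_integral_fresh (fun v => `|h v|); rewrite /= => ->//.
exact: measurableT_comp.
Qed.

Lemma integral_fresh (h : T1 * T2 -> R) : measurable_fun setT h ->
  (\int[P]_w \int[mu]_z (`|h (past w, z)|)%:E < +oo)%E ->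
  (\int[P]_w (h (past w, Y w))%:E = \int[P]_w \int[mu]_z (h (past w, z))%:E)%E.
Proof.
move=> mh hfin; have mh' : measurable_fun setT (EFin \o h) by exact/measurable_EFinP.
have hi := integrable_fresh mh hfin.
have mabs : measurable_fun setT (abse \o (EFin \o h)) by exact: measurableT_comp.
have mF := measurable_fun_fubini_tonelli_F (m2 := mu) _ mabs (fun v => abse_ge0 _).
have hp : (distribution P past \x mu)%E.-integrable setT (EFin \o h).
  apply/integrable12ltyP => //.
  rewrite (ge0_integral_distribution past)//.
  by move=> v; exact: integral_ge0.
rewrite -(integral_distribution (X := joint) mh' hi).
rewrite (eq_measure_integral (distribution P past \x mu)%E); last first.
  by move=> A mA _; apply/esym; exact: joint_law.
rewrite -integral12_prod_meas1// /fubini_F.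
have mH := measurable_fubini_F hp.
rewrite (integral_distribution (X := past) mH)//.
apply/integrableP; split; first exact: measurableT_comp.
apply: le_lt_trans hfin; apply: ge0_le_integral => //.
- by apply: measurableT_comp => //; exact: measurableT_comp.
- exact: (measurableT_comp mF).
- move=> w _; apply: le_abse_integral => //.
  exact: (measurableT_comp mh').
Qed.

Let frozen_measurable (h : T1 * T2 -> R) : measurable_fun setT h ->
  (forall v, 0 <= h v) ->
  measurable_fun setT (fun w => (\int[mu]_z (h (past w, z))%:E)%E).
Proof.
move=> mh h0; have mh' : measurable_fun setT (EFin \o h) by exact/measurable_EFinP.
have h0' v : (0 <= (EFin \o h) v)%E by rewrite lee_fin.
exact: (measurableT_comp (measurable_fun_fubini_tonelli_F (m2 := mu) _ mh' h0')).
Qed.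

Lemma ge0_le_integral_fresh (h : T1 * T2 -> R) (C : T -> R) : measurable_fun setT h ->
  (forall v, 0 <= h v) -> measurable_fun setT C ->
  (forall w, (\int[mu]_z (h (past w, z))%:E <= (C w)%:E)%E) ->
  (\int[P]_w (h (past w, Y w))%:E <= \int[P]_w (C w)%:E)%E.
Proof.
move=> mh h0 mC hC; rewrite ge0_integral_fresh//.
apply: ge0_le_integral => //; last exact/measurable_EFinP.
- by move=> w _; apply: integral_ge0 => z _; rewrite lee_fin.
- exact: frozen_measurable.
Qed.

Lemma fresh_finite (h : T1 * T2 -> R) (C : T -> R) : measurable_fun setT h ->
  P.-integrable setT (EFin \o C) ->
  (forall w, (\int[mu]_z (`|h (past w, z)|)%:E <= (C w)%:E)%E) ->
  (\int[P]_w \int[mu]_z (`|h (past w, z)|)%:E < +oo)%E.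
Proof.
move=> mh iC hC; apply: le_lt_trans (integrable_lty measurableT iC).
have mabs : measurable_fun setT (fun v => `|h v|) by exact: measurableT_comp.
apply: ge0_le_integral => //.
- by move=> w _; apply: integral_ge0 => z _; rewrite lee_fin.
- exact: (frozen_measurable mabs).
- exact: measurable_int iC.
Qed.

End FreshSample.

Section ConditionalDensity.
Context d d1 (T : measurableType d) (T1 : measurableType d1) {R : realType}
  (mu : {measure set T -> \bar R}) (past : {mfun T >-> T1}).

Import HBNNSimple.

Let simple_integral (q : T -> R) (f : {nnsfun T1 >-> R}) :
  measurable_fun setT q -> (forall w, 0 <= q w) ->
  (\int[mu]_w (f (past w) * q w)%:E =
   \sum_(i < #|`fset_set (f @` setT)|) ((fset_set (f @` setT))`_i)%:E *
     \int[mu]_(w in past @^-1` (f @^-1` [set (fset_set (f @` setT))`_i])) (q w)%:E)%E.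
Proof.
move=> mq q0; set s := fset_set _.
have mA i : measurable (past @^-1` (f @^-1` [set s`_i])).
  by rewrite -[X in measurable X]setTI; exact: measurable_funP.
have s0 (i : 'I_#|`s|) : 0 <= s`_i.
  have : s`_i \in s by rewrite mem_nth.
  by rewrite in_fset_set// => /set_mem[x _ <-].
under eq_integral => w _.
  rewrite fimfunEord -/s mulr_suml -sumEFin; over.
rewrite ge0_integral_sum//=; first last.
- by move=> i w _; rewrite lee_fin !mulr_ge0.
- move=> i; apply/measurable_EFinP; apply: measurable_funM => //.
  apply: measurable_funM => //; apply: measurableT_comp => //.
apply: eq_bigr => i _; rewrite -ge0_integralZl//; first last.
- by rewrite lee_fin.
- by move=> w _; rewrite lee_fin.
- by apply: measurable_funTS; exact/measurable_EFinP.
rewrite [RHS]integral_mkcond; apply: eq_integral => w _.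
rewrite patchE indicE; case: ifPn => h.
  by rewrite mem_set ?mulr1//; exact: (set_mem h).
by rewrite memNset ?mulr0 ?mul0r//; move: h; rewrite notin_setE.
Qed.

(** For q1 the indicator of a random choice and q2 its conditional probability given
the past, this extends the conditional law from events to functions, by simple
functions and monotone convergence. *)
Lemma eq_integral_weight (q1 q2 : T -> R) (h : T1 -> R) :
  measurable_fun setT q1 -> measurable_fun setT q2 ->
  (forall w, 0 <= q1 w) -> (forall w, 0 <= q2 w) ->
  (forall A, measurable A -> (\int[mu]_(w in past @^-1` A) (q1 w)%:E =
     \int[mu]_(w in past @^-1` A) (q2 w)%:E)%E) ->
  measurable_fun setT h -> (forall v, 0 <= h v) ->
  (\int[mu]_w (h (past w) * q1 w)%:E = \int[mu]_w (h (past w) * q2 w)%:E)%E.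
Proof.
move=> mq1 mq2 q10 q20 q12 mh h0.
have mh' : measurable_fun setT (EFin \o h) by exact/measurable_EFinP.
pose S := nnsfun_approx measurableT mh'.
have lim (q : T -> R) : measurable_fun setT q -> (forall w, 0 <= q w) ->
    (\int[mu]_w (h (past w) * q w)%:E =
     limn (fun n => \int[mu]_w (S n (past w) * q w)%:E))%E.
  move=> mq q0; rewrite -monotone_convergence//; first last.
  - move=> w _ m n mn; rewrite lee_fin ler_wpM2r//.
    exact/lefP/nd_nnsfun_approx.
  - by move=> n w _; rewrite lee_fin mulr_ge0.
  - move=> n; apply/measurable_EFinP; apply: measurable_funM => //.
    exact: measurableT_comp.
  apply: eq_integral => w _; apply/esym/cvg_lim => //.
  under eq_fun do rewrite EFinM; rewrite EFinM; apply: cvgeZr => //.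
  by apply: (cvg_nnsfun_approx measurableT mh' _ (x := past w)) => // v _; rewrite lee_fin.
rewrite !lim//; congr (limn _); apply/funext => n.
rewrite !simple_integral//; apply: eq_bigr => i _; congr (_ * _)%E.
by apply: q12; rewrite -[X in measurable X]setTI; exact: measurable_funP.
Qed.

End ConditionalDensity.

Section SigmaAlgebraOfOthers.
Context d (Om : measurableType d) dXi (Xi : measurableType dXi) {R : realType}
  (P : probability Om R) (mu : probability Xi R) (I : eqType) (Y : I -> Om -> Xi).
Hypothesis HY : iid_with_law P mu Y.
Local Open Scope ereal_scope.

Definition events_of_others (i : I) : set (set Om) :=
  [set A | exists j B, [/\ j != i, measurable B & A = Y j @^-1` B]].

Let cylinders (i : I) : set (set Om) :=
  [set A | exists (s : seq I) (B : I -> set Xi), [/\ uniq s, i \notin s,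
     forall j, measurable (B j) & A = \bigcap_(j in [set` s]) (Y j @^-1` B j)]].

Lemma sample_preimage j B : measurable B -> measurable (Y j @^-1` B).
Proof.
by move=> mB; rewrite -[X in measurable X]setTI; apply: (iid_measurable HY) => //.
Qed.

Let cylinders_measurable i : cylinders i `<=` measurable.
Proof.
move=> _ [s [B [us _ mB ->]]]; apply: fin_bigcap_measurable => [|j _]; first exact: finite_seq.
exact: sample_preimage.
Qed.

Let cylinders_setI i : setI_closed (cylinders i).
Proof.
move=> _ _ [s [B [us si mB ->]]] [r [C [ur ri mC ->]]].
exists (undup (s ++ r)), (fun j => (if j \in s then B j else setT) `&`
                                   (if j \in r then C j else setT)).
split.
- exact: undup_uniq.
- by rewrite mem_undup mem_cat negb_or si.
- by move=> j; apply: measurableI; case: ifP.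
apply/seteqP; split=> w.
  move=> [Bw Cw] j /= _; split; case: ifP => // h; [exact: Bw|exact: Cw].
move=> h; split=> j /= js.
  have := h j; rewrite /= mem_undup mem_cat js => /(_ isT)[].
  by [].
have := h j; rewrite /= mem_undup mem_cat js orbT => /(_ isT)[_].
by [].
Qed.

(** Independence is given for finitely many samples; their cylinders form a
pi-system that generates the sigma-algebra of all the others. *)
Lemma others_independent i A B : <<s events_of_others i >> A -> measurable B ->
  P (A `&` Y i @^-1` B) = P A * mu B.
Proof.
move=> sA mB; have mYB := sample_preimage i mB.
have sub : <<s events_of_others i >> `<=` <<s cylinders i >>.
  apply: smallest_sub; first exact: smallest_sigma_algebra.
  move=> _ [j [C [ji mC ->]]]; apply: sub_sigma_algebra.
  exists [:: j], (fun=> C); split=> //; first by rewrite inE eq_sym.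
  by rewrite set_cons1 bigcap_set1.
have muB : mu B = (fine (mu B))%:E by rewrite fineK// fin_num_measure.
have r0 : (0 <= fine (mu B))%R by rewrite fine_ge0.
pose m1 := mrestr P mYB; pose m2 := mscale (NngNum r0) P.
have m2E C : m2 C = P C * mu B by rewrite [RHS]muleC {1}muB.
suff : m1 A = m2 A by rewrite m2E.
apply: (@g_sigma_algebra_measure_unique _ _ _ _ (@cylinders_measurable i)
  (fun=> setT) _ _ m1 m2 (@cylinders_setI i) _ _ _ (sub _ sA)).
- move=> _; exists [::], (fun=> setT); split=> //.
  by apply/seteqP; split.
- by rewrite -subTset => w _; exists 0%N.
- move=> _ [s [C [us si mC ->]]]; apply/esym/(etrans (m2E _))/esym.
  rewrite /m1 /mrestr.
  pose D j := if j == i then B else C j.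
  have mD j : measurable (D j) by rewrite /D; case: ifP.
  have := iid_independent HY (s := i :: s) (B := D); rewrite /= si us => /(_ isT mD).
  have -> : [set` i :: s] = i |` [set` s].
    apply/seteqP; split=> j /=; rewrite inE; first by case/predU1P; [left|right].
    by case=> [->|->]; rewrite ?eqxx ?orbT.
  rewrite bigcap_setU1 big_cons (iid_law HY)// -(iid_independent HY us mD).
  have -> : D i = B by rewrite /D eqxx.
  have E : \bigcap_(j in [set` s]) (Y j @^-1` D j) = \bigcap_(j in [set` s]) (Y j @^-1` C j).
    by apply: eq_bigcapr => j /= js; rewrite /D; case: eqP si => // <-; rewrite js.
  by rewrite E setIC muleC.
- by move=> _; rewrite /= /mrestr setTI (le_lt_trans (probability_le1 _ _))// ltry.
Qed.

End SigmaAlgebraOfOthers.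

(** * Measurable functions of the estimates *)

Section MeasurableFunctions.
Context d (T : measurableType d) {R : realType}.

Lemma measurable_funV (g : T -> R) :
  measurable_fun setT g -> measurable_fun setT (fun w => (g w)^-1).
Proof.
move=> mg.
have -> : (fun w => (g w)^-1) =
    (fun w => g w * (if 0 < g w ^+ 2 then expR (- ln (g w ^+ 2)) else 0)).
  apply/funext => w; have [->|g0] := eqVneq (g w) 0; first by rewrite invr0 mul0r.
  have g20 : 0 < g w ^+ 2 by rewrite exprn_even_gt0.
  by rewrite g20 -lnV ?posrE// lnK ?posrE ?invr_gt0// expr2 invfM mulVKf.
have mg2 : measurable_fun setT (fun w => g w ^+ 2) by exact: measurable_funX.
apply: measurable_funM => //; apply: measurable_fun_ifT => //.
  exact: measurable_fun_ltr.
apply: measurableT_comp => //; apply: measurable_funN.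
by apply: measurableT_comp => //; exact: measurable_ln.
Qed.

Lemma measurable_bigmax (c0 : R) N (c : nat -> T -> R) :
  (forall j, (j < N)%N -> measurable_fun setT (c j)) ->
  measurable_fun setT (fun w => \big[Num.max/c0]_(j < N) c j w).
Proof.
elim: N c => [|N ih] c mc; first by under eq_fun do rewrite big_ord0; exact: measurable_cst.
under eq_fun do rewrite big_ord_recl.
apply: measurable_maxr; first exact: mc.
by apply: (ih (fun j => c j.+1)) => j jN; exact: mc.
Qed.

Lemma measurable_sum_ord N (c : nat -> T -> R) :
  (forall j, (j < N)%N -> measurable_fun setT (c j)) ->
  measurable_fun setT (fun w => \sum_(j < N) c j w).
Proof.
elim: N c => [|N ih] c mc; first by under eq_fun do rewrite big_ord0; exact: measurable_cst.
under eq_fun do rewrite big_ord_recl.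
apply: measurable_funD; first exact: mc.
by apply: (ih (fun j => c j.+1)) => j jN; exact: mc.
Qed.

Lemma measurable_sum_nat1 N (c : nat -> T -> R) :
  (forall j, (1 <= j <= N)%N -> measurable_fun setT (c j)) ->
  measurable_fun setT (fun w => \sum_(1 <= j < N.+1) c j w).
Proof.
elim: N => [|N ih] mc; first by under eq_fun do rewrite big_geq//; exact: measurable_cst.
under eq_fun do rewrite sum_nat1_recr.
apply: measurable_funD; last by apply: mc; rewrite leqnn.
by apply: ih => j /andP[j1 jN]; apply: mc; rewrite j1 leqW.
Qed.

Lemma measurable_nat_index (K : T -> nat) :
  (forall N, measurable [set w | K w = N]) <-> measurable_fun setT K.
Proof.
split=> [h|mK N].
  by apply: (@measurable_fun_countable_index _ T _ nat nat K (fun v _ => v)).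
by rewrite -[X in measurable X]setTI; exact: (mK measurableT [set N]).
Qed.

Lemma measurable_fun_of_nat d' (U : measurableType d') (h : nat -> U) (K : T -> nat) :
  measurable_fun setT K -> measurable_fun setT (fun w => h (K w)).
Proof.
move=> /measurable_nat_index mK.
by apply: (@measurable_fun_countable_index _ T _ U nat K (fun v _ => h v)).
Qed.

Lemma measurable_natr_bool (c : T -> bool) :
  measurable_fun setT c -> measurable_fun setT (fun w => (c w)%:R : R).
Proof.
move=> mc; rewrite (_ : (fun w => _) = (fun w => if c w then 1 else 0)); last first.
  by apply/funext => w; case: (c w).
exact: measurable_fun_ifT.
Qed.

Definition coords_measurable n (u : T -> 'rV[R]_n) :=
  forall i, measurable_fun setT (fun w => u w 0 i).

Lemma coords_measurableB n (u v : T -> 'rV[R]_n) : coords_measurable u ->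
  coords_measurable v -> coords_measurable (fun w => u w - v w).
Proof.
move=> mu mv i; under eq_fun do rewrite !mxE.
exact: measurable_funB.
Qed.

Lemma coords_measurableZ n (c : T -> R) (u : T -> 'rV[R]_n) :
  measurable_fun setT c -> coords_measurable u -> coords_measurable (fun w => c w *: u w).
Proof. by move=> mc mu i; under eq_fun do rewrite !mxE; exact: measurable_funM. Qed.

Lemma coords_measurable_sum n N (u : nat -> T -> 'rV[R]_n) :
  (forall j, (j < N)%N -> coords_measurable (u j)) ->
  coords_measurable (fun w => \sum_(j < N) u j w).
Proof.
move=> mu i; under eq_fun do rewrite summxE.
by apply: (measurable_sum_ord (c := fun j w => u j w 0 i)) => j jN; exact: mu.
Qed.

Lemma measurable_dotp n (u v : T -> 'rV[R]_n) : coords_measurable u ->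
  coords_measurable v -> measurable_fun setT (fun w => dotp (u w) (v w)).
Proof. by move=> mu mv; apply: measurable_sum => i; exact: measurable_funM. Qed.

Lemma measurable_enorm2 n (u : T -> 'rV[R]_n) : coords_measurable u ->
  measurable_fun setT (fun w => enorm (u w) ^+ 2).
Proof. by move=> mu; under eq_fun do rewrite enorm2E; exact: measurable_dotp. Qed.

End MeasurableFunctions.

Section MeasurableSegments.
Context d (T : measurableType d) {R : realType} (e : T -> nat -> R).
Implicit Types t : nat.

Let observed t := forall s, (s <= t)%N -> measurable_fun setT (fun w => e w s).

Lemma measurable_runmax t : observed t -> measurable_fun setT (fun w => runmax (e w) t).
Proof.
elim: t => [|t ih] h; first by under eq_fun do rewrite runmax0; exact: h.
under eq_fun do rewrite runmaxS; apply: measurable_maxr; last exact: h.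
by apply: ih => s st; apply: h; exact: leqW.
Qed.

Lemma measurable_gam t : observed t.-1 -> measurable_fun setT (fun w => gam (e w) t).
Proof. by move=> h; apply: measurable_funM => //; exact: measurable_runmax. Qed.

Lemma measurable_new_segment t : observed t ->
  measurable_fun setT (fun w => new_segment (e w) t).
Proof.
move=> h; apply: measurable_and => //; apply: measurable_fun_ltr; last exact: h.
apply: measurable_funM => //; apply: measurable_runmax => s st.
by apply: h; apply: leq_trans st (leq_pred _).
Qed.

Lemma measurable_in_index t : observed t ->
  measurable_fun setT (fun w => in_index (e w) t).
Proof.
elim: t => [|t ih] h //=; apply: measurable_fun_ifT => //.
  exact: measurable_new_segment.
by apply: measurable_fun_of_nat; apply: ih => s st; apply: h; exact: leqW.
Qed.

Lemma measurable_seg_index t : observed t ->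
  measurable_fun setT (fun w => seg_index (e w) t).
Proof.
elim: t => [|t ih] h //=; apply: measurable_fun_addn.
  by apply: ih => s st; apply: h; exact: leqW.
by apply: (measurableT_comp (f := nat_of_bool)) => //; exact: measurable_new_segment.
Qed.

Lemma measurable_weight t : observed t -> measurable_fun setT (fun w => weight (e w) t).
Proof.
move=> h; have mI := measurable_in_index h; apply: measurable_fun_ifT => //.
  exact: (measurable_fun_of_nat (fun i : nat => (2 <= i)%N)).
exact: (measurable_fun_of_nat (fun i : nat => 3 * i%:R / 16 - 1 / 4 : R)).
Qed.

Lemma measurable_noise_coef t : observed t.-1 ->
  measurable_fun setT (fun w => noise_coef (e w) t).
Proof.
move=> h; have mI := measurable_in_index h.
exact: (measurable_fun_of_nat (fun i : nat => 11 * i%:R / 8 + 7 / 8 : R)).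
Qed.

Lemma measurable_weight_gam t : observed t ->
  measurable_fun setT (fun w => weight (e w) t / gam (e w) t).
Proof.
move=> h; apply: measurable_funM; first exact: measurable_weight.
apply: measurable_funV; apply: measurable_gam => s st.
by apply: h; apply: leq_trans st (leq_pred _).
Qed.

Lemma measurable_weight_sum k : observed k ->
  measurable_fun setT (fun w => \sum_(1 <= j < k.+1) weight (e w) j / gam (e w) j).
Proof.
move=> h; apply: measurable_sum_nat1 => j /andP[_ jk].
by apply: measurable_weight_gam => s sj; apply: h; exact: leq_trans jk.
Qed.

Lemma measurable_output_prob k t : observed k -> (t <= k)%N ->
  measurable_fun setT (fun w => output_prob (e w) k t).
Proof.
move=> h tk; apply: measurable_funM; first exact/measurable_funV/measurable_weight_sum.
by apply: measurable_weight_gam => s st; apply: h; exact: leq_trans tk.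
Qed.

Lemma measurable_curvature_threshold t : observed t.-1 ->
  measurable_fun setT (fun w => curvature_threshold (e w) t).
Proof.
move=> h; rewrite /curvature_threshold; case: (t == 1%N) => //.
by apply: measurable_funM => //; exact: measurable_runmax.
Qed.

End MeasurableSegments.

(** * Measurability of a run *)

Section Run.
Context {R : realType} {n : nat}
  {X : set 'rV[R]_n} {f : 'rV[R]_n -> R} {gradf : 'rV[R]_n -> 'rV[R]_n} {L l : R}
  {dXi : measure_display} {Xi : measurableType dXi} {mu : probability Xi R}
  {F : 'rV[R]_n -> Xi -> R} {G : 'rV[R]_n -> Xi -> 'rV[R]_n} {calL : Xi -> R}
  {sigma Lhat Lbar Lbar0 : R}
  {dOm : measure_display} {Om : measurableType dOm} {P : probability Om R}
  {est : estimator} {k : nat}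
  {xi xibar : nat -> nat -> Om -> Xi} {b : Om -> nat -> nat} {b' : nat -> nat}
  {x0 : 'rV[R]_n} {x : Om -> nat -> 'rV[R]_n} {Lb : Om -> nat -> R}.
Hypotheses (Hproblem : smooth_problem X f gradf L l)
  (Horacle : stochastic_oracle mu X f gradf F G calL sigma Lhat Lbar)
  (HLbar0 : 0 < Lbar0 <= Lhat) (Hk : (1 <= k)%N)
  (Hrun : acspg_run P mu X F G Lbar0 est k xi xibar b b' x0 x Lb).

Let cX : compact X := domain_compact Hproblem.
Let convX : convex_set (X : set (convex_lmodType 'rV[R]_n)) := domain_convex Hproblem.
Let X0 : X !=set0. Proof. by exists x0; exact: start_in_domain Hrun. Qed.

Lemma run_Lb0 w : 0 < Lb w 0%N.
Proof. by rewrite (estimate_start Hrun); have /andP[] := HLbar0. Qed.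

Lemma run_in_domain w t : (t <= k)%N -> X (x w t).
Proof.
case: t => [|t] tk; first by rewrite (start Hrun); exact: start_in_domain Hrun.
by rewrite (iterate Hrun)//; apply: prox_in => //; exact/gam_gt0/run_Lb0.
Qed.

Section PointFunctions.
Context d (T : measurableType d).
Implicit Types (u v : T -> 'rV[R]_n) (Y : T -> Xi).

Lemma coords_measurable_proj u : coords_measurable u ->
  coords_measurable (fun w => euclid_proj X (u w)).
Proof.
move=> mu_ i.
apply: (@measurable_fun_caratheodory _ T R n setT id (fun q _ => euclid_proj X q 0 i)) => // w.
apply: (@lipschitz_continuous_on _ _ _ _ 1) => y _.
have := coord_le_enorm (euclid_proj X y - euclid_proj X (u w)) i; rewrite !mxE mul1r => /le_trans; apply.
exact: proj_nonexpansive.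
Qed.

Lemma measurable_point_fun u (h : 'rV[R]_n -> R) : coords_measurable u ->
  (forall w, X (u w)) -> (forall y, X y -> continuous_on_at X h y) ->
  measurable_fun setT (fun w => h (u w)).
Proof.
move=> mu_ Xu ch.
apply: (@measurable_fun_caratheodory _ T R n X (euclid_proj X) (fun q _ => h q)) => //.
- by move=> q; exact: proj_in.
- by move=> p q; exact: proj_nonexpansive.
- by move=> w; exact: proj_id.
- by move=> w; exact: ch.
Qed.

Lemma measurable_sample_fun u Y (h : 'rV[R]_n -> Xi -> R) : coords_measurable u ->
  (forall w, X (u w)) -> measurable_fun setT Y ->
  (forall y, X y -> measurable_fun setT (h y)) ->
  (forall y z, X y -> continuous_on_at X (h ^~ z) y) ->
  measurable_fun setT (fun w => h (u w) (Y w)).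
Proof.
move=> mu_ Xu mY mh ch.
apply: (@measurable_fun_caratheodory _ T R n X (euclid_proj X) (fun q w => h q (Y w))) => //.
- by move=> q; exact: proj_in.
- by move=> p q; exact: proj_nonexpansive.
- by move=> w; exact: proj_id.
- by move=> q Xq; apply: (measurableT_comp (mh q Xq)).
- by move=> w; exact: ch.
Qed.

Lemma coord_lipschitz_continuous (h : 'rV[R]_n -> 'rV[R]_n) (K : R) y i :
  (forall q, X q -> enorm (h q - h y) <= K * enorm (q - y)) ->
  continuous_on_at X (fun q => h q 0 i) y.
Proof.
move=> hK; apply: (@lipschitz_continuous_on _ _ _ _ K) => q Xq.
by have := coord_le_enorm (h q - h y) i; rewrite !mxE => /le_trans; apply; exact: hK.
Qed.

Lemma coords_measurable_gradf u : coords_measurable u -> (forall w, X (u w)) ->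
  coords_measurable (fun w => gradf (u w)).
Proof.
move=> mu_ Xu i; apply: (measurable_point_fun (h := fun q => gradf q 0 i)) => // y Xy.
by apply: (coord_lipschitz_continuous (K := L)) => q Xq; exact: gradient_lipschitz Hproblem _ _ Xq Xy.
Qed.

Lemma measurable_f u : coords_measurable u -> (forall w, X (u w)) ->
  measurable_fun setT (fun w => f (u w)).
Proof.
move=> mu_ Xu; apply: measurable_point_fun => // y Xy.
by apply: gradient_continuous_on Xy; exact: objective_gradient Hproblem.
Qed.

Lemma coords_measurable_G u Y : coords_measurable u -> (forall w, X (u w)) ->
  measurable_fun setT Y -> coords_measurable (fun w => G (u w) (Y w)).
Proof.
move=> mu_ Xu mY i; apply: (measurable_sample_fun (h := fun q z => G q z 0 i)) => //.
  move=> y Xy; apply/measurable_EFinP.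
  exact: measurable_int (gradient_integrable Horacle _ Xy).
move=> y z Xy; apply: (coord_lipschitz_continuous (h := G ^~ z) (K := calL z)) => q Xq.
exact: sample_lipschitz Horacle _ _ _ Xq Xy.
Qed.

Lemma measurable_F u Y : coords_measurable u -> (forall w, X (u w)) ->
  measurable_fun setT Y -> measurable_fun setT (fun w => F (u w) (Y w)).
Proof.
move=> mu_ Xu mY; apply: measurable_sample_fun => //.
  move=> y Xy; apply/measurable_EFinP.
  exact: measurable_int (value_integrable Horacle Xy).
by move=> y z Xy; apply: gradient_continuous_on Xy; exact: oracle_gradient Horacle z.
Qed.

Lemma measurable_curvature u v (h : 'rV[R]_n -> T -> R) (gradh : 'rV[R]_n -> T -> 'rV[R]_n) :
  coords_measurable u -> coords_measurable v ->
  measurable_fun setT (fun w => h (u w) w) -> measurable_fun setT (fun w => h (v w) w) ->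
  coords_measurable (fun w => gradh (v w) w) ->
  measurable_fun setT (fun w => curvature (h ^~ w) (gradh ^~ w) (u w) (v w)).
Proof.
move=> mu_ mv hu hv gv; apply: measurable_funM.
  apply: measurable_funM => //; apply: measurable_funB; first exact: measurable_funB.
  by apply: measurable_dotp => //; exact: coords_measurableB.
by apply: measurable_funV; apply: measurable_enorm2; exact: coords_measurableB.
Qed.

Lemma measurable_sample_curvature u v Y : coords_measurable u -> coords_measurable v ->
  (forall w, X (u w)) -> (forall w, X (v w)) -> measurable_fun setT Y ->
  measurable_fun setT (fun w => curvature (F ^~ (Y w)) (G ^~ (Y w)) (u w) (v w)).
Proof.
move=> mu_ mv Xu Xv mY.
apply: (measurable_curvature (h := fun q w => F q (Y w)) (gradh := fun q w => G q (Y w))) => //.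
- exact: measurable_F.
- exact: measurable_F.
- exact: coords_measurable_G.
Qed.

Lemma measurable_objective_curvature u v : coords_measurable u -> coords_measurable v ->
  (forall w, X (u w)) -> (forall w, X (v w)) ->
  measurable_fun setT (fun w => curvature f gradf (u w) (v w)).
Proof.
move=> mu_ mv Xu Xv.
apply: (measurable_curvature (h := fun q _ => f q) (gradh := fun q _ => gradf q)) => //.
- exact: measurable_f.
- exact: measurable_f.
- exact: coords_measurable_gradf.
Qed.

End PointFunctions.

Definition batch_gradient w t : 'rV[R]_n :=
  (b w t)%:R^-1 *: (\sum_(j < b w t) G (x w t.-1) (xi t j w)).

(** A sigma-algebra for which the iterates up to time t are measurable need only
know the samples actually drawn; the samples of a batch beyond its random size
are replaced by a fixed value. *)
Section Observation.
Variable Gn : set (set Om).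
Let T := g_sigma_algebraType Gn.

Definition observed_batch_sizes t :=
  forall s N, (1 <= s <= t)%N -> <<s Gn >> [set w | b w s = N].
Definition observed_samples t := forall s j B, (1 <= s <= t)%N -> measurable B ->
  <<s Gn >> [set w | (j < b w s)%N /\ B (xi s j w)].
Definition observed_est_samples t := forall s j B, (1 <= s <= t)%N -> (j < b' s)%N ->
  measurable B -> <<s Gn >> (xibar s j @^-1` B).

Lemma observed_batchP t : (1 <= t <= k)%N -> observed_batch_sizes t -> observed_samples t ->
  (forall s, (s <= t.-1)%N -> coords_measurable ((fun w => x w s) : T -> _)) ->
  coords_measurable ((fun w => batch_gradient w t) : T -> _).
Proof.
move=> /andP[t1 tk] Ob Os mx i.
pose xi' j w := if (j < b w t)%N then xi t j w else point.
have mb : measurable_fun setT ((fun w => b w t) : T -> nat).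
  by apply/measurable_nat_index => N; apply: Ob; rewrite t1 leqnn.
have mxi' j : measurable_fun setT (xi' j : T -> Xi).
  move=> _ B mB; rewrite setTI.
  have -> : xi' j @^-1` B = [set w | (j < b w t)%N /\ B (xi t j w)] `|`
      (~` [set w | (j < b w t)%N /\ setT (xi t j w)] `&` [set _ | B point]).
    apply/seteqP; split=> w; rewrite /xi' /=; case: ifP => jb.
    - by left.
    - by right; split=> // -[].
    - by case=> [[]//|[/not_andP[]]].
    - by case=> [[]//|[]].
  have m1 C : measurable C -> (measurable : set (set T)) [set w | (j < b w t)%N /\ C (xi t j w)].
    by move=> mC; apply: Os => //; rewrite t1 leqnn.
  apply: measurableU; first exact: m1.
  apply: measurableI; first by apply: measurableC; exact: (m1 setT).
  have [Bp|nBp] := pselect (B point).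
    by rewrite (_ : [set _ | _] = setT)//; apply/seteqP; split.
  by rewrite (_ : [set _ | _] = set0)//; apply/seteqP; split.
have -> : (fun w => batch_gradient w t 0 i) = (fun w =>
    (fun N w => ((N%:R^-1 : R) *: (\sum_(j < N) G (x w t.-1) (xi' j w))) 0 i) (b w t) w).
  apply/funext => w; rewrite /batch_gradient.
  suff -> : \sum_(j < b w t) G (x w t.-1) (xi t j w) =
    \sum_(j < b w t) G (x w t.-1) (xi' j w) by [].
  by apply: eq_bigr => j _; rewrite /xi' ltn_ord.
apply: (@measurable_fun_countable_index _ T _ R nat (fun w => b w t)
  (fun N w => ((N%:R^-1 : R) *: (\sum_(j < N) G (x w t.-1) (xi' j w))) 0 i)).
  by apply/measurable_nat_index.
move=> N; apply: coords_measurableZ => //.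
apply: (@coords_measurable_sum _ T _ _ _ (fun j w => G (x w t.-1) (xi' j w))) => j _.
apply: coords_measurable_G => //; first exact: mx.
by move=> w; apply: run_in_domain; apply: leq_trans tk; exact: leq_pred.
Qed.

Lemma observed_estimate t : (1 <= t <= k)%N ->
  (forall s, (s <= t)%N -> coords_measurable ((fun w => x w s) : T -> _)) ->
  (forall j, (j < b' t)%N -> measurable_fun setT (xibar t j : T -> _)) ->
  measurable_fun setT ((fun w => Lb w t) : T -> _).
Proof.
move=> /andP[t1 tk] mx mxi.
under eq_fun do rewrite (estimate_step Hrun) ?t1//.
have mc j : (j < b' t)%N -> measurable_fun setT ((fun w =>
    curvature (F ^~ (xibar t j w)) (G ^~ (xibar t j w)) (x w t) (x w t.-1)) : T -> R).
  move=> jb; apply: measurable_sample_curvature.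
  - exact: mx.
  - by apply: mx; exact: leq_pred.
  - by move=> w; exact: run_in_domain.
  - by move=> w; apply: run_in_domain; apply: leq_trans tk; exact: leq_pred.
  - exact: mxi.
rewrite /estimate; case: est; last exact: (measurable_bigmax _ mc).
by apply: measurable_funM => //; exact: (measurable_sum_ord mc).
Qed.

Lemma iterates_measurable t : (t <= k)%N -> observed_batch_sizes t ->
  observed_samples t -> observed_est_samples t.-1 ->
  (forall s, (s <= t)%N -> coords_measurable ((fun w => x w s) : T -> _)) /\
  (forall s, (s <= t.-1)%N -> measurable_fun setT ((fun w => Lb w s) : T -> _)).
Proof.
elim: t => [|t ih] tk Ob Os Oe.
  split=> s; rewrite leqn0 => /eqP->; last first.
    by under eq_fun do rewrite (estimate_start Hrun); exact: measurable_cst.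
  by move=> i; under eq_fun do rewrite (start Hrun); exact: measurable_cst.
have [mx mL] : (forall s, (s <= t)%N -> coords_measurable ((fun w => x w s) : T -> _)) /\
  (forall s, (s <= t.-1)%N -> measurable_fun setT ((fun w => Lb w s) : T -> _)).
  apply: ih => [|s N /andP[s1 st]|s j B /andP[s1 st]|s j B /andP[s1 st]]; first exact: ltnW.
  - by apply: Ob; rewrite s1 leqW.
  - by apply: Os; rewrite s1 leqW.
  - by apply: Oe; rewrite s1 /= (leq_trans st)// leq_pred.
have {}mL s : (s <= t)%N -> measurable_fun setT ((fun w => Lb w s) : T -> _).
  case: (posnP t) => [t0|t1]; first by move=> st; apply: mL; move: st; rewrite t0.
  rewrite leq_eqVlt => /predU1P[->|st]; last by apply: mL; rewrite -ltnS prednK.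
  apply: observed_estimate => //; first by rewrite t1 ltnW.
  move=> j jb _ B mB; rewrite setTI; apply: Oe => //.
  by rewrite t1 /=.
split=> s st; last exact: mL.
move: st; rewrite leq_eqVlt => /predU1P[->|]; last exact: mx.
have -> : (fun w => x w t.+1) = (fun w =>
    euclid_proj X (x w t - (gam (Lb w) t.+1)^-1 *: batch_gradient w t.+1)).
  apply/funext => w; rewrite (iterate Hrun)// prox_proj//.
  exact/gam_gt0/run_Lb0.
apply: coords_measurable_proj; apply: coords_measurableB; first exact: mx.
apply: coords_measurableZ.
  by apply: measurable_funV; apply: (measurable_gam (e := (Lb : T -> _))).
exact: observed_batchP.
Qed.

Lemma estimates_measurable t : (t <= k)%N -> observed_batch_sizes t ->
  observed_samples t -> observed_est_samples t ->
  forall s, (s <= t)%N -> measurable_fun setT ((fun w => Lb w s) : T -> _).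
Proof.
move=> tk Ob Os Oe s st.
have Oe' : observed_est_samples t.-1.
  by move=> r j B /andP[r1 rt]; apply: Oe; rewrite r1 (leq_trans rt)// leq_pred.
have [mx mL] := iterates_measurable tk Ob Os Oe'.
case: (leqP s t.-1) => [|ts]; first exact: mL.
have t1 : (0 < t)%N by case: t ts st {tk Ob Os Oe Oe' mx mL} => // ts; rewrite leqNgt ts.
have -> : s = t by apply/eqP; rewrite eqn_leq st -ltnS -(prednK t1) ltnS.
apply: observed_estimate => //; first by rewrite t1.
by move=> j jb _ B mB; rewrite setTI; apply: Oe => //; rewrite t1 /=.
Qed.

End Observation.

(** * The sigma-algebras of the samples *)

Let sample : (nat * nat) + (nat * nat) -> Om -> Xi := all_samples xi xibar.
Let sample_iid : iid_with_law P mu sample := samples_iid Hrun.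

Lemma measurable_xi s j : measurable_fun setT (xi s j).
Proof. exact: (iid_measurable sample_iid (inl (s, j))). Qed.

Lemma measurable_xibar s j : measurable_fun setT (xibar s j).
Proof. exact: (iid_measurable sample_iid (inr (s, j))). Qed.

Definition drawn_events t : set (set Om) :=
  [set A | exists s j B, [/\ (1 <= s <= t)%N, measurable B &
    A = [set w | (j < b w s)%N /\ B (xi s j w)]
    \/ (j < b' s)%N /\ A = xibar s j @^-1` B]].

Lemma drawn_homo s t : (s <= t)%N -> drawn xi xibar b b' s `<=` drawn xi xibar b b' t.
Proof.
move=> st; apply: smallest_sub; first exact: smallest_sigma_algebra.
move=> A [r [j [B [/andP[r1 rs] mB AE]]]]; apply: sub_sigma_algebra.
by exists r, j, B; rewrite r1 (leq_trans rs st).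
Qed.

Lemma drawn_sub (Gn : set (set Om)) t : (t <= k)%N ->
  (forall s j B, (1 <= s <= t)%N -> measurable B -> <<s Gn >> (xi s j @^-1` B)) ->
  (forall s j B, (1 <= s <= t)%N -> measurable B -> <<s Gn >> (xibar s j @^-1` B)) ->
  drawn xi xibar b b' t `<=` <<s Gn >>.
Proof.
elim/ltn_ind: t => t ih tk hxi hxibar.
apply: smallest_sub; first exact: smallest_sigma_algebra.
move=> A [s [j [B [/andP[s1 st] mB [->|[_ ->]]]]]]; last by apply: hxibar => //; rewrite s1.
have mb : measurable_fun setT ((fun w => b w s) : g_sigma_algebraType Gn -> nat).
  apply/measurable_nat_index => N; apply: (ih s.-1).
  - by rewrite prednK.
  - by apply: leq_trans tk; apply: leq_trans st; exact: leq_pred.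
  - move=> r i C /andP[r1 rs]; apply: hxi; rewrite r1 (leq_trans rs)//.
    by apply: leq_trans st; exact: leq_pred.
  - move=> r i C /andP[r1 rs]; apply: hxibar; rewrite r1 (leq_trans rs)//.
    by apply: leq_trans st; exact: leq_pred.
  - by apply: (batch_adapted Hrun); rewrite s1 (leq_trans st tk).
apply: (@measurableI _ (g_sigma_algebraType Gn)).
  have := measurable_fun_of_nat (fun N => (j < N)%N) mb.
  by move=> /(_ measurableT [set true] I); rewrite setTI.
by apply: hxi => //; rewrite s1.
Qed.

Lemma drawn_measurable t : (t <= k)%N -> drawn xi xibar b b' t `<=` measurable.
Proof.
move=> tk; have : <<s @measurable _ Om >> `<=` measurable.
  by apply: smallest_sub => //; exact: sigma_algebra_measurable.
apply: subset_trans; apply: drawn_sub => // s j B _ mB; apply: sub_sigma_algebra.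
  by rewrite -[X in measurable X]setTI; exact: measurable_xi.
by rewrite -[X in measurable X]setTI; exact: measurable_xibar.
Qed.

Let Tk := g_sigma_algebraType (drawn_events k).

Lemma observed_drawn : [/\ observed_batch_sizes (drawn_events k) k,
  observed_samples (drawn_events k) k & observed_est_samples (drawn_events k) k].
Proof.
split.
- move=> s N /andP[s1 sk]; apply: (drawn_homo (leq_trans (leq_pred s) sk)).
  by apply: (batch_adapted Hrun); rewrite s1.
- move=> s j B sk mB; apply: sub_sigma_algebra; exists s, j, B; split=> //.
  by left.
- by move=> s j B sk jb mB; apply: sub_sigma_algebra; exists s, j, B; split=> //; right.
Qed.

Lemma drawn_x t : (t <= k)%N -> coords_measurable ((fun w => x w t) : Tk -> _).
Proof.
move=> tk; have [Ob Os Oe] := observed_drawn.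
have Oe' : observed_est_samples (drawn_events k) k.-1.
  by move=> r j B /andP[r1 rt]; apply: Oe; rewrite r1 (leq_trans rt)// leq_pred.
exact: (iterates_measurable (leqnn k) Ob Os Oe').1.
Qed.

Lemma drawn_Lb t : (t <= k)%N -> measurable_fun setT ((fun w => Lb w t) : Tk -> _).
Proof.
by move=> tk; have [Ob Os Oe] := observed_drawn; exact: (estimates_measurable (leqnn k)).
Qed.

Section PastOfSample.
Variable i : (nat * nat) + (nat * nat).
Let Gn := events_of_others sample i.
Let T1 := g_sigma_algebraType Gn.

Lemma others_measurable : <<s Gn >> `<=` measurable.
Proof.
apply: smallest_sub; first exact: sigma_algebra_measurable.
by move=> _ [j [B [_ mB ->]]]; exact: (sample_preimage sample_iid).
Qed.

Lemma others_xi s j B : inl (s, j) != i -> measurable B -> <<s Gn >> (xi s j @^-1` B).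
Proof. by move=> ji mB; apply: sub_sigma_algebra; exists (inl (s, j)), B. Qed.

Lemma others_xibar s j B : inr (s, j) != i -> measurable B -> <<s Gn >> (xibar s j @^-1` B).
Proof. by move=> ji mB; apply: sub_sigma_algebra; exists (inr (s, j)), B. Qed.

Definition past (w : Om) : T1 := w.

Lemma measurable_past : measurable_fun setT past.
Proof. by move=> _ B mB; rewrite setTI; exact: others_measurable. Qed.

HB.instance Definition _ := isMeasurableFun.Build _ _ _ _ past measurable_past.

HB.instance Definition _ := isMeasurableFun.Build _ _ _ _ (sample i)
  (iid_measurable sample_iid i).

Lemma past_independent (A : set T1) (B : set Xi) : measurable A -> measurable B ->
  P (past @^-1` A `&` sample i @^-1` B) = (P (past @^-1` A) * mu B)%E.
Proof. by move=> mA mB; exact: (others_independent sample_iid). Qed.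

Lemma past_sub (h : Om -> R) :
  measurable_fun setT (h : T1 -> R) -> measurable_fun setT h.
Proof. by move=> mh _ B mB; rewrite setTI; apply: others_measurable; rewrite -[X in <<s _ >> X]setTI; exact: mh. Qed.

Lemma observed_others t : (t <= k)%N ->
  (forall s j, (1 <= s <= t)%N -> inl (s, j) != i /\ inr (s, j) != i) ->
  [/\ observed_batch_sizes Gn t, observed_samples Gn t,
    observed_est_samples Gn t & forall N, (t < k)%N -> <<s Gn >> [set w | b w t.+1 = N]].
Proof.
move=> tk hi.
have sub : drawn xi xibar b b' t `<=` <<s Gn >>.
  by apply: drawn_sub => // s j B st mB; [apply: others_xi|apply: others_xibar] => //;
    have [] := hi s j st.
have Ob s N : (1 <= s <= t)%N -> <<s Gn >> [set w | b w s = N].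
  move=> /andP[s1 st]; apply: sub; apply: (drawn_homo (leq_trans (leq_pred s) st)).
  by apply: (batch_adapted Hrun); rewrite s1 (leq_trans st tk).
split=> //.
- move=> s j B st mB; apply: (@measurableI _ T1).
    have mb : measurable_fun setT ((fun w => b w s) : T1 -> nat).
      by apply/measurable_nat_index => N; exact: Ob.
    have := measurable_fun_of_nat (fun N => (j < N)%N) mb.
    by move=> /(_ measurableT [set true] I); rewrite setTI.
  by apply: others_xi => //; have [] := hi s j st.
- by move=> s j B st _ mB; apply: others_xibar => //; have [] := hi s j st.
- by move=> N tk'; apply: sub; apply: (batch_adapted Hrun (t := t.+1)).
Qed.

End PastOfSample.

(** * One sample at a fixed point *)

Let Lhat_gt0 : 0 < Lhat. Proof. by have /andP[h1 h2] := HLbar0; exact: lt_le_trans h2. Qed.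

Lemma coords_measurable_G_at y : X y -> coords_measurable (G y).
Proof.
move=> Xy i; apply/measurable_EFinP.
exact: measurable_int (gradient_integrable Horacle i Xy).
Qed.

Lemma noise_variance y : X y ->
  (\int[mu]_z (enorm (G y z - gradf y) ^+ 2)%:E <= (sigma ^+ 2)%:E)%E.
Proof. by move=> Xy; have := gradient_variance Horacle Xy; rewrite unlock. Qed.

Let noise_dotE y v z : (dotp (G y z - gradf y) v)%:E =
  (\sum_(i < n) ((v 0 i)%:E * ((G y z 0 i)%:E - (gradf y 0 i)%:E)))%E.
Proof.
rewrite /dotp -sumEFin; apply: eq_bigr => i _.
by rewrite !mxE mulrC EFinM EFinB.
Qed.

Let noise_coord_integrable y i : X y ->
  mu.-integrable setT (fun z => (G y z 0 i)%:E - (gradf y 0 i)%:E)%E.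
Proof.
move=> Xy; apply: integrableB => //; first exact: (gradient_integrable Horacle).
exact: finite_measure_integrable_cst.
Qed.

Lemma noise_integrable y v : X y ->
  mu.-integrable setT (fun z => (dotp (G y z - gradf y) v)%:E).
Proof.
move=> Xy; under eq_fun do rewrite noise_dotE.
by apply: integrable_sum => // i _; apply: integrableZl => //; exact: noise_coord_integrable.
Qed.

Lemma noise_centered y v : X y ->
  (\int[mu]_z (dotp (G y z - gradf y) v)%:E = 0)%E.
Proof.
move=> Xy; under eq_integral do rewrite noise_dotE.
rewrite integral_sum//; last first.
  by move=> i; apply: integrableZl => //; exact: noise_coord_integrable.
rewrite big1// => i _; rewrite integralZl//; last exact: noise_coord_integrable.
rewrite integralB//; last exact: finite_measure_integrable_cst.
  have := gradient_unbiased Horacle i Xy; rewrite unlock => ->.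
  by rewrite integral_probability_cst -EFinB subrr mule0.
exact: (gradient_integrable Horacle).
Qed.

Lemma sample_curvature_abs y v z : X y -> X v ->
  `|curvature (F ^~ z) (G ^~ z) y v * enorm (y - v) ^+ 2| <= 3 * calL z * enorm (y - v) ^+ 2.
Proof.
move=> Xy Xv; rewrite curvatureK.
have h1 := sample_upper_curvature Horacle z Xy Xv.
have h2 := sample_upper_curvature Horacle z Xv Xy.
have h3 : - dotp (G y z - G v z) (y - v) <= calL z * enorm (y - v) ^+ 2.
  rewrite -dotpNl; apply: le_trans (cauchy_schwarz _ _) _.
  rewrite enormN expr2 mulrA ler_wpM2r ?enorm_ge0//.
  exact: (sample_lipschitz Horacle).
rewrite (enormC v y) in h2.
rewrite -(opprB y v) dotpNr in h2; rewrite dotpBl in h3.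
have c0 := sample_lipschitz_ge0 Horacle z; have r0 := sqr_ge0 (enorm (y - v)).
have := mulr_ge0 c0 r0.
by rewrite ler_norml; lra.
Qed.

Lemma calL_integrable : mu.-integrable setT (EFin \o calL).
Proof.
apply: (ae_le_integrable (g := fun=> Lhat)).
- exact: sample_lipschitz_measurable Horacle.
- exact: finite_measure_integrable_cst.
- apply: filterS (sample_lipschitz_bounded Horacle) => z h.
  by rewrite ger0_norm// (sample_lipschitz_ge0 Horacle).
Qed.

Lemma calL_mean : \int[mu]_z calL z <= Lhat.
Proof.
apply: (@le_trans _ _ (\int[mu]_z Lhat)).
  apply: ae_le_Rintegral => //; [exact: calL_integrable|exact: finite_measure_integrable_cst|].
  exact: sample_lipschitz_bounded Horacle.
by rewrite Rintegral_probability_cst.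
Qed.

Lemma measurable_sample_curvature_at y v : X y -> X v ->
  measurable_fun setT (fun z => curvature (F ^~ z) (G ^~ z) y v).
Proof.
move=> Xy Xv.
by apply: (measurable_sample_curvature (u := fun=> y) (v := fun=> v) (Y := id)).
Qed.

Lemma sample_curvature_integrable y v : X y -> X v ->
  mu.-integrable setT
    (EFin \o (fun z => curvature (F ^~ z) (G ^~ z) y v * enorm (y - v) ^+ 2)).
Proof.
move=> Xy Xv; apply: (ae_le_integrable (g := fun z => (3 * enorm (y - v) ^+ 2) * calL z)).
- by apply: measurable_funM => //; exact: measurable_sample_curvature_at.
- by have := integrableZl measurableT (3 * enorm (y - v) ^+ 2) calL_integrable;
    apply: eq_integrable.
- by apply: nearW => z; rewrite [leRHS]mulrAC; exact: sample_curvature_abs.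
Qed.

Lemma sample_curvature_mean y v : X y -> X v ->
  \int[mu]_z (curvature (F ^~ z) (G ^~ z) y v * enorm (y - v) ^+ 2) =
  curvature f gradf y v * enorm (y - v) ^+ 2.
Proof.
move=> Xy Xv; rewrite curvatureK.
have iF q : X q -> mu.-integrable setT (EFin \o F q) by move=> Xq; exact: (value_integrable Horacle Xq).
have mF q : X q -> \int[mu]_z F q z = f q.
  by move=> Xq; have := value_unbiased Horacle Xq; rewrite unlock /Rintegral => ->.
have iG : mu.-integrable setT (EFin \o (fun z => dotp (G v z) (y - v))).
  apply: (@eq_integrable _ _ _ _ _ measurableT
    (fun z => \sum_(i < n) ((y - v) 0 i)%:E * (G v z 0 i)%:E)%E).
    by move=> z _; rewrite /dotp /= -sumEFin; apply: eq_bigr => i _; rewrite mulrC EFinM.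
  by apply: integrable_sum => // i _; apply: integrableZl => //; exact: (gradient_integrable Horacle).
have mG : \int[mu]_z dotp (G v z) (y - v) = dotp (gradf v) (y - v).
  have ic : mu.-integrable setT (EFin \o (fun=> dotp (gradf v) (y - v))).
    exact: finite_measure_integrable_cst.
  apply/eqP; rewrite -subr_eq0 -[X in _ - X](Rintegral_probability_cst mu) -RintegralB//.
  rewrite /Rintegral; under eq_integral do rewrite -dotpBl.
  by rewrite noise_centered.
have E z : curvature (F ^~ z) (G ^~ z) y v * enorm (y - v) ^+ 2 =
   2 * ((F y z - F v z) - dotp (G v z) (y - v)) by rewrite curvatureK.
under eq_Rintegral do rewrite E.
have iFF : mu.-integrable setT (EFin \o (fun z => F y z - F v z)).
  by have := integrableB measurableT (iF _ Xy) (iF _ Xv); apply: eq_integrable.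
have iFFG : mu.-integrable setT (EFin \o (fun z => F y z - F v z - dotp (G v z) (y - v))).
  by have := integrableB measurableT iFF iG; apply: eq_integrable.
rewrite RintegralZl// RintegralB// mG RintegralB ?mF//; exact: iF.
Qed.

Lemma curvature_le_Lhat y v : X y -> X v -> curvature f gradf y v <= Lhat.
Proof.
move=> Xy Xv; have [->|yv] := eqVneq y v.
  by rewrite /curvature !subrr enorm0 expr0n invr0 mulr0 ltW.
have r0 : 0 < enorm (y - v) ^+ 2 by rewrite lt_neqAle eq_sym enorm_eq0 subr_eq0 yv sqr_ge0.
rewrite -(ler_pM2r r0) -sample_curvature_mean//.
apply: (@le_trans _ _ (\int[mu]_z (enorm (y - v) ^+ 2 * calL z))).
  apply: le_Rintegral => //; first exact: sample_curvature_integrable.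
    by have := integrableZl measurableT (enorm (y - v) ^+ 2) calL_integrable; apply: eq_integrable.
  move=> z _; rewrite curvatureK; have := sample_upper_curvature Horacle z Xy Xv; lra.
rewrite RintegralZl//; last exact: calL_integrable.
by rewrite mulrC ler_pM2r//; exact: calL_mean.
Qed.

Let iterate_in w t : (t <= k)%N -> X (x w t) := run_in_domain w (t := t).
Let iterate_in' w t : (t <= k)%N -> X (x w t.-1).
Proof. by move=> tk; apply: iterate_in; exact: leq_trans (leq_pred _) tk. Qed.

(** * The gradient batch of iteration t *)

Definition gradient_noise t j w : 'rV[R]_n := G (x w t.-1) (xi t j w) - gradf (x w t.-1).

Let Tgrad t j := g_sigma_algebraType (events_of_others sample (inl (t, j))).

Lemma past_batch_observed t j : (1 <= t <= k)%N ->
  [/\ observed_batch_sizes (events_of_others sample (inl (t, j))) t.-1,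
    observed_samples (events_of_others sample (inl (t, j))) t.-1,
    observed_est_samples (events_of_others sample (inl (t, j))) t.-1 &
    forall N, <<s events_of_others sample (inl (t, j)) >> [set w | b w t = N]].
Proof.
move=> /andP[t1 tk].
have [] := @observed_others (inl (t, j)) t.-1 (leq_trans (leq_pred t) tk).
  move=> s i /andP[s1 st]; split=> //; apply/eqP => -[sE _].
  by move: st; rewrite sE; case: (t) t1 => // t' _; rewrite ltnn.
by move=> h1 h2 h3 h4; split=> // N; have := h4 N; rewrite prednK// => /(_ tk).
Qed.

Lemma past_batch_x t j s : (1 <= t <= k)%N -> (s <= t.-1)%N ->
  coords_measurable ((fun w => x w s) : Tgrad t j -> _).
Proof.
move=> t1k st; have [Ob Os Oe _] := past_batch_observed j t1k.
have /andP[_ tk] := t1k.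
have Oe' : observed_est_samples (events_of_others sample (inl (t, j))) t.-1.-1.
  by move=> r i B /andP[r1 rt]; apply: Oe; rewrite r1 (leq_trans rt)// leq_pred.
exact: (iterates_measurable (leq_trans (leq_pred t) tk) Ob Os Oe').1.
Qed.

Lemma past_batch_Lb t j s : (1 <= t <= k)%N -> (s <= t.-1)%N ->
  measurable_fun setT ((fun w => Lb w s) : Tgrad t j -> _).
Proof.
move=> t1k st; have [Ob Os Oe _] := past_batch_observed j t1k.
have /andP[_ tk] := t1k.
exact: (estimates_measurable (leq_trans (leq_pred t) tk) Ob Os Oe).
Qed.

Lemma past_batch_b t j : (1 <= t <= k)%N ->
  measurable_fun setT ((fun w => b w t) : Tgrad t j -> nat).
Proof.
by move=> t1k; apply/measurable_nat_index => N; have [_ _ _ h] := past_batch_observed j t1k; exact: h.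
Qed.

Lemma past_batch_noise t i j : (1 <= t <= k)%N -> i != j ->
  coords_measurable (gradient_noise t i : Tgrad t j -> _).
Proof.
move=> t1k ij; have /andP[_ tk] := t1k; apply: coords_measurableB.
  apply: coords_measurable_G; first exact: past_batch_x.
    by move=> w; exact: iterate_in'.
  move=> _ B mB; rewrite setTI; apply: others_xi => //.
  by apply: contra ij => /eqP[->].
by apply: coords_measurable_gradf; [exact: past_batch_x|move=> w; exact: iterate_in'].
Qed.

Let joint_noise t j : (1 <= t <= k)%N ->
  coords_measurable ((fun v => G (x v.1 t.-1) v.2 - gradf (x v.1 t.-1)) :
    Tgrad t j * Xi -> 'rV[R]_n).
Proof.
move=> t1k; have /andP[_ tk] := t1k.
have mx : coords_measurable ((fun v => x v.1 t.-1) : Tgrad t j * Xi -> 'rV[R]_n).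
  by move=> i; exact: (measurableT_comp (past_batch_x (j := j) t1k (leqnn _) i) measurable_fst).
apply: coords_measurableB.
  by apply: coords_measurable_G => // v; exact: iterate_in'.
by apply: coords_measurable_gradf => // v; exact: iterate_in'.
Qed.

(** Freezing all other samples, the noise of one sample has variance at most
sigma^2 whatever the point reached. *)
Lemma gradient_noise_variance t j (H : Om -> R) : (1 <= t <= k)%N ->
  measurable_fun setT (H : Tgrad t j -> R) -> (forall w, 0 <= H w) ->
  (\int[P]_w (H w * enorm (gradient_noise t j w) ^+ 2)%:E <=
   \int[P]_w (H w * sigma ^+ 2)%:E)%E.
Proof.
move=> t1k mH H0; have /andP[_ tk] := t1k.
pose h (v : Tgrad t j * Xi) := H v.1 * enorm (G (x v.1 t.-1) v.2 - gradf (x v.1 t.-1)) ^+ 2.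
have mh : measurable_fun setT h.
  apply: measurable_funM; first exact: (measurableT_comp mH measurable_fst).
  by apply: measurable_enorm2; exact: joint_noise.
have h0 v : 0 <= h v by rewrite mulr_ge0 ?sqr_ge0.
apply: (ge0_le_integral_fresh (@past_independent (inl (t, j))) mh h0).
  by apply: measurable_funM => //; exact: past_sub mH.
move=> w; rewrite /h /past /=; under eq_integral do rewrite EFinM.
have Xw := iterate_in' w tk.
rewrite ge0_integralZl ?lee_fin//; last first.
- by move=> z _; rewrite lee_fin sqr_ge0.
- apply/measurable_EFinP; apply: measurable_enorm2; apply: coords_measurableB.
    exact: coords_measurable_G_at.
  by move=> i; exact: measurable_cst.
by rewrite EFinM; apply: lee_pmul => //; [rewrite lee_fin|apply: integral_ge0 => z _; rewrite lee_fin sqr_ge0|exact: noise_variance].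
Qed.

(** Freezing all other samples, the noise of one sample is centered. *)
Lemma gradient_noise_uncorrelated t j (H : Om -> R) (V : Om -> 'rV[R]_n) :
  (1 <= t <= k)%N -> measurable_fun setT (H : Tgrad t j -> R) ->
  coords_measurable (V : Tgrad t j -> _) -> (forall w, 0 <= H w) ->
  P.-integrable setT (EFin \o (fun w => H w * (sigma ^+ 2 + enorm (V w) ^+ 2))) ->
  P.-integrable setT (EFin \o (fun w => H w * dotp (gradient_noise t j w) (V w))) /\
  \int[P]_w (H w * dotp (gradient_noise t j w) (V w)) = 0.
Proof.
move=> t1k mH mV H0 iC; have /andP[_ tk] := t1k.
pose h (v : Tgrad t j * Xi) :=
  H v.1 * dotp (G (x v.1 t.-1) v.2 - gradf (x v.1 t.-1)) (V v.1).
have mh : measurable_fun setT h.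
  apply: measurable_funM; first exact: (measurableT_comp mH measurable_fst).
  apply: measurable_dotp; first exact: joint_noise.
  by move=> i; exact: (measurableT_comp (mV i) measurable_fst).
have mG w : coords_measurable (fun z => G (x w t.-1) z - gradf (x w t.-1)).
  apply: coords_measurableB; first by apply: coords_measurable_G_at; exact: iterate_in'.
  by move=> i; exact: measurable_cst.
have hfin : (\int[P]_w \int[mu]_z (`|h (past (inl (t, j)) w, z)|)%:E < +oo)%E.
  apply: (fresh_finite mh iC) => w.
  have Xw := iterate_in' w tk.
  apply: (@le_trans _ _ (\int[mu]_z ((H w)%:E *
    ((enorm (G (x w t.-1) z - gradf (x w t.-1)) ^+ 2)%:E + (enorm (V w) ^+ 2)%:E)))%E).
    apply: ge0_le_integral => //.
    - apply/measurable_EFinP; apply: measurableT_comp => //.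
      exact: measurable_fun_pair2.
    - apply: measurable_funeM; apply: emeasurable_funD => //.
      by apply/measurable_EFinP; exact: measurable_enorm2.
    - move=> z _; rewrite /h /past /= lee_fin normrM ger0_norm// ler_wpM2l//.
      set a := G _ _ - _; have := dotp_young a (V w) ltr01.
      have := dotp_young (- a) (V w) ltr01; rewrite enormN dotpNl.
      by have := sqr_ge0 (enorm a); have := sqr_ge0 (enorm (V w)); rewrite ler_norml; lra.
  rewrite ge0_integralZl ?lee_fin//; first last.
  - by move=> z _; rewrite -EFinD lee_fin addr_ge0 ?sqr_ge0.
  - by apply: emeasurable_funD => //; apply/measurable_EFinP; exact: measurable_enorm2.
  rewrite ge0_integralD//; first last.
  - by move=> z _; rewrite lee_fin sqr_ge0.
  - by apply/measurable_EFinP; exact: measurable_enorm2.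
  - by move=> z _; rewrite lee_fin sqr_ge0.
  rewrite integral_probability_cst [leRHS]EFinM; apply: lee_pmul; rewrite ?lee_fin//.
    apply: adde_ge0; last by rewrite lee_fin sqr_ge0.
    by apply: integral_ge0 => z _; rewrite lee_fin sqr_ge0.
  by rewrite EFinD leeD// noise_variance.
split.
  exact: (integrable_fresh (@past_independent (inl (t, j))) mh hfin).
have := integral_fresh (@past_independent (inl (t, j))) mh hfin.
rewrite /Rintegral /h /= => ->; rewrite integral0_eq// => w _.
under eq_integral do rewrite EFinM.
have Xw := iterate_in' w tk.
rewrite integralZl//; first by rewrite noise_centered// mule0.
exact: noise_integrable.
Qed.

Lemma drawn_observable (h : Om -> R) :
  measurable_fun setT (h : Tk -> R) -> measurable_fun setT h.
Proof.
move=> mh _ B mB; rewrite setTI; apply: (drawn_measurable (leqnn k)).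
by rewrite -[X in drawn _ _ _ _ _ X]setTI; exact: mh.
Qed.

Lemma measurable_x t : (t <= k)%N -> coords_measurable (x ^~ t).
Proof. by move=> tk i; apply: drawn_observable; exact: drawn_x. Qed.

Lemma measurable_Lb t : (t <= k)%N -> measurable_fun setT (Lb ^~ t).
Proof. by move=> tk; apply: drawn_observable; exact: drawn_Lb. Qed.

Lemma measurable_b t : (1 <= t <= k)%N -> measurable_fun setT (b ^~ t).
Proof.
move=> t1k; apply/measurable_nat_index => N.
have /andP[_ tk] := t1k; apply: (drawn_measurable (leq_trans (leq_pred t) tk)).
exact: (batch_adapted Hrun).
Qed.

Lemma measurable_gradient_noise t j : (t <= k)%N -> coords_measurable (gradient_noise t j).
Proof.
move=> tk; have tk' := leq_trans (leq_pred t) tk.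
apply: coords_measurableB.
  apply: coords_measurable_G; [exact: measurable_x|by move=> w; exact: iterate_in|].
  exact: measurable_xi.
by apply: coords_measurable_gradf; [exact: measurable_x|move=> w; exact: iterate_in].
Qed.

(** For every j, because independence is used for one sample of the batch at a time;
c may not depend on any sample of the batch. *)
Definition known_before_batch t (c : Om -> R) :=
  forall j, measurable_fun setT (c : Tgrad t j -> R).

Lemma bounded_integrable (c : Om -> R) (C : R) : measurable_fun setT c ->
  (forall w, 0 <= c w <= C) -> P.-integrable setT (EFin \o c).
Proof.
move=> mc hc; apply: (ae_le_integrable (g := fun=> C)) => //.
  exact: finite_measure_integrable_cst.
by apply: nearW => w; have /andP[c0 cC] := hc w; rewrite ger0_norm.
Qed.

Section BatchMoments.
Variables (t : nat) (c : Om -> R) (C : R).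
Hypotheses (t1k : (1 <= t <= k)%N) (kc : known_before_batch t c)
  (c0C : forall w, 0 <= c w <= C).

Let c0 w : 0 <= c w. Proof. by have /andP[] := c0C w. Qed.
Let mc : measurable_fun setT c. Proof. exact: (@past_sub (inl (t, 0%N)) _ (@kc 0%N)). Qed.

Let piece N w : R := (b w t == N)%:R * c w.

Let kpiece N : known_before_batch t (piece N).
Proof.
move=> j; apply: measurable_funM => //.
exact: (measurable_fun_of_nat (fun i => (i == N)%:R : R) (past_batch_b (j := j) t1k)).
Qed.

Let piece0 N w : 0 <= piece N w <= C.
Proof.
have /andP[h1 h2] := c0C w; rewrite /piece; case: eqP => _ /=.
  by rewrite mul1r h1.
by rewrite mul0r lexx (le_trans h1).
Qed.

Let measurable_piece N : measurable_fun setT (piece N).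
Proof. exact: (@past_sub (inl (t, 0%N)) _ (@kpiece N 0%N)). Qed.

Let piece_ge0 N w : 0 <= piece N w. Proof. by have /andP[] := piece0 N w. Qed.

Let piece_noise N i :
  P.-integrable setT (EFin \o (fun w => piece N w * enorm (gradient_noise t i w) ^+ 2)).
Proof.
have /andP[_ tk] := t1k; have mp := measurable_piece N.
apply/integrableP; split.
  apply/measurable_EFinP; apply: measurable_funM => //.
  by apply: measurable_enorm2; exact: measurable_gradient_noise.
apply: (@le_lt_trans _ _ (\int[P]_w (piece N w * enorm (gradient_noise t i w) ^+ 2)%:E)%E).
  rewrite le_eqVlt; apply/orP; left; apply/eqP; apply: eq_integral => w _ /=.
  by rewrite ger0_norm// mulr_ge0 ?sqr_ge0.
apply: le_lt_trans (gradient_noise_variance t1k (@kpiece N i) (piece_ge0 N)) _.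
have := integrableZr measurableT (sigma ^+ 2) (bounded_integrable mp (piece0 N)).
by move=> /(integrable_lty measurableT).
Qed.

Let piece_sigma N : P.-integrable setT (EFin \o (fun w => piece N w * sigma ^+ 2)).
Proof.
have := integrableZr measurableT (sigma ^+ 2) (bounded_integrable (measurable_piece N) (piece0 N)).
by apply: eq_integrable.
Qed.

(** Expanding the square, the mixed terms vanish. *)
Let piece_square N : (0 < N)%N ->
  P.-integrable setT
    (EFin \o (fun w => piece N w * enorm (\sum_(j < N) gradient_noise t j w) ^+ 2)) /\
  \int[P]_w (piece N w * enorm (\sum_(j < N) gradient_noise t j w) ^+ 2) <=
  N%:R * \int[P]_w (piece N w * sigma ^+ 2).
Proof.
move=> N0; have /andP[_ tk] := t1k.
have mp := measurable_piece N.
have ips := piece_sigma N.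
pose cross (ij : 'I_N * 'I_N) w := piece N w *
  dotp (gradient_noise t ij.1 w) (gradient_noise t ij.2 w).
have crossE w : piece N w * enorm (\sum_(j < N) gradient_noise t j w) ^+ 2 =
    \sum_(ij : 'I_N * 'I_N) cross ij w.
  rewrite enorm2E dotp_suml mulr_sumr -(pair_bigA _ (fun i j => cross (i, j) w))/=.
  by apply: eq_bigr => i _; rewrite dotp_sumr mulr_sumr.
have key (ij : 'I_N * 'I_N) : P.-integrable setT (EFin \o cross ij) /\
    \int[P]_w cross ij w <= (ij.1 == ij.2)%:R * \int[P]_w (piece N w * sigma ^+ 2).
  case: ij => i j; rewrite /cross /=; have [->|ij] := eqVneq i j.
    split; first by under eq_fun do rewrite -enorm2E; exact: piece_noise.
    under eq_Rintegral do rewrite -enorm2E.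
    rewrite mul1r /Rintegral fine_le ?integrable_fin_num//; last first.
      exact: (gradient_noise_variance t1k (@kpiece N j) (piece_ge0 N)).
    exact: piece_noise.
  have [] := @gradient_noise_uncorrelated t i (piece N) (gradient_noise t j) t1k (@kpiece N i).
  - by apply: past_batch_noise => //; apply: contra ij => /eqP ij; apply/eqP/val_inj.
  - exact: piece_ge0.
  - have := integrableD measurableT ips (piece_noise N j).
    by apply: eq_integrable => // w _; rewrite /= mulrDr EFinD.
  - by move=> h1 h2; split; [exact: h1|rewrite h2 mul0r].
have [isum Esum] := Rintegral_sum (index_enum _) (fun ij => (key ij).1).
split; first by apply: eq_integrable isum => // w _; rewrite /= crossE.
under eq_Rintegral do rewrite crossE.
rewrite Esum.
apply: le_trans (ler_sum _ (fun ij _ => (key ij).2)) _.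
rewrite -mulr_suml ler_wpM2r//.
  by apply: Rintegral_ge0 => w _; rewrite mulr_ge0 ?sqr_ge0.
rewrite -(pair_bigA _ (fun i j => (i == j)%:R))/=.
under eq_bigr => i _.
  rewrite (bigD1 i)//= eqxx big1 ?addr0; last by move=> j; rewrite eq_sym => /negbTE->.
  over.
by rewrite sumr_const card_ord.
Qed.

Let batch_noise w := batch_gradient w t - gradf (x w t.-1).

Let batch_noise_piece N w : (0 < N)%N -> b w t = N ->
  batch_noise w = N%:R^-1 *: \sum_(j < N) gradient_noise t j w.
Proof.
move=> N0 bN; rewrite /batch_noise /batch_gradient bN /gradient_noise sumrB scalerBr.
by rewrite sumr_const card_ord -(scaler_nat N (gradf _)) scalerA mulVf ?scale1r// pnatr_eq0 -lt0n.
Qed.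

Lemma measurable_batch_noise : coords_measurable batch_noise.
Proof.
have /andP[_ tk] := t1k; have [Ob Os Oe] := observed_drawn.
have tk' := leq_trans (leq_pred t) tk.
apply: coords_measurableB.
  move=> i; apply: drawn_observable; apply: observed_batchP => //.
  - by move=> s N /andP[s1 st]; apply: Ob; rewrite s1 (leq_trans st).
  - by move=> s j B /andP[s1 st]; apply: Os; rewrite s1 (leq_trans st).
  - by move=> s st; apply: drawn_x; exact: leq_trans st tk'.
by apply: coords_measurable_gradf; [exact: measurable_x|move=> w; exact: iterate_in].
Qed.

Let b_gt0 w : (b w t == 0%N) = false.
Proof. by apply/negbTE; rewrite -lt0n; exact: (batch_gt0 Hrun). Qed.

(** Averaging b_t centered and uncorrelated errors divides the variance by b_t,
also when b_t is random, as long as it is fixed before the batch is drawn. *)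
Lemma batch_variance :
  (\int[P]_w (c w * enorm (batch_gradient w t - gradf (x w t.-1)) ^+ 2)%:E <=
   \int[P]_w (c w * (sigma ^+ 2 / (b w t)%:R))%:E)%E.
Proof.
apply: (le_integral_pieces (K := b ^~ t)).
- by apply/measurable_nat_index; exact: measurable_b.
- by apply: measurable_funM => //; apply: measurable_enorm2; exact: measurable_batch_noise.
- apply: measurable_funM => //; apply: measurable_funM => //; apply: measurable_funV.
  by apply: measurable_fun_of_nat; exact: measurable_b.
- by move=> w; rewrite mulr_ge0 ?sqr_ge0.
- by move=> w; rewrite mulr_ge0// divr_ge0 ?sqr_ge0.
case=> [|N].
  by rewrite !integral0_eq// => w _; rewrite b_gt0 mul0r.
have [isq sq] := piece_square (ltn0Sn N); have isg := piece_sigma N.+1.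
have N0 : 0 < N.+1%:R :> R by rewrite ltr0n.
rewrite (_ : (fun w => _) = (fun w => (N.+1%:R ^- 2)%:E *
    (piece N.+1 w * enorm (\sum_(j < N.+1) gradient_noise t j w) ^+ 2)%:E)%E); last first.
  apply/funext => w; rewrite -EFinM /piece; case: eqP => bN /=; last by rewrite !mul0r mulr0.
  rewrite !mul1r -/(batch_noise w) (batch_noise_piece _ bN)// enorm2E dotpZl dotpZr -enorm2E.
  by congr (_%:E); field; rewrite gt_eqF.
rewrite [in leRHS](_ : (fun w => _) = (fun w => (N.+1%:R^-1)%:E *
    (piece N.+1 w * sigma ^+ 2)%:E)%E); last first.
  apply/funext => w; rewrite -EFinM /piece; case: eqP => bN /=; last by rewrite !mul0r mulr0.
  by rewrite bN !mul1r; congr (_%:E); field; rewrite gt_eqF.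
rewrite !integralZl// !integral_EFin// -!EFinM lee_fin.
apply: le_trans (ler_wpM2l _ sq) _; first by rewrite invr_ge0 sqr_ge0.
by rewrite mulrA expr2 invfM mulfVK// gt_eqF.
Qed.

Lemma batch_variance_integrable : P.-integrable setT
  (EFin \o (fun w => c w * enorm (batch_gradient w t - gradf (x w t.-1)) ^+ 2)).
Proof.
apply: (integrable_of_ge0_le (g := fun w => c w * (sigma ^+ 2 / (b w t)%:R))).
- by apply: measurable_funM => //; apply: measurable_enorm2; exact: measurable_batch_noise.
- by move=> w; rewrite mulr_ge0 ?sqr_ge0.
- apply: (bounded_integrable (C := C * sigma ^+ 2)).
    apply: measurable_funM => //; apply: measurable_funM => //; apply: measurable_funV.
    by apply: measurable_fun_of_nat; exact: measurable_b.
  move=> w; have /andP[h0 hC] := c0C w.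
  have b1 : (1 : R) <= (b w t)%:R by rewrite (ler_nat _ 1) lt0n b_gt0.
  rewrite mulr_ge0 ?divr_ge0 ?sqr_ge0//= ler_pM ?divr_ge0 ?sqr_ge0//.
  by rewrite ler_piMr ?sqr_ge0// invf_le1// (lt_le_trans ltr01).
- exact: batch_variance.
Qed.

Lemma batch_centered (V : Om -> 'rV[R]_n) (B : R) :
  (forall j, coords_measurable (V : Tgrad t j -> _)) -> (forall w, enorm (V w) <= B) ->
  P.-integrable setT
    (EFin \o (fun w => c w * dotp (batch_gradient w t - gradf (x w t.-1)) (V w))) /\
  \int[P]_w (c w * dotp (batch_gradient w t - gradf (x w t.-1)) (V w)) = 0.
Proof.
move=> kV VB; have VB2 w : enorm (V w) ^+ 2 <= B ^+ 2.
  rewrite ler_pXn2r// nnegrE ?enorm_ge0//.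
  exact: (le_trans (enorm_ge0 _) (VB w)).
have mV : coords_measurable V by move=> i; exact: (@past_sub (inl (t, 0%N)) _ (@kV 0%N i)).
have int : P.-integrable setT
    (EFin \o (fun w => c w * dotp (batch_gradient w t - gradf (x w t.-1)) (V w))).
  apply: (ae_le_integrable (g := fun w => c w * enorm (batch_noise w) ^+ 2 + C * B ^+ 2)).
  - apply: measurable_funM => //; apply: measurable_dotp => //; exact: measurable_batch_noise.
  - have := integrableD measurableT batch_variance_integrable
      (finite_measure_integrable_cst P (C * B ^+ 2) measurableT).
    by apply: eq_integrable.
  - apply: nearW => w; have /andP[h0 hC] := c0C w.
    rewrite normrM ger0_norm// -/(batch_noise w).
    have d : `|dotp (batch_noise w) (V w)| <= enorm (batch_noise w) ^+ 2 + B ^+ 2.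
      have := dotp_young (batch_noise w) (V w) ltr01.
      have := dotp_young (- batch_noise w) (V w) ltr01; rewrite enormN dotpNl.
      have := VB2 w.
      by have := sqr_ge0 (enorm (batch_noise w)); have := sqr_ge0 (enorm (V w)); rewrite ler_norml; lra.
    apply: le_trans (ler_wpM2l h0 d) _; rewrite mulrDr lerD2l.
    by rewrite ler_wpM2r ?sqr_ge0.
split=> //; apply: (integral_pieces0 (K := b ^~ t)) => //.
  by apply/measurable_nat_index; exact: measurable_b.
case=> [|N].
  by rewrite integral0_eq// => w _; rewrite b_gt0 mul0r.
have mp := measurable_piece N.+1.
have key j : P.-integrable setT
    (EFin \o (fun w => piece N.+1 w * dotp (gradient_noise t j w) (V w))) /\
    \int[P]_w (piece N.+1 w * dotp (gradient_noise t j w) (V w)) = 0.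
  apply: gradient_noise_uncorrelated => //; first exact: kpiece.
  apply: (bounded_integrable (C := C * (sigma ^+ 2 + B ^+ 2))).
    by apply: measurable_funM => //; apply: measurable_funD => //; exact: measurable_enorm2.
  move=> w; have /andP[h0 hC] := piece0 N.+1 w.
  rewrite mulr_ge0 ?addr_ge0 ?sqr_ge0//= ler_pM ?addr_ge0 ?sqr_ge0//.
  by rewrite lerD2l.
have [isum Esum] := Rintegral_sum (index_enum 'I_N.+1) (fun j => (key j).1).
rewrite (_ : (fun w => _) = (fun w => (N.+1%:R^-1)%:E *
    (\sum_(j < N.+1) piece N.+1 w * dotp (gradient_noise t j w) (V w))%:E)%E); last first.
  apply/funext => w; rewrite -EFinM -mulr_sumr /piece -dotp_suml.
  case: eqP => bN /=; last by rewrite !mul0r mulr0.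
  by rewrite !mul1r -/(batch_noise w) (batch_noise_piece _ bN)// dotpZl mulrCA.
rewrite integralZl// integral_EFin// Esum big1 ?mule0// => j _.
by have [] := key j.
Qed.

End BatchMoments.

(** * The curvature samples of iteration t *)

Definition sample_curv t j w : R :=
  curvature (F ^~ (xibar t j w)) (G ^~ (xibar t j w)) (x w t) (x w t.-1).
Definition step_curv t w : R := curvature f gradf (x w t) (x w t.-1).
Definition step_sq t w : R := enorm (x w t - x w t.-1) ^+ 2.

Let Test t j := g_sigma_algebraType (events_of_others sample (inr (t, j))).

Lemma past_est_iterates t j : (1 <= t <= k)%N ->
  (forall s, (s <= t)%N -> coords_measurable ((fun w => x w s) : Test t j -> _)) /\
  (forall s, (s <= t.-1)%N -> measurable_fun setT ((fun w => Lb w s) : Test t j -> _)).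
Proof.
move=> /andP[t1 tk].
have [] := @observed_others (inr (t, j)) t.-1 (leq_trans (leq_pred t) tk).
  move=> s i /andP[s1 st]; split=> //; apply/eqP => -[sE _].
  by move: st; rewrite sE; case: (t) t1 => // t' _; rewrite ltnn.
rewrite prednK// => Ob Os Oe obt.
have Ob' s N : (1 <= s <= t)%N -> <<s events_of_others sample (inr (t, j)) >> [set w | b w s = N].
  move=> /andP[s1]; rewrite leq_eqVlt => /predU1P[->|st]; first exact: obt.
  by apply: Ob; rewrite s1 -ltnS prednK.
apply: iterates_measurable => // s i B st mB.
apply: (@measurableI _ (Test t j)); last exact: others_xi.
have mb : measurable_fun setT ((fun w => b w s) : Test t j -> nat).
  by apply/measurable_nat_index => N; exact: Ob'.
have := measurable_fun_of_nat (fun N => (i < N)%N) mb.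
by move=> /(_ measurableT [set true] I); rewrite setTI.
Qed.

Let past_est_x t j s (t1k : (1 <= t <= k)%N) (st : (s <= t)%N) :
  coords_measurable ((fun w => x w s) : Test t j -> _) := (past_est_iterates j t1k).1 s st.

Lemma past_est_step_curv t j : (1 <= t <= k)%N ->
  measurable_fun setT (step_curv t : Test t j -> R).
Proof.
move=> t1k; have /andP[_ tk] := t1k; apply: measurable_objective_curvature.
- exact: past_est_x.
- by apply: past_est_x => //; exact: leq_pred.
- by move=> w; exact: iterate_in.
- by move=> w; exact: iterate_in'.
Qed.

Lemma past_est_sample_curv t i j : (1 <= t <= k)%N -> i != j ->
  measurable_fun setT (sample_curv t i : Test t j -> R).
Proof.
move=> t1k ij; have /andP[_ tk] := t1k; apply: measurable_sample_curvature.
- exact: past_est_x.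
- by apply: past_est_x => //; exact: leq_pred.
- by move=> w; exact: iterate_in.
- by move=> w; exact: iterate_in'.
- move=> _ B mB; rewrite setTI; apply: others_xibar => //.
  by apply: contra ij => /eqP[->].
Qed.

Let joint_x t j s : (1 <= t <= k)%N -> (s <= t)%N ->
  coords_measurable ((fun v => x v.1 s) : Test t j * Xi -> 'rV[R]_n).
Proof.
by move=> t1k st i; exact: (measurableT_comp (past_est_x (j := j) t1k st i) measurable_fst).
Qed.

Let joint_sample_curv t j : (1 <= t <= k)%N -> measurable_fun setT
  ((fun v => curvature (F ^~ v.2) (G ^~ v.2) (x v.1 t) (x v.1 t.-1)) : Test t j * Xi -> R).
Proof.
move=> t1k; have /andP[_ tk] := t1k.
apply: (measurable_sample_curvature (Y := snd)) => //.
- exact: joint_x.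
- by apply: joint_x => //; exact: leq_pred.
- by move=> v; exact: iterate_in.
- by move=> v; exact: iterate_in'.
Qed.

Lemma step_sq_le t w : (t <= k)%N -> 0 <= step_sq t w <= diam X ^+ 2.
Proof.
move=> tk; rewrite sqr_ge0 /step_sq ler_pXn2r ?nnegrE ?enorm_ge0//; last exact: diam_ge0.
by apply: le_diam => //; [exact: iterate_in|exact: iterate_in'].
Qed.

Lemma step_curv_abs t w : (t <= k)%N ->
  `|step_curv t w * step_sq t w| <= (Lhat + l) * diam X ^+ 2.
Proof.
move=> tk; have /andP[r0 rD] := step_sq_le w tk.
have Xt := iterate_in w tk; have Xt' := iterate_in' w tk.
have /andP[l0 _] := lower_curvature_bounds Hproblem.
have h1 := ler_wpM2r r0 (curvature_le_Lhat Xt Xt').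
have h2 := lower_curvature Hproblem Xt Xt'.
have h3 := curvatureK f gradf (x w t) (x w t.-1).
rewrite -/(step_sq t w) -/(step_curv t w) in h1 h2 h3.
have h4 := ler_wpM2l l0 rD; have h5 := ler_wpM2l (ltW Lhat_gt0) rD.
have h6 := mulr_ge0 l0 r0; have h7 := mulr_ge0 (ltW Lhat_gt0) r0.
by rewrite ler_norml; lra.
Qed.

(** The curvature samples are drawn once both ends of the step are known: at a frozen
past, this is the unbiasedness of the oracle at two fixed points. *)
Lemma sample_curv_unbiased t j (H : Om -> R) (C : R) : (1 <= t <= k)%N ->
  measurable_fun setT (H : Test t j -> R) -> (forall w, 0 <= H w <= C) ->
  P.-integrable setT
    (EFin \o (fun w => H w * ((step_curv t w - sample_curv t j w) * step_sq t w))) /\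
  \int[P]_w (H w * ((step_curv t w - sample_curv t j w) * step_sq t w)) = 0.
Proof.
move=> t1k mH H0C; have /andP[_ tk] := t1k; have tk' := leq_trans (leq_pred t) tk.
pose h (v : Test t j * Xi) := H v.1 * ((step_curv t v.1 -
  curvature (F ^~ v.2) (G ^~ v.2) (x v.1 t) (x v.1 t.-1)) * step_sq t v.1).
have mh : measurable_fun setT h.
  apply: measurable_funM; first exact: (measurableT_comp mH measurable_fst).
  apply: measurable_funM.
    apply: measurable_funB; last exact: joint_sample_curv.
    exact: (measurableT_comp (past_est_step_curv (j := j) t1k) measurable_fst).
  apply: measurable_enorm2; apply: coords_measurableB; first exact: joint_x.
  by apply: joint_x => //; exact: leq_pred.
pose D := diam X.
have iB : mu.-integrable setT
    (EFin \o (fun z => C * ((Lhat + l) * D ^+ 2) + (C * (3 * D ^+ 2)) * calL z)).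
  have := integrableD measurableT
    (finite_measure_integrable_cst mu (C * ((Lhat + l) * D ^+ 2)) measurableT)
    (integrableZl measurableT (C * (3 * D ^+ 2)) calL_integrable).
  by apply: eq_integrable.
have hfin : (\int[P]_w \int[mu]_z (`|h (past (inr (t, j)) w, z)|)%:E < +oo)%E.
  pose K := \int[mu]_z (C * ((Lhat + l) * D ^+ 2) + (C * (3 * D ^+ 2)) * calL z).
  apply: (fresh_finite (C := fun=> K) mh); first exact: finite_measure_integrable_cst.
  move=> w; rewrite -integral_EFin//; apply: ge0_le_integral => //.
  - apply/measurable_EFinP; apply: measurableT_comp => //.
    exact: measurable_fun_pair2.
  - exact: measurable_int iB.
  - move=> z _; rewrite lee_fin /h /past /= normrM.
    have /andP[h0 hC] := H0C w; rewrite (ger0_norm h0).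
    have a1 := step_curv_abs w tk.
    have a2 := sample_curvature_abs z (iterate_in w tk) (iterate_in' w tk).
    have /andP[r0 rD] := step_sq_le w tk.
    have c0 := sample_lipschitz_ge0 Horacle z.
    rewrite -/(step_sq t w) in a2.
    have a3 : 3 * calL z * step_sq t w <= 3 * D ^+ 2 * calL z.
      by rewrite mulrAC ler_wpM2r// ler_pM2l.
    rewrite mulrBl; set A := step_curv t w * _; set B := curvature _ _ _ _ * _.
    have aAB : `|A - B| <= (Lhat + l) * D ^+ 2 + 3 * D ^+ 2 * calL z.
      by apply: le_trans (ler_normB _ _) _; rewrite lerD// (le_trans a2).
    rewrite -[in leRHS]mulrA -mulrDr; apply: ler_pM => //.
split.
  exact: (integrable_fresh (@past_independent (inr (t, j))) mh hfin).
have := integral_fresh (@past_independent (inr (t, j))) mh hfin.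
rewrite /Rintegral /h /= => ->; rewrite integral0_eq// => w _.
have Xt := iterate_in w tk; have Xt' := iterate_in' w tk.
have ic : mu.-integrable setT (EFin \o (fun=> step_curv t w * step_sq t w)).
  exact: finite_measure_integrable_cst.
have is_ := sample_curvature_integrable Xt Xt'.
have ib : mu.-integrable setT (EFin \o (fun z => step_curv t w * step_sq t w -
    curvature (F ^~ z) (G ^~ z) (x w t) (x w t.-1) * step_sq t w)).
  by have := integrableB measurableT ic is_; apply: eq_integrable.
under eq_integral do rewrite /past EFinM mulrBl.
rewrite integralZl// integral_EFin// RintegralB//.
by rewrite Rintegral_probability_cst sample_curvature_mean// subrr mule0.
Qed.

(** * Underestimated curvatures *)

Definition underestimated t j w : bool := Num.max Lbar0 (sample_curv t j w) <= step_curv t w / 2.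

Let beta : R := underestimation_prob mu X f gradf F G Lbar0.

Let measurable_under_at y v : X y -> X v -> measurable
  [set z | (Num.max Lbar0 (curvature (F ^~ z) (G ^~ z) y v) <= curvature f gradf y v / 2)%R].
Proof.
move=> Xy Xv; rewrite -[X in measurable X]setTI.
have m : measurable_fun setT (fun z =>
    Num.max Lbar0 (curvature (F ^~ z) (G ^~ z) y v) <= curvature f gradf y v / 2).
  apply: measurable_fun_ler => //; apply: measurable_maxr => //.
  exact: measurable_sample_curvature_at.
exact: (m measurableT [set true] I).
Qed.

Lemma underestimation_le_beta y v : X y -> X v ->
  (mu [set z | (Num.max Lbar0 (curvature (F ^~ z) (G ^~ z) y v) <= curvature f gradf y v / 2)%R]
     <= beta%:E)%E.
Proof.
move=> Xy Xv; have m := measurable_under_at Xy Xv.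
rewrite -[leLHS]fineK ?fin_num_measure// lee_fin; apply: sup_upper_bound; last by exists y, v.
split; first by eexists; exists y, v; split.
exists 1 => _ [y' [v' [Xy' Xv' ->]]].
have m' := measurable_under_at Xy' Xv'.
by rewrite -lee_fin fineK ?fin_num_measure// probability_le1.
Qed.

Lemma beta_ge0 : 0 <= beta.
Proof.
have Xx0 := start_in_domain Hrun.
by rewrite -lee_fin; apply: le_trans (underestimation_le_beta Xx0 Xx0); exact: measure_ge0.
Qed.

(** The curvature samples of an iteration are independent given the step, so the
probability that all of them fall short is a power of beta. *)
Lemma all_underestimated t N : (1 <= t <= k)%N ->
  (\int[P]_w (\prod_(j < N) (underestimated t j w)%:R)%:E <= (beta ^+ N)%:E)%E.
Proof.
move=> t1k; have /andP[_ tk] := t1k; elim: N => [|N ih].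
  under eq_integral do rewrite big_ord0; by rewrite integral_probability_cst expr0.
under eq_integral do rewrite big_ord_recr.
pose E w : R := \prod_(j < N) (underestimated t j w)%:R.
have E0 w : 0 <= E w by apply: prodr_ge0.
have mE : measurable_fun setT (E : Test t N -> R).
  apply: measurable_prod => j _; apply: measurable_natr_bool.
  apply: measurable_fun_ler; last by apply: measurable_funM => //; exact: past_est_step_curv.
  apply: measurable_maxr => //; apply: past_est_sample_curv => //.
  by rewrite neq_ltn ltn_ord.
pose h (v : Test t N * Xi) : R := E v.1 * (Num.max Lbar0
  (curvature (F ^~ v.2) (G ^~ v.2) (x v.1 t) (x v.1 t.-1)) <= step_curv t v.1 / 2)%R%:R.
have mh : measurable_fun setT h.
  apply: measurable_funM; first exact: (measurableT_comp mE measurable_fst).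
  apply: measurable_natr_bool; apply: measurable_fun_ler.
    by apply: measurable_maxr => //; exact: joint_sample_curv.
  apply: measurable_funM => //.
  exact: (measurableT_comp (past_est_step_curv (j := N) t1k) measurable_fst).
have h0 v : 0 <= h v by rewrite mulr_ge0.
apply: (@le_trans _ _ (\int[P]_w (E w * beta)%:E)%E).
  apply: (ge0_le_integral_fresh (@past_independent (inr (t, N))) mh h0).
    by apply: measurable_funM => //; exact: (@past_sub (inr (t, N)) _ mE).
  move=> w; rewrite /h /past /=.
  have Xt := iterate_in w tk; have Xt' := iterate_in' w tk.
  have mU := measurable_under_at Xt Xt'.
  rewrite (_ : (fun z => _) = (fun z => (E w)%:E * (\1_[set z | (Num.max Lbar0
    (curvature (F ^~ z) (G ^~ z) (x w t) (x w t.-1)) <= step_curv t w / 2)%R] z)%:E)%E); last first.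
    by apply/funext => z; rewrite -EFinM indicE; congr (_ * (nat_of_bool _)%:R)%:E;
      apply/idP/idP => [h1|/set_mem]//; exact/mem_set.
  rewrite ge0_integralZl_EFin//; [|exact/measurable_EFinP/measurable_indic].
  rewrite integral_indic// setIT EFinM lee_wpmul2l ?lee_fin//.
  exact: underestimation_le_beta.
rewrite (_ : (fun w => _) = (fun w => beta%:E * (E w)%:E)%E); last first.
  by apply/funext => w; rewrite mulrC EFinM.
rewrite ge0_integralZl_EFin ?beta_ge0//; last first.
- by apply/measurable_EFinP; exact: (@past_sub (inr (t, N)) _ mE).
- by move=> z _; rewrite lee_fin.
by rewrite exprS EFinM lee_wpmul2l ?lee_fin ?beta_ge0.
Qed.

(** * The local estimates *)

Lemma sample_curv_le_calL t j w : (t <= k)%N -> sample_curv t j w <= calL (xibar t j w).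
Proof.
move=> tk; have Xt := iterate_in w tk; have Xt' := iterate_in' w tk.
rewrite /sample_curv; have [->|xx] := eqVneq (x w t) (x w t.-1).
  by rewrite /curvature !subrr enorm0 expr0n invr0 mulr0 (sample_lipschitz_ge0 Horacle).
have r0 : 0 < enorm (x w t - x w t.-1) ^+ 2.
  by rewrite lt_neqAle eq_sym enorm_eq0 subr_eq0 xx sqr_ge0.
rewrite -(ler_pM2r r0) curvatureK.
have := sample_upper_curvature Horacle (xibar t j w) Xt Xt'; lra.
Qed.

Lemma estimates_le_Lhat : {ae P, forall w, forall t, (t <= k)%N -> Lb w t <= Lhat}.
Proof.
have key : {ae P, forall w, forall t j, calL (xibar t j w) <= Lhat}.
  apply/ae_foralln => t; apply/ae_foralln => j.
  have [N [mN N0 hN]] := sample_lipschitz_bounded Horacle.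
  exists (xibar t j @^-1` N); split.
  - exact: (sample_preimage sample_iid (inr (t, j)) mN).
  - by rewrite -N0; exact: (iid_law sample_iid (inr (t, j)) mN).
  - by move=> w h; apply: hN.
apply: filterS key => w h [|t] tk.
  by rewrite (estimate_start Hrun); have /andP[] := HLbar0.
have t1k : (1 <= t.+1 <= k)%N by [].
have hc j := le_trans (sample_curv_le_calL j w tk) (h t.+1 j).
rewrite (estimate_step Hrun _ t1k); have b0 := est_batch_gt0 Hrun t1k.
case: est => /=.
  rewrite ler_pdivrMr ?ltr0n// mulr_natr -[X in _ *+ X]card_ord -sumr_const.
  by apply: ler_sum => j _; exact: hc.
apply: bigmax_le => [|j _]; last exact: hc.
by have /andP[] := HLbar0.
Qed.

(** The largest sample dominates the mean, so that the bounds for the mean estimate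
hold for both estimators. *)
Lemma mean_le_estimate t w : (1 <= t <= k)%N ->
  (\sum_(j < b' t) sample_curv t j w) / (b' t)%:R <= Lb w t.
Proof.
move=> t1k; rewrite (estimate_step Hrun _ t1k); have b0 := est_batch_gt0 Hrun t1k.
case: est => //=; rewrite ler_pdivrMr ?ltr0n// mulr_natr -[X in _ *+ X]card_ord -sumr_const.
apply: ler_sum => j _.
exact: (le_bigmax _ (fun j : 'I_(b' t) => sample_curv t j w)).
Qed.

Lemma estimate_le_half t w : est = EstimatorII -> (1 <= t <= k)%N ->
  (Lb w t <= step_curv t w / 2)%R%:R <= \prod_(j < b' t) (underestimated t j w)%:R :> R.
Proof.
move=> estE t1k; case: (leP (Lb w t) _) => [h|_]; last by rewrite mulr0n prodr_ge0.
rewrite big1// => j _; rewrite /underestimated.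
suff -> : Num.max Lbar0 (sample_curv t j w) <= step_curv t w / 2 by [].
apply: le_trans h; rewrite (estimate_step Hrun _ t1k) estE /= ge_max.
rewrite (le_bigmax _ (fun j : 'I_(b' t) => sample_curv t j w)) andbT.
exact: bigmax_ge_id.
Qed.

(** * One iteration in expectation *)

Let runmax_gt0' w t : 0 < runmax (Lb w) t. Proof. exact: (runmax_gt0 t (run_Lb0 w)). Qed.
Let gam_gt0' w t : 0 < gam (Lb w) t. Proof. exact: (gam_gt0 t (run_Lb0 w)). Qed.

Lemma gam_ge w t : 4 * Lbar0 <= gam (Lb w) t.
Proof. by rewrite /gam ler_pM2l// -(estimate_start Hrun w) runmax_ge. Qed.

Lemma noise_coef_le w t : (t <= k)%N -> 0 <= noise_coef (Lb w) t <= 2 * k%:R + 1.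
Proof.
move=> tk; have i0 : 0 <= (in_index (Lb w) t.-1)%:R :> R by [].
have ik : (in_index (Lb w) t.-1)%:R <= k%:R :> R.
  by rewrite ler_nat (leq_trans (in_index_le _ _))// (leq_trans (leq_pred t)).
by rewrite /noise_coef; lra.
Qed.

Definition noise_weight t w : R := noise_coef (Lb w) t / gam (Lb w) t.

Lemma noise_weight_le t w : (t <= k)%N ->
  0 <= noise_weight t w <= (2 * k%:R + 1) / (4 * Lbar0).
Proof.
move=> tk; have /andP[c0 c1] := noise_coef_le w tk; have g := gam_ge w t.
have /andP[L0 _] := HLbar0; have L4 : 0 < 4 * Lbar0 by rewrite mulr_gt0.
apply/andP; split; first exact: (divr_ge0 c0 (ltW (gam_gt0' w t))).
apply: ler_pM => //; first by rewrite invr_ge0 ltW.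
by rewrite lef_pV2 ?posrE// (lt_le_trans L4).
Qed.

Lemma noise_weight_known t : (1 <= t <= k)%N -> known_before_batch t (noise_weight t).
Proof.
move=> t1k j; have O s : (s <= t.-1)%N -> measurable_fun setT ((fun w => Lb w s) : Tgrad t j -> R).
  by move=> st; exact: past_batch_Lb.
apply: measurable_funM; first exact: measurable_noise_coef.
by apply: measurable_funV; exact: measurable_gam.
Qed.

Lemma noise_term_integrable t : (1 <= t <= k)%N ->
  P.-integrable setT (EFin \o (fun w => noise_weight t w * (sigma ^+ 2 / (b w t)%:R))).
Proof.
move=> t1k; have /andP[_ tk] := t1k.
apply: (bounded_integrable (C := (2 * k%:R + 1) / (4 * Lbar0) * sigma ^+ 2)).
  apply: measurable_funM.
    exact: (@past_sub (inl (t, 0%N)) _ (@noise_weight_known t t1k 0%N)).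
  by apply: measurable_funM => //; apply/measurable_funV/measurable_fun_of_nat/measurable_b.
move=> w; have /andP[h0 hC] := noise_weight_le w tk.
have b1 : (1 : R) <= (b w t)%:R by rewrite (ler_nat _ 1) (batch_gt0 Hrun).
have v0 : 0 <= sigma ^+ 2 / (b w t)%:R by rewrite divr_ge0 ?sqr_ge0.
apply/andP; split; first exact: mulr_ge0.
apply: ler_pM => //.
by rewrite ler_piMr ?sqr_ge0// invf_le1// (lt_le_trans ltr01).
Qed.

Definition gradient_error t w : 'rV[R]_n := batch_gradient w t - gradf (x w t.-1).

(** The error of the gradient estimate enters a step linearly, with mean 0, and
quadratically, with the variance of the batch. *)
Lemma gradient_error_mean t z : (1 <= t <= k)%N -> X z ->
  P.-integrable setT (EFin \o (fun w => - dotp (gradient_error t w) (x w t.-1 - z)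
     + noise_weight t w * enorm (gradient_error t w) ^+ 2)) /\
  \int[P]_w (- dotp (gradient_error t w) (x w t.-1 - z)
     + noise_weight t w * enorm (gradient_error t w) ^+ 2) <=
  \int[P]_w (noise_weight t w * (sigma ^+ 2 / (b w t)%:R)).
Proof.
move=> t1k Xz; have /andP[_ tk] := t1k.
have kw := noise_weight_known t1k; have wb w := noise_weight_le w tk.
have iv := batch_variance_integrable t1k kw wb.
have [il l0] : P.-integrable setT (EFin \o (fun w =>
      1 * dotp (batch_gradient w t - gradf (x w t.-1)) (x w t.-1 - z))) /\
    \int[P]_w (1 * dotp (batch_gradient w t - gradf (x w t.-1)) (x w t.-1 - z)) = 0.
  apply: (@batch_centered t (fun=> 1) 1 t1k _ _ (fun w => x w t.-1 - z) (diam X)) => //.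
  - by move=> w; rewrite ler01 lexx.
  - by move=> j; apply: coords_measurableB => //; exact: past_batch_x.
  - by move=> w; apply: le_diam => //; exact: iterate_in'.
have il' : P.-integrable setT (EFin \o (fun w => - dotp (gradient_error t w) (x w t.-1 - z))).
  have := integrableN il; apply: eq_integrable => // w _.
  by rewrite /= mul1r.
split; first by have := integrableD measurableT il' iv; apply: eq_integrable.
have l0' : \int[P]_w (- dotp (gradient_error t w) (x w t.-1 - z)) = 0.
  rewrite -[RHS](mulr0 (-1)) -[in RHS]l0 -RintegralZl//.
  by apply: eq_Rintegral => w _; rewrite mulN1r mul1r.
rewrite RintegralD// l0' add0r.
rewrite -lee_fin -integral_EFin// -integral_EFin//; first exact: batch_variance.
exact: noise_term_integrable.
Qed.

Definition exceeding t w : R :=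
  if curvature_threshold (Lb w) t < step_curv t w then ((in_index (Lb w) t.-1)%:R + 1) / 2
  else 0.

(** The part of the excess that is proportional to c - Lbar_t, with Lbar_t lowered to
the mean of the samples so that the expectation vanishes. *)
Definition curvature_gap t w : R := \sum_(j < b' t)
  exceeding t w / (b' t)%:R * ((step_curv t w - sample_curv t j w) * step_sq t w).

Lemma curvature_gap_mean t : (1 <= t <= k)%N ->
  P.-integrable setT (EFin \o curvature_gap t) /\ \int[P]_w curvature_gap t w = 0.
Proof.
move=> t1k; have /andP[_ tk] := t1k; have tk' := leq_trans (leq_pred t) tk.
have b0 : 0 < (b' t)%:R :> R by rewrite ltr0n; exact: (est_batch_gt0 Hrun).
have H0 w : 0 <= exceeding t w / (b' t)%:R <= (k%:R + 1) / (b' t)%:R.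
  have i0 : 0 <= (in_index (Lb w) t.-1)%:R :> R by [].
  have ik : (in_index (Lb w) t.-1)%:R <= k%:R :> R.
    by rewrite ler_nat (leq_trans (in_index_le _ _)).
  have k0 : 0 <= k%:R :> R by [].
  by rewrite ler_pM2r ?invr_gt0// pmulr_lge0 ?invr_gt0// /exceeding; case: ifP => _; lra.
have key (j : 'I_(b' t)) : P.-integrable setT (EFin \o (fun w =>
    exceeding t w / (b' t)%:R * ((step_curv t w - sample_curv t j w) * step_sq t w))) /\
  \int[P]_w (exceeding t w / (b' t)%:R *
    ((step_curv t w - sample_curv t j w) * step_sq t w)) = 0.
  have [_ mL] := past_est_iterates j t1k; apply: (sample_curv_unbiased t1k _ H0).
  apply: measurable_funM; [rewrite /exceeding|exact: measurable_cst].
  apply: measurable_fun_ifT => //.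
    apply: measurable_fun_ltr; last exact: past_est_step_curv.
    exact: measurable_curvature_threshold.
  exact: (measurable_fun_of_nat (fun i : nat => (i%:R + 1) / 2 : R) (measurable_in_index mL)).
have [int ->] := Rintegral_sum (index_enum 'I_(b' t)) (fun j => (key j).1).
by split=> //; rewrite big1// => j _; have [] := key j.
Qed.

Definition segment_start_cost t w : R :=
  if in_index (Lb w) t == 1%N then runmax (Lb w) t else 0.

Definition segment_close_length t w : nat :=
  if new_segment (Lb w) t then (in_index (Lb w) t.-1).-1 else 0.

Lemma excess_le_gap t w : (1 <= t <= k)%N -> (forall s, (s <= k)%N -> Lb w s <= Lhat) ->
  curvature_excess (Lb w) (step_curv t w) t * step_sq t w / 2 <=
  curvature_gap t w + segment_start_cost t w * diam X ^+ 2
  + (segment_close_length t w)%:R / 2 * Lhat * diam X ^+ 2.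
Proof.
move=> t1k LbL; have /andP[t1 tk] := t1k.
have /andP[r0 rD] := step_sq_le w tk.
have b0 : 0 < (b' t)%:R :> R by rewrite ltr0n; exact: (est_batch_gt0 Hrun).
have := curvature_excess_le_estimate (step_curv t w) (run_Lb0 w) t1 (LbL t tk).
move=> /(ler_wpM2r r0); rewrite mulrAC => /le_trans; apply.
rewrite !(mulrDl _ _ (step_sq t w)) lerD//; last first.
  rewrite /segment_close_length; case: ifP => _; last by rewrite !mul0r.
  by rewrite ler_wpM2l// mulr_ge0 ?divr_ge0// ltW// Lhat_gt0.
rewrite lerD//; last first.
  rewrite /segment_start_cost; case: ifP => _; last by rewrite !mul0r.
  by rewrite ler_wpM2l// ltW.
rewrite /curvature_gap -mulr_sumr -mulr_suml sumrB sumr_const card_ord /exceeding.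
case: ifP => _; last by rewrite !mul0r.
set a := (_ + 1) / 2.
rewrite -(mulrA a) -(mulrA a) ler_wpM2l//.
  by rewrite divr_ge0// addr_ge0.
rewrite (mulrA (b' t)%:R^-1) ler_wpM2r// mulrBr -(mulr_natl (step_curv t w)) mulrA mulVf ?gt_eqF// mul1r.
by rewrite lerB// mulrC mean_le_estimate.
Qed.

(** gamma_k / 2 is at most twice the maximum, and the openings cost three times the
maximum. *)
Lemma sum_segment_costs w : (forall s, (s <= k)%N -> Lb w s <= Lhat) ->
  gam (Lb w) k / 2 + \sum_(1 <= t < k.+1) segment_start_cost t w <= 5 * Lhat.
Proof.
move=> LbL; have rk : runmax (Lb w) k <= Lhat by exact/runmaxP.
have := sum_runmax_first k (run_Lb0 w); rewrite /gam -/(segment_start_cost _ w).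
have := runmax_homo (Lb w) (leq_pred k).
by rewrite /segment_start_cost; lra.
Qed.

Lemma sum_close_lengths w :
  \sum_(1 <= t < k.+1) (segment_close_length t w)%:R <= k%:R - (num_segments (Lb w) k)%:R :> R.
Proof.
rewrite lerBrDr -natr_sum -natrD ler_nat -[leqRHS](sum_closed_lengths (Lb w) Hk).
by rewrite leq_add2r leq_addr.
Qed.

(** With the largest sample as estimate, the excess only matters when all samples
fall short. *)
Definition shortfall t w : R :=
  t%:R / 2 * Lhat * diam X ^+ 2 * \prod_(j < b' t) (underestimated t j w)%:R.

Lemma excess_le_shortfall t w : est = EstimatorII -> (1 <= t <= k)%N ->
  curvature_excess (Lb w) (step_curv t w) t * step_sq t w / 2 <=
  shortfall t w + segment_start_cost t w * diam X ^+ 2.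
Proof.
move=> estE t1k; have /andP[t1 tk] := t1k; have /andP[r0 rD] := step_sq_le w tk.
have cL := curvature_le_Lhat (iterate_in w tk) (iterate_in' w tk).
have := curvature_excess_le_underestimate (run_Lb0 w) t1 cL (ltW Lhat_gt0).
move=> /(ler_wpM2r r0); rewrite mulrAC => /le_trans; apply.
rewrite mulrDl addrC lerD//; last first.
  rewrite /segment_start_cost; case: ifP => _; last by rewrite !mul0r.
  by rewrite ler_wpM2l// ltW.
have := estimate_le_half w estE t1k; rewrite /shortfall /step_curv.
have tL : 0 <= t%:R / 2 * Lhat by rewrite mulr_ge0 ?divr_ge0// ltW// Lhat_gt0.
case: ifP => [_|_ _]; last first.
  by rewrite mul0r mulr_ge0 ?prodr_ge0// mulr_ge0// sqr_ge0.
move=> h; rewrite -[_ * _ * \prod_(j < _) _]mulrA ler_wpM2l// (le_trans rD)//.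
by rewrite ler_peMr ?sqr_ge0.
Qed.

Lemma measurable_underestimated t j : (1 <= t <= k)%N ->
  measurable_fun setT (fun w => (underestimated t j w)%:R : R).
Proof.
move=> t1k; have /andP[_ tk] := t1k; apply: measurable_natr_bool.
apply: measurable_fun_ler.
  apply: measurable_maxr => //; apply: measurable_sample_curvature.
  - exact: measurable_x.
  - by apply: measurable_x; exact: leq_trans (leq_pred _) tk.
  - by move=> w; exact: iterate_in.
  - by move=> w; exact: iterate_in'.
  - exact: measurable_xibar.
apply: measurable_funM => //; apply: measurable_objective_curvature.
- exact: measurable_x.
- by apply: measurable_x; exact: leq_trans (leq_pred _) tk.
- by move=> w; exact: iterate_in.
- by move=> w; exact: iterate_in'.
Qed.

Lemma shortfall_mean t : (1 <= t <= k)%N -> P.-integrable setT (EFin \o shortfall t) /\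
  \int[P]_w shortfall t w <= t%:R / 2 * Lhat * diam X ^+ 2 * beta ^+ b' t.
Proof.
move=> t1k; have c0 : 0 <= t%:R / 2 * Lhat * diam X ^+ 2.
  by rewrite mulr_ge0 ?sqr_ge0// mulr_ge0 ?divr_ge0// ltW// Lhat_gt0.
have ip : P.-integrable setT (EFin \o (fun w => \prod_(j < b' t) (underestimated t j w)%:R)).
  apply: (bounded_integrable (C := 1)).
    by apply: measurable_prod => j _; exact: measurable_underestimated.
  by move=> w; rewrite prodr_ge0//= prodr_ile1// => j _; rewrite ler0n lern1 leq_b1.
split.
  by have := integrableZl measurableT (t%:R / 2 * Lhat * diam X ^+ 2) ip; apply: eq_integrable.
rewrite RintegralZl// ler_wpM2l// -lee_fin -integral_EFin//.
exact: all_underestimated.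
Qed.

(** * The trajectory in expectation *)

Definition sqgrad t w : R :=
  enorm (proj_grad X (x w t.-1) (gradf (x w t.-1)) (gam (Lb w) t)) ^+ 2.

Definition trajectory_sum w : R :=
  \sum_(1 <= t < k.+1) weight (Lb w) t / gam (Lb w) t * sqgrad t w.

Definition noise_sum w : R :=
  \sum_(1 <= t < k.+1) noise_coef (Lb w) t * (sigma ^+ 2 / ((b w t)%:R * gam (Lb w) t)).

Lemma drawn_sqgrad t : (1 <= t <= k)%N -> measurable_fun setT (sqgrad t : Tk -> R).
Proof.
move=> /andP[t1 tk]; have tk' := leq_trans (leq_pred t) tk.
have mg : measurable_fun setT ((fun w => gam (Lb w) t) : Tk -> R).
  by apply: measurable_gam => s st; apply: drawn_Lb; exact: leq_trans tk'.
have mx := drawn_x tk'; have Xx w := run_in_domain w tk'.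
apply: measurable_enorm2; apply: coords_measurableZ => //.
apply: coords_measurableB => //.
rewrite (_ : (fun w => _) = (fun w => euclid_proj X (x w t.-1 - (gam (Lb w) t)^-1 *: gradf (x w t.-1)))).
  apply: coords_measurable_proj; apply: coords_measurableB => //.
  apply: coords_measurableZ; first exact: measurable_funV.
  exact: coords_measurable_gradf.
by apply/funext => w; rewrite prox_proj.
Qed.

Lemma measurable_trajectory_sum : measurable_fun setT trajectory_sum.
Proof.
apply: measurable_sum_nat1 => t t1k; have /andP[_ tk] := t1k; apply: measurable_funM.
  by apply: measurable_weight_gam => s st; apply: measurable_Lb; exact: leq_trans tk.
by apply: drawn_observable; exact: drawn_sqgrad.
Qed.

Lemma trajectory_sum_ge0 w : 0 <= trajectory_sum w.
Proof.
apply: sumr_ge0 => t _; rewrite mulr_ge0 ?sqr_ge0// divr_ge0 ?weight_ge0//.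
exact: ltW.
Qed.

Lemma noise_sumE w :
  noise_sum w = \sum_(1 <= t < k.+1) noise_weight t w * (sigma ^+ 2 / (b w t)%:R).
Proof.
by apply: eq_bigr => t _; rewrite /noise_weight invfM; ring.
Qed.

Lemma Rintegral_sum_nat1 (h : nat -> Om -> R) N :
  (forall t, (1 <= t <= N)%N -> P.-integrable setT (EFin \o h t)) ->
  P.-integrable setT (EFin \o (fun w => \sum_(1 <= t < N.+1) h t w)) /\
  \int[P]_w (\sum_(1 <= t < N.+1) h t w) = \sum_(1 <= t < N.+1) \int[P]_w h t w.
Proof.
move=> hi; have hi' (t : 'I_N) : P.-integrable setT (EFin \o h t.+1).
  exact: (hi t.+1 (ltn_ord t)).
have [h1 h2] := Rintegral_sum (index_enum 'I_N) hi'.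
rewrite big_add1 big_mkord /= -h2; split.
  by apply: eq_integrable h1 => // w _; rewrite /= big_add1 big_mkord.
by apply: eq_Rintegral => w _; rewrite big_add1 big_mkord.
Qed.

(** A collects the costs bounded pathwise, and g t the cost of iteration t that is
bounded only in expectation. The two regimes differ in the choice of g: the gap to
the mean sample, or the event that all samples fall short. *)
Lemma expected_trajectory (A : Om -> R) (g : nat -> Om -> R) (a : nat -> R)
    (D := diam X) :
  P.-integrable setT (EFin \o A) ->
  (forall t, (1 <= t <= k)%N -> P.-integrable setT (EFin \o g t) /\
     \int[P]_w g t w <= a t) ->
  {ae P, forall w, gam (Lb w) k * D ^+ 2 / 2 + \sum_(1 <= t < k.+1)
     curvature_excess (Lb w) (step_curv t w) t * step_sq t w / 2 <=
     A w + \sum_(1 <= t < k.+1) g t w} ->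
  (\int[P]_w (trajectory_sum w)%:E <= \int[P]_w (A w)%:E
     + (k%:R * l * D ^+ 2 / 2 + \sum_(1 <= t < k.+1) a t)%:E + \int[P]_w (noise_sum w)%:E)%E.
Proof.
move=> iA ig le; have [z Xz zmin] := objective_argmin Hproblem X0.
pose U t w := - dotp (gradient_error t w) (x w t.-1 - z)
     + noise_weight t w * enorm (gradient_error t w) ^+ 2.
have iU t (t1k : (1 <= t <= k)%N) := gradient_error_mean t1k Xz.
have [isU sU] := Rintegral_sum_nat1 (fun t t1k => (iU t t1k).1).
have [isg sg] := Rintegral_sum_nat1 (fun t t1k => (ig t t1k).1).
have [isn sn] := Rintegral_sum_nat1 noise_term_integrable.
pose K := k%:R * l * D ^+ 2 / 2.
pose B w := A w + K.
have iB : P.-integrable setT (EFin \o B).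
  have := integrableD measurableT iA (finite_measure_integrable_cst P K measurableT).
  by apply: eq_integrable.
pose V w := \sum_(1 <= t < k.+1) g t w + \sum_(1 <= t < k.+1) U t w.
have iV : P.-integrable setT (EFin \o V).
  by have := integrableD measurableT isg isU; apply: eq_integrable.
have iBV : P.-integrable setT (EFin \o (fun w => B w + V w)).
  by have := integrableD measurableT iB iV; apply: eq_integrable.
have path : {ae P, forall w, trajectory_sum w <= B w + V w}.
  apply: filterS le => w le.
  have := trajectory_inequality Hproblem (e := Lb w) (xs := x w) (gs := batch_gradient w)
    (run_Lb0 w) Hk (run_in_domain w (leq0n k)) (fun t => iterate Hrun w (t := t)) Xz zmin.
  move=> /le_trans; apply; rewrite big_split /= addrA.
  have -> : \sum_(1 <= t < k.+1) (- dotp (batch_gradient w t - gradf (x w t.-1)) (x w t.-1 - z)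
      + noise_coef (Lb w) t * (enorm (batch_gradient w t - gradf (x w t.-1)) ^+ 2 / gam (Lb w) t))
    = \sum_(1 <= t < k.+1) U t w.
    apply: eq_bigr => t _; congr (_ + _).
    by rewrite /noise_weight -/(gradient_error t w); ring.
  move: le; rewrite /V /B /K /step_curv /step_sq -/D.
  set S1 := \sum_(_ <= _ < _) _; set S2 := \sum_(_ <= _ < _) _; set S3 := \sum_(_ <= _ < _) _.
  lra.
have iT : P.-integrable setT (EFin \o trajectory_sum).
  apply: (ae_le_integrable (g := fun w => B w + V w)) => //.
    exact: measurable_trajectory_sum.
  by apply: filterS path => w h; rewrite ger0_norm// trajectory_sum_ge0.
have := ae_le_Rintegral iT iBV path.
have -> : (\int[P]_w (noise_sum w)%:E = (\sum_(1 <= t < k.+1)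
    \int[P]_w (noise_weight t w * (sigma ^+ 2 / (b w t)%:R)))%:E)%E.
  rewrite -sn -integral_EFin//; apply: eq_integral => w _; by rewrite noise_sumE.
rewrite !integral_EFin// -!EFinD lee_fin => /le_trans; apply.
have iK : P.-integrable setT (EFin \o (fun=> K)) by exact: finite_measure_integrable_cst.
rewrite RintegralD// [X in X + _ <= _]RintegralD// Rintegral_probability_cst RintegralD//.
rewrite sg sU -!addrA lerD2l lerD2l lerD//.
  by apply: ler_sum_nat => t /andP[t1 tk]; apply: (ig t _).2; rewrite t1.
by apply: ler_sum_nat => t /andP[t1 tk]; apply: (iU t _).2; rewrite t1.
Qed.

Let D := diam X.

Let D0 : 0 <= D ^+ 2. Proof. exact: sqr_ge0. Qed.

Lemma num_segments_le w : (num_segments (Lb w) k <= k)%N.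
Proof. exact: seg_index_le. Qed.

Lemma measurable_num_segments : measurable_fun setT (fun w => num_segments (Lb w) k).
Proof. by apply: measurable_seg_index => s sk; exact: measurable_Lb. Qed.

Lemma segments_fun_integrable (h : nat -> R) :
  (forall m, (m <= k)%N -> 0 <= h m) ->
  P.-integrable setT (EFin \o (fun w => h (num_segments (Lb w) k))).
Proof.
move=> h0; apply: (bounded_integrable (C := \sum_(m < k.+1) h m)).
  by apply: measurable_fun_of_nat; exact: measurable_num_segments.
move=> w; have mk := num_segments_le w; rewrite h0//=.
rewrite (bigD1 (Ordinal (mk : (num_segments (Lb w) k < k.+1)%N)))//= lerDl.
by apply: sumr_ge0 => j _; apply: h0; rewrite -ltnS.
Qed.

Lemma basic_trajectory : (\int[P]_w (trajectory_sum w)%:E <=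
  \int[P]_w ((10 + k%:R - (num_segments (Lb w) k)%:R) * Lhat * D ^+ 2 / 2)%:E
  + (k%:R * l * D ^+ 2 / 2)%:E + \int[P]_w (noise_sum w)%:E)%E.
Proof.
have := @expected_trajectory (fun w => (10 + k%:R - (num_segments (Lb w) k)%:R) * Lhat * D ^+ 2 / 2)
  curvature_gap (fun=> 0).
rewrite -/D /= big1_eq addr0; apply.
- apply: (segments_fun_integrable (h := fun m => (10 + k%:R - m%:R) * Lhat * D ^+ 2 / 2)) => m mk.
  have : m%:R <= k%:R :> R by rewrite ler_nat.
  by move=> ?; rewrite divr_ge0// mulr_ge0// mulr_ge0 ?(ltW Lhat_gt0)//; lra.
- by move=> t t1k; have [i0 ->] := curvature_gap_mean t1k.
apply: filterS estimates_le_Lhat => w LbL.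
have S : \sum_(1 <= t < k.+1) curvature_excess (Lb w) (step_curv t w) t * step_sq t w / 2 <=
    \sum_(1 <= t < k.+1) curvature_gap t w
    + (\sum_(1 <= t < k.+1) segment_start_cost t w) * D ^+ 2
    + (\sum_(1 <= t < k.+1) (segment_close_length t w)%:R) / 2 * Lhat * D ^+ 2.
  rewrite !mulr_suml -!big_split/=; apply: ler_sum_nat => t /andP[t1 tk].
  by apply: excess_le_gap => //; rewrite t1.
have C1 := ler_wpM2r D0 (sum_segment_costs LbL).
have LD : 0 <= Lhat * D ^+ 2 by rewrite mulr_ge0// ltW// Lhat_gt0.
have C2 := ler_wpM2r LD (sum_close_lengths w).
move: S C1 C2; set S1 := \sum_(_ <= _ < _) _; set S2 := \sum_(_ <= _ < _) _.
set S3 := \sum_(_ <= _ < _) _; set S4 := \sum_(_ <= _ < _) _.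
lra.
Qed.

Lemma logb_power_le (c q : R) N : 0 <= c < 1 -> 1 <= q -> (0 < N)%N ->
  2 * logb (1 / c) q <= N%:R -> c ^+ N <= q ^- 2.
Proof.
move=> /andP[c0 c1] q1 N0; have q0 : 0 < q by apply: lt_le_trans q1.
have [->|cn] := eqVneq c 0.
  by rewrite expr0n gtn_eqF// invr_ge0 exprn_ge0// ltW.
have c_gt0 : 0 < c by rewrite lt_neqAle eq_sym cn.
rewrite /logb div1r lnV ?posrE//; have l0 : 0 < - ln c by rewrite oppr_gt0 ln_lt0// c_gt0.
rewrite mulrA ler_pdivrMr// => h.
rewrite -ler_ln ?posrE ?exprn_gt0 ?invr_gt0 ?exprn_gt0//.
rewrite lnV ?posrE ?exprn_gt0// !lnXn// -mulr_natl -(mulr_natl (ln q)).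
lra.
Qed.

Lemma improved_trajectory (bhat : R) : est = EstimatorII -> beta < 1 ->
  2 * logb (1 / beta) (k%:R + 1) <= bhat ->
  (forall t, (1 <= t <= k)%N -> bhat <= (b' t)%:R) ->
  (\int[P]_w (trajectory_sum w)%:E <= (21 * Lhat * D ^+ 2 / 4)%:E
  + (k%:R * l * D ^+ 2 / 2)%:E + \int[P]_w (noise_sum w)%:E)%E.
Proof.
move=> estE beta1 hlog hb.
have k0 : 0 <= k%:R :> R by [].
have LD : 0 <= Lhat * D ^+ 2 by rewrite mulr_ge0// ltW// Lhat_gt0.
pose a (t : nat) : R := t%:R / 2 * Lhat * D ^+ 2 * (k%:R + 1) ^- 2.
(* 5 + 1/4 = 21/4, the 5 coming from the segment costs *)
have aE : \sum_(1 <= t < k.+1) a t <= Lhat * D ^+ 2 / 4.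
  have S N : \sum_(1 <= t < N.+1) t%:R = N%:R * (N%:R + 1) / 2 :> R.
    elim: N => [|N ih]; first by rewrite big_geq// mul0r mul0r.
    by rewrite sum_nat1_recr ih -[N.+1%:R]natr1; field.
  rewrite /a -!mulr_suml S ler_pdivrMr ?exprn_gt0 ?ltr_wpDl//.
  by have := mulr_ge0 LD (addr_ge0 k0 ler01); lra.
have iA : P.-integrable setT (EFin \o (fun=> 5 * Lhat * D ^+ 2)).
  exact: finite_measure_integrable_cst.
have ig t : (1 <= t <= k)%N -> P.-integrable setT (EFin \o shortfall t) /\
    \int[P]_w shortfall t w <= a t.
  move=> t1k; have [i0 h0] := shortfall_mean t1k; split=> //; apply: le_trans h0 _.
  rewrite -/D ler_wpM2l//; first by rewrite -mulrA mulr_ge0// divr_ge0.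
  apply: logb_power_le; rewrite ?beta_ge0 ?lerDr//.
    exact: (est_batch_gt0 Hrun).
  exact: le_trans hlog (hb t t1k).
have := expected_trajectory iA ig; rewrite -/D => h.
apply: le_trans (h _) _.
  apply: filterS estimates_le_Lhat => w LbL.
  have S : \sum_(1 <= t < k.+1) curvature_excess (Lb w) (step_curv t w) t * step_sq t w / 2 <=
      \sum_(1 <= t < k.+1) shortfall t w
      + (\sum_(1 <= t < k.+1) segment_start_cost t w) * D ^+ 2.
    rewrite !mulr_suml -!big_split/=; apply: ler_sum_nat => t /andP[t1 tk].
    by apply: excess_le_shortfall => //; rewrite t1.
  have C1 := ler_wpM2r D0 (sum_segment_costs LbL).
  move: S C1; set S1 := \sum_(_ <= _ < _) _; set S2 := \sum_(_ <= _ < _) _.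
  by set S3 := \sum_(_ <= _ < _) _; lra.
rewrite leeD2r// integral_probability_cst -!EFinD lee_fin; lra.
Qed.

(** * The random output *)

Section Output.
Context {out : Om -> nat}.
Hypothesis Hout : random_output P k xi xibar b b' Lb out.

Let total w : R := \sum_(1 <= t < k.+1) weight (Lb w) t / gam (Lb w) t.
Let selected t w : R := ((2 <= t)%N && (out w == t.-1))%:R.
Let g2 := output_sqgrad X gradf x Lb out.

Let term_ge0 t w : 0 <= weight (Lb w) t / gam (Lb w) t.
Proof. by rewrite divr_ge0 ?weight_ge0// ltW. Qed.

Let total_ge0 w : 0 <= total w.
Proof. by apply: sumr_ge0 => t _; exact: term_ge0. Qed.

Let drawn_total : measurable_fun setT (total : Tk -> R).
Proof. by apply: measurable_weight_sum => s sk; exact: drawn_Lb. Qed.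

Let measurable_total : measurable_fun setT total.
Proof. exact: drawn_observable. Qed.

Let output_prob_ge0 t w : 0 <= output_prob (Lb w) k t.
Proof. by apply: mulr_ge0 (term_ge0 t w); rewrite invr_ge0; exact: total_ge0. Qed.

Let measurable_prob t : (t <= k)%N -> measurable_fun setT (fun w => output_prob (Lb w) k t).
Proof. by move=> tk; apply: measurable_output_prob => // s sk; exact: measurable_Lb. Qed.

Let measurable_out : measurable_fun setT out.
Proof. by apply/measurable_nat_index; exact: output_measurable Hout. Qed.

Let measurable_selected t : measurable_fun setT (selected t).
Proof.
exact: (measurable_fun_of_nat (fun N => ((2 <= t)%N && (N == t.-1))%:R : R) measurable_out).
Qed.

Let observe (w : Om) : Tk := w.

Let measurable_observe : measurable_fun setT observe.
Proof. by move=> _ B mB; rewrite setTI; exact: (drawn_measurable (leqnn k)). Qed.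

HB.instance Definition _ := isMeasurableFun.Build _ _ _ _ observe measurable_observe.

(** The conditional law of the output, for functions of the samples instead of
events. *)
Lemma output_integral t (h : Om -> R) : (1 <= t <= k)%N ->
  measurable_fun setT (h : Tk -> R) -> (forall w, 0 <= h w) ->
  (\int[P]_w (h w * selected t w)%:E = \int[P]_w (h w * output_prob (Lb w) k t)%:E)%E.
Proof.
case: t => [|[|t]]// t1k mh h0.
  (* at t = 1 the left-hand side is 0 by definition, and the weight on the right is 0 *)
  rewrite !integral0_eq// => w _; rewrite ?mulr0//.
  by rewrite /output_prob /weight /= mul0r !mulr0.
have /andP[_ tk] := t1k; have t2k : (2 <= t.+2 <= k)%N by exact: t1k.
apply: (eq_integral_weight (past := observe)) => //; first exact: measurable_prob.
move=> A mA; rewrite -(output_law Hout t2k mA).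
rewrite (_ : (fun w => (selected t.+2 w)%:E) =
  (fun w => (\1_[set w | out w = t.+1] w)%:E)); last first.
  apply/funext => w; rewrite indicE /selected; congr (nat_of_bool _)%:R%:E.
  by apply/eqP/idP => [h1|/set_mem]//; exact/mem_set.
rewrite integral_indic; first by rewrite setIC.
- exact: (drawn_measurable (leqnn k)).
- exact: (output_measurable Hout).
Qed.

Let sum_selected w : \sum_(1 <= t < k.+1) selected t w = (0 < out w < k)%N%:R.
Proof.
have [ok|ok] := boolP (0 < out w < k)%N; last first.
  rewrite big_nat big1// => -[|[|t]]//= tk; rewrite /selected/=.
  by case: eqP => // oE; move: ok; rewrite oE /= -ltnS tk.
have /andP[q0 qk] := ok; rewrite (bigD1_seq (out w).+1) ?iota_uniq ?mem_index_iota//.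
rewrite big1 => [|t tn]; first by rewrite /= addr0 /selected ltnS q0 eqxx.
rewrite /selected; case: eqP => [oE|_]; last by rewrite andbF.
by case: t tn oE => [|[|t]]//= tn oE; rewrite oE eqxx in tn.
Qed.

(** On this event nothing is known about the output, and its squared gradient need
not be measurable there. *)
Let stray : set Om := [set w | (total w != 0) && ~~ (0 < out w < k)%N].

Let measurable_stray : measurable stray.
Proof.
have m : measurable_fun setT (fun w => (total w != 0) && ~~ (0 < out w < k)%N).
  apply: measurable_and; last exact: (measurable_fun_of_nat (fun N => ~~ (0 < N < k)%N)).
  by apply: measurable_neg; exact: measurable_fun_eqr.
by rewrite -[stray]setTI; exact: (m measurableT [set true] I).
Qed.

(** The conditional probabilities of the values 1, ..., k - 1 sum to 1 as soon as one
of the weights is positive. *)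
Lemma output_in_range : P stray = 0%E.
Proof.
pose c w : R := (total w != 0)%:R.
have c0 w : 0 <= c w by [].
have drawn_c : measurable_fun setT (c : Tk -> R).
  by apply: measurable_natr_bool; apply: measurable_neg; exact: measurable_fun_eqr.
have mc : measurable_fun setT c by exact: drawn_observable.
have ic : P.-integrable setT (EFin \o c).
  by apply: (bounded_integrable (C := 1)) => // w; rewrite c0 lern1 leq_b1.
have is_ t : P.-integrable setT (EFin \o (fun w => c w * selected t w)).
  apply: (bounded_integrable (C := 1)); first exact: measurable_funM.
  by move=> w; rewrite mulr_ge0//= mulr_ile1// lern1 leq_b1.
have ip t : (1 <= t <= k)%N ->
    P.-integrable setT (EFin \o (fun w => c w * output_prob (Lb w) k t)).
  move=> t1k; have /andP[_ tk] := t1k; apply: integrable_of_ge0_le (is_ t) _.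
  - by apply: measurable_funM => //; exact: measurable_prob.
  - by move=> w; rewrite mulr_ge0.
  - by rewrite output_integral.
have [_ sums] := Rintegral_sum_nat1 (fun t (_ : (1 <= t <= k)%N) => is_ t).
have [_ sump] := Rintegral_sum_nat1 ip.
have ssE : \sum_(1 <= t < k.+1) \int[P]_w (c w * selected t w) =
    \sum_(1 <= t < k.+1) \int[P]_w (c w * output_prob (Lb w) k t).
  apply: eq_big_nat => t /andP[t1 tk]; rewrite /Rintegral output_integral//.
  by rewrite t1.
have cE w : c w = \sum_(1 <= t < k.+1) c w * output_prob (Lb w) k t.
  rewrite -mulr_sumr /output_prob -mulr_sumr -/(total w) /c.
  by have [->|tn] := eqVneq (total w) 0; rewrite ?mul0r// mulVf// mulr1.
have iss : P.-integrable setT (EFin \o (fun w => \sum_(1 <= t < k.+1) c w * selected t w)).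
  exact: (Rintegral_sum_nat1 (fun t (_ : (1 <= t <= k)%N) => is_ t)).1.
have sE w : (\1_stray w : R) = c w - \sum_(1 <= t < k.+1) c w * selected t w.
  rewrite -mulr_sumr sum_selected /c indicE.
  rewrite (_ : (w \in stray) = (total w != 0) && ~~ (0 < out w < k)%N).
    by case: (total w != 0); case: (0 < out w < k)%N; rewrite /= ?mul0r ?mulr0 ?mulr1 ?subr0 ?subrr.
  by apply/idP/idP => [/set_mem|h]//; exact/mem_set.
rewrite -[LHS]fineK ?fin_num_measure//; congr (_%:E).
transitivity (\int[P]_w (\1_stray w : R)).
  by rewrite /Rintegral integral_indic// setIT.
under eq_Rintegral do rewrite sE.
rewrite RintegralB// sums ssE -sump.
by under [X in _ - X]eq_Rintegral do rewrite -cE; rewrite subrr.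
Qed.

Let measurable_sqgrad t : (1 <= t <= k)%N -> measurable_fun setT (sqgrad t).
Proof. by move=> t1k; apply: drawn_observable; exact: drawn_sqgrad. Qed.

(** Where the output is t - 1, its squared gradient is that of iteration t; this has
conditional probability weight_t / gamma_t over the total, which cancels. *)
Lemma output_le_trajectory (c : R) (h : Om -> R) : 0 <= c -> (forall w, 0 <= h w) ->
  {ae P, forall w, h w <= c * (total w * g2 w)} ->
  (\int[P]_w (h w)%:E <= c%:E * \int[P]_w (trajectory_sum w)%:E)%E.
Proof.
move=> c0 h0 [N [mN N0 hN]].
pose term t w := total w * sqgrad t w * selected t w.
have sq0 t w : 0 <= sqgrad t w by exact: sqr_ge0.
have term0 t w : 0 <= term t w by rewrite mulr_ge0// mulr_ge0.
pose Gs w := \sum_(1 <= t < k.+1) term t w.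
have Gs0 w : 0 <= Gs w by apply: sumr_ge0.
have mterm t : (1 <= t <= k)%N -> measurable_fun setT (term t).
  move=> t1k; apply: measurable_funM => //; apply: measurable_funM => //.
  exact: measurable_sqgrad.
have mGs : measurable_fun setT Gs by exact: measurable_sum_nat1.
have mtraj t : (1 <= t <= k)%N ->
    measurable_fun setT (fun w => weight (Lb w) t / gam (Lb w) t * sqgrad t w).
  move=> t1k; have /andP[_ tk] := t1k; apply: measurable_funM; last exact: measurable_sqgrad.
  by apply: measurable_weight_gam => s st; apply: measurable_Lb; exact: leq_trans tk.
have le t : (1 <= t <= k)%N ->
    (\int[P]_w (term t w)%:E <=
     \int[P]_w (weight (Lb w) t / gam (Lb w) t * sqgrad t w)%:E)%E.
  move=> t1k; have /andP[_ tk] := t1k.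
  rewrite (output_integral t1k (h := fun w => total w * sqgrad t w)); first last.
  - by move=> w; rewrite mulr_ge0.
  - by apply: measurable_funM => //; exact: drawn_sqgrad.
  apply: ge0_le_integral => //.
  - by move=> w _; rewrite lee_fin mulr_ge0// mulr_ge0.
  - apply/measurable_EFinP; apply: measurable_funM; last exact: measurable_prob.
    by apply: measurable_funM => //; exact: measurable_sqgrad.
  - by apply/measurable_EFinP; exact: mtraj.
  move=> w _; rewrite lee_fin mulrAC ler_wpM2r//.
  rewrite /output_prob -/(total w) mulrA.
  have [->|tn] := eqVneq (total w) 0; first by rewrite mul0r mul0r.
  by rewrite mulfV// mul1r.
apply: (@le_trans _ _ (\int[P]_w (c * Gs w)%:E)%E).
  apply: (le_integral_off_null (N := stray `|` N)) => //.
  - exact: measurableU.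
  - exact: null_set_setU measurable_stray mN output_in_range N0.
  - exact: measurable_funM.
  - by move=> w; rewrite mulr_ge0.
  move=> w /not_orP[ns nN].
  have hw : h w <= c * (total w * g2 w) by apply: contrapT => hw; apply: nN; exact: hN.
  apply: le_trans hw _; apply: ler_wpM2l => //.
  have [->|tn] := eqVneq (total w) 0; first by rewrite mul0r.
  have /andP[q0 ok] : (0 < out w < k)%N.
    by apply: contrapT => o; apply: ns; rewrite /stray /= tn; exact/negP.
  rewrite /Gs (bigD1_seq (out w).+1) ?iota_uniq ?mem_index_iota//=.
  have -> : g2 w = sqgrad (out w).+1 w by rewrite /sqgrad succnK.
  by rewrite {1}/term /selected ltnS succnK q0 eqxx mulr1 lerDl sumr_ge0.
under eq_integral do rewrite EFinM.
rewrite ge0_integralZl_EFin//; first last.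
- exact/measurable_EFinP.
- by move=> w _; rewrite lee_fin.
rewrite lee_wpmul2l ?lee_fin//.
have sumE (q : nat -> Om -> R) : (forall t, (1 <= t <= k)%N -> measurable_fun setT (q t)) ->
    (forall t w, 0 <= q t w) -> (\int[P]_w (\sum_(1 <= t < k.+1) q t w)%:E =
    \sum_(t < k) \int[P]_w (q t.+1 w)%:E)%E.
  move=> mq q0; rewrite -ge0_integral_sum//.
  - by apply: eq_integral => w _; rewrite sumEFin big_add1 big_mkord.
  - by move=> t; apply/measurable_EFinP; exact: (mq t.+1 (ltn_ord t)).
  - by move=> t w _; rewrite lee_fin.
rewrite !sumE//; last by move=> t w; rewrite mulr_ge0.
by apply: lee_sum => t _; exact: (le t.+1 (ltn_ord t)).
Qed.

(** With fewer segments than iterations the lower bound for the total is positive,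
and its running maximum is almost surely at most Lhat. *)
Lemma unweighted_output (mmax : nat) :
  {ae P, forall w, (num_segments (Lb w) k <= mmax)%N} -> (mmax < k)%N ->
  (\int[P]_w (g2 w)%:E <= (128 * Lhat / (k%:R - mmax%:R) ^+ 2)%:E *
     \int[P]_w (trajectory_sum w)%:E)%E.
Proof.
move=> mle mk; have km : 0 < k%:R - mmax%:R :> R by rewrite subr_gt0 ltr_nat.
have L0 := Lhat_gt0.
have c0 : 0 < 128 * Lhat / (k%:R - mmax%:R) ^+ 2 by rewrite divr_gt0 ?exprn_gt0// mulr_gt0.
apply: output_le_trajectory => //; first exact: ltW.
  by move=> w; exact: sqr_ge0.
apply: filterS2 mle estimates_le_Lhat => w mw LbL.
have g0 : 0 <= g2 w by exact: sqr_ge0.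
rewrite mulrA -[leLHS]mul1r ler_wpM2r//.
have lower := Msum_lower (run_Lb0 w) Hk; rewrite MsumE -/(total w) in lower.
have r0 := runmax_gt0' w k.-1.
have rL : runmax (Lb w) k.-1 <= Lhat.
  by apply/runmaxP => s sk; apply: LbL; exact: leq_trans sk (leq_pred _).
rewrite -ler_pdivrMl// mulr1 invf_div (le_trans _ lower)//.
apply: ler_pM; rewrite ?invr_ge0 ?exprn_ge0 ?mulr_ge0 ?(ltW L0) ?(ltW km)//.
  rewrite ler_pXn2r ?nnegrE ?(ltW km)//; last by rewrite subr_ge0 ler_nat num_segments_le.
  by rewrite lerB// ler_nat.
by rewrite lef_pV2 ?posrE ?mulr_gt0// ler_pM2l.
Qed.

Lemma weighted_output : (\int[P]_w (Msum (Lb w) k * g2 w)%:E <=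
  \int[P]_w (trajectory_sum w)%:E)%E.
Proof.
rewrite -[leRHS]mul1e; apply: output_le_trajectory => //.
  by move=> w; rewrite MsumE -/(total w) mulr_ge0// sqr_ge0.
by apply: nearW => w; rewrite mul1r MsumE.
Qed.

Let noise_coef_ge0 w t : 0 <= noise_coef (Lb w) t.
Proof. by rewrite /noise_coef addr_ge0// divr_ge0// mulr_ge0. Qed.

Lemma noise_sum_le (c : R) : (forall w, noise_sum w <= c) ->
  (\int[P]_w (noise_sum w)%:E <= c%:E)%E.
Proof.
move=> hc; rewrite -(integral_probability_cst P c).
have [i _] := Rintegral_sum_nat1 noise_term_integrable.
apply: ge0_le_integral => //.
- move=> w _; rewrite lee_fin noise_sumE; apply: sumr_ge0 => t _.
  by rewrite mulr_ge0 ?divr_ge0 ?sqr_ge0 ?noise_coef_ge0// ltW.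
- by under eq_fun do rewrite noise_sumE; exact: measurable_int i.
- by move=> w _; rewrite lee_fin.
Qed.

Lemma adaptive_noise (alpha : R) : 0 < alpha ->
  (forall t w, (1 <= t <= k)%N -> (b w t)%:Z =
     Num.max 1 (Num.ceil (noise_coef (Lb w) t * (alpha / gam (Lb w) t)))) ->
  forall w, noise_sum w <= k%:R * (sigma ^+ 2 / alpha).
Proof.
move=> a0 hb w; rewrite mulr_natl.
apply: (@le_trans _ _ (\sum_(1 <= t < k.+1) sigma ^+ 2 / alpha)); last first.
  by rewrite sumr_const_nat subSS subn0.
apply: ler_sum_nat => t /andP[t1 tk]; have t1k : (1 <= t <= k)%N by rewrite t1.
have b0 : 0 < (b w t)%:R :> R by rewrite ltr0n (batch_gt0 Hrun).
have g0 := gam_gt0' w t.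
have le : noise_coef (Lb w) t * (alpha / gam (Lb w) t) <= (b w t)%:R.
  rewrite pmulrn hb//; apply: le_trans (Num.Theory.ceil_ge _) _.
  by rewrite ler_int le_max lexx orbT.
rewrite (_ : _ * _ = noise_coef (Lb w) t * (alpha / gam (Lb w) t) / (b w t)%:R * (sigma ^+ 2 / alpha)).
  apply: ler_piMl; last by rewrite ler_pdivrMr// mul1r.
  by rewrite divr_ge0 ?sqr_ge0// ltW.
by field; rewrite !gt_eqF.
Qed.

(** The weights of the noise are largest when the run is a single segment, and gamma
is at least 4 Lbar_0. *)
Lemma constant_noise (c : nat) : (forall t w, (1 <= t <= k)%N -> b w t = c) ->
  forall w, noise_sum w <=
    k%:R * (11 * k%:R + 3) / 16 * (sigma ^+ 2 / (c%:R * (4 * Lbar0))).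
Proof.
move=> hb w.
have /andP[L0 _] := HLbar0; have L4 : 0 < 4 * Lbar0 by rewrite mulr_gt0.
have c0 : 0 < c%:R :> R by rewrite ltr0n -(hb 1%N w) ?(batch_gt0 Hrun) ?Hk.
have -> : k%:R * (11 * k%:R + 3) / 16 =
    \sum_(1 <= t < k.+1) (11 * t.-1%:R / 8 + 7 / 8) :> R.
  elim: (k) => [|N ih]; first by rewrite big_geq// !mul0r.
  by rewrite sum_nat1_recr -ih succnK -[N.+1%:R]natr1; field.
rewrite mulr_suml; apply: ler_sum_nat => t /andP[t1 tk]; rewrite hb ?t1//.
apply: ler_pM.
- exact: noise_coef_ge0.
- by rewrite divr_ge0 ?sqr_ge0// mulr_ge0// ltW.
- by rewrite /noise_coef lerD2r ler_pM2r// ler_pM2l// ler_nat in_index_le.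
rewrite ler_wpM2l ?sqr_ge0// lef_pV2 ?posrE ?mulr_gt0// ler_pM2l//.
exact: gam_ge.
Qed.

Lemma unweighted_bound (A : Om -> R) (N : R) (mmax : nat)
    (C := 128 * Lhat / (k%:R - mmax%:R) ^+ 2) (K := k%:R * l * D ^+ 2 / 2) :
  P.-integrable setT (EFin \o A) ->
  (\int[P]_w (trajectory_sum w)%:E <=
     \int[P]_w (A w)%:E + K%:E + \int[P]_w (noise_sum w)%:E)%E ->
  (\int[P]_w (noise_sum w)%:E <= N%:E)%E ->
  {ae P, forall w, (num_segments (Lb w) k <= mmax)%N} -> (mmax < k)%N ->
  (\int[P]_w (g2 w)%:E <= \int[P]_w (C * A w)%:E + (C * K)%:E + (C * N)%:E)%E.
Proof.
move=> iA hT hN mle mk; apply: le_trans (unweighted_output mle mk) _.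
have C0 : 0 <= C by rewrite /C divr_ge0 ?sqr_ge0// mulr_ge0// ltW// Lhat_gt0.
under [in leRHS]eq_integral do rewrite EFinM.
rewrite integralZl// (integral_EFin iA) -!EFinM -!EFinD -!mulrDr [(C * (_ + _))%:E]EFinM lee_wpmul2l//.
by apply: le_trans hT _; rewrite (integral_EFin iA) !EFinD leeD2l.
Qed.

End Output.

End Run.

(** * Convergence of the method *)

Theorem theorem4 (R : realType) (n : nat)
    (X : set 'rV[R]_n) (f : 'rV[R]_n -> R) (gradf : 'rV[R]_n -> 'rV[R]_n) (L l : R)
    (dXi : measure_display) (Xi : measurableType dXi) (mu : probability Xi R)
    (F : 'rV[R]_n -> Xi -> R) (G : 'rV[R]_n -> Xi -> 'rV[R]_n) (calL : Xi -> R)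
    (sigma Lhat Lbar Lbar0 : R)
    (dOm : measure_display) (Om : measurableType dOm) (P : probability Om R)
    (est : estimator) (k : nat)
    (xi xibar : nat -> nat -> Om -> Xi) (b : Om -> nat -> nat) (b' : nat -> nat)
    (x0 : 'rV[R]_n) (x : Om -> nat -> 'rV[R]_n) (Lb : Om -> nat -> R)
    (out : Om -> nat)
    (Hproblem : smooth_problem X f gradf L l)
    (Horacle : stochastic_oracle mu X f gradf F G calL sigma Lhat Lbar)
    (HLbar0 : 0 < Lbar0 <= Lhat)
    (Hk : (1 <= k)%N)
    (Hrun : acspg_run P mu X F G Lbar0 est k xi xibar b b' x0 x Lb)
    (Hout : random_output P k xi xibar b b' Lb out) :
  let D := diam X in
  let M w := Msum (Lb w) k in
  let m w := num_segments (Lb w) k in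
  let g2 := output_sqgrad X gradf x Lb out in
  let beta := underestimation_prob mu X f gradf F G Lbar0 in
  let noise :=
    ('E_P[fun w => (\sum_(1 <= t < k.+1)
            noise_coef (Lb w) t * (sigma ^+ 2 / ((b w t)%:R * gam (Lb w) t)))%R])%E in
  let adaptive_batch (alpha : R) := forall t w, (1 <= t <= k)%N ->
    (b w t)%:Z =
      Num.max 1 (Num.ceil (noise_coef (Lb w) t * (alpha / gam (Lb w) t))) in
  let constant_batch (c : nat) := forall t w, (1 <= t <= k)%N -> b w t = c in
  (* mmax is a deterministic bound on the random number of segments *)
  let segments_le (mmax : nat) := {ae P, forall w, (m w <= mmax)%N} in
  let basic_bounds :=
    [/\ ('E_P[fun w => (M w * g2 w)%R] <=
           'E_P[fun w => ((10 + k%:R - (m w)%:R) * Lhat * D ^+ 2 / 2)%R]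
           + (k%:R * l * D ^+ 2 / 2)%R%:E + noise)%E,
        (forall (alpha : R) (mmax : nat), 0 < alpha -> adaptive_batch alpha ->
           segments_le mmax -> (mmax < k)%N ->
           ('E_P[g2] <=
              'E_P[fun w => (64 * (10 + k%:R - (m w)%:R) * Lhat ^+ 2 * D ^+ 2
                             / (k%:R - mmax%:R) ^+ 2)%R]
              + (64 * k%:R * l * Lhat * D ^+ 2 / (k%:R - mmax%:R) ^+ 2)%R%:E
              + (128 * k%:R * Lhat * sigma ^+ 2
                 / (alpha * (k%:R - mmax%:R) ^+ 2))%R%:E)%E)
      & (forall (c : nat) (mmax : nat), constant_batch c ->
           segments_le mmax -> (mmax < k)%N ->
           ('E_P[g2] <=
              'E_P[fun w => (64 * (10 + k%:R - (m w)%:R) * Lhat ^+ 2 * D ^+ 2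
                             / (k%:R - mmax%:R) ^+ 2)%R]
              + (64 * k%:R * l * Lhat * D ^+ 2 / (k%:R - mmax%:R) ^+ 2)%R%:E
              + (2 * (11 * k%:R + 3) * k%:R * Lhat * sigma ^+ 2
                 / (c%:R * Lbar0 * (k%:R - mmax%:R) ^+ 2))%R%:E)%E)] in
  let improved_bounds :=
    [/\ ('E_P[fun w => (M w * g2 w)%R] <=
           (21 * Lhat * D ^+ 2 / 4)%R%:E
           + (k%:R * l * D ^+ 2 / 2)%R%:E + noise)%E,
        (forall (alpha : R) (mmax : nat), 0 < alpha -> adaptive_batch alpha ->
           segments_le mmax -> (mmax < k)%N ->
           ('E_P[g2] <=
              (672 * Lhat ^+ 2 * D ^+ 2 / (k%:R - mmax%:R) ^+ 2)%R%:E
              + (64 * k%:R * l * Lhat * D ^+ 2 / (k%:R - mmax%:R) ^+ 2)%R%:E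
              + (128 * k%:R * Lhat * sigma ^+ 2
                 / (alpha * (k%:R - mmax%:R) ^+ 2))%R%:E)%E)
      & (forall (c : nat) (mmax : nat), constant_batch c ->
           segments_le mmax -> (mmax < k)%N ->
           ('E_P[g2] <=
              (672 * Lhat ^+ 2 * D ^+ 2 / (k%:R - mmax%:R) ^+ 2)%R%:E
              + (64 * k%:R * l * Lhat * D ^+ 2 / (k%:R - mmax%:R) ^+ 2)%R%:E
              + (2 * (11 * k%:R + 3) * k%:R * Lhat * sigma ^+ 2
                 / (c%:R * Lbar0 * (k%:R - mmax%:R) ^+ 2))%R%:E)%E)] in
  [/\ (forall w, M w >= (k%:R - (m w)%:R) ^+ 2 / (128 * runmax (Lb w) k.-1)),
      (est = EstimatorI -> basic_bounds)
    & (est = EstimatorII ->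
         basic_bounds /\
         (forall bhat : R, beta < 1 ->
            2 * logb (1 / beta) (k%:R + 1) <= bhat ->
            (forall t, (1 <= t <= k)%N -> bhat <= (b' t)%:R) ->
            improved_bounds))].
Proof.
move=> D M m g2 beta noise adaptive_batch constant_batch segments_le basic_bounds improved_bounds.
have Lbar0_gt0 : 0 < Lbar0 by have /andP[] := HLbar0.
have Lhat_gt0 : 0 < Lhat by have /andP[_] := HLbar0; exact: lt_le_trans.
have noiseE : noise = (\int[P]_w (@noise_sum R sigma _ _ k b Lb w)%:E)%E by rewrite /noise unlock.
have kmN (mmax : nat) : (mmax < k)%N -> k%:R - mmax%:R != 0 :> R.
  by move=> mk; rewrite subr_eq0 eqr_nat gtn_eqF.
have weighted (B : \bar R) : (\int[P]_w (@trajectory_sum R n X gradf _ _ k x Lb w)%:E <= B)%E ->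
    ('E_P[fun w => (M w * g2 w)%R] <= B)%E.
  rewrite unlock; apply: le_trans.
  exact: (weighted_output Hproblem Horacle HLbar0 Hrun Hout).
have adaptive (A : Om -> R) (alpha : R) (mmax : nat) :
    P.-integrable setT (EFin \o A) ->
    (\int[P]_w (@trajectory_sum R n X gradf _ _ k x Lb w)%:E <=
       \int[P]_w (A w)%:E + (k%:R * l * D ^+ 2 / 2)%:E + noise)%E ->
    0 < alpha -> adaptive_batch alpha -> segments_le mmax -> (mmax < k)%N ->
    ('E_P[g2] <= \int[P]_w (128 * Lhat / (k%:R - mmax%:R) ^+ 2 * A w)%:E
       + (64 * k%:R * l * Lhat * D ^+ 2 / (k%:R - mmax%:R) ^+ 2)%R%:E
       + (128 * k%:R * Lhat * sigma ^+ 2 / (alpha * (k%:R - mmax%:R) ^+ 2))%R%:E)%E.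
  rewrite noiseE => iA hT a0 hb hm mk; rewrite unlock.
  have hN := noise_sum_le Hproblem Horacle HLbar0 Hrun
    (adaptive_noise HLbar0 Hrun a0 hb).
  have := unweighted_bound Hproblem Horacle HLbar0 Hk Hrun Hout iA hT hN hm mk.
  move=> /le_trans; apply; rewrite le_eqVlt; apply/orP; left; apply/eqP.
  have kn := kmN _ mk; have an := gt_eqF a0.
  by congr (_ + _%:E + _%:E)%E; rewrite -?/D; field; rewrite ?kn ?an.
have constant (A : Om -> R) (c mmax : nat) :
    P.-integrable setT (EFin \o A) ->
    (\int[P]_w (@trajectory_sum R n X gradf _ _ k x Lb w)%:E <=
       \int[P]_w (A w)%:E + (k%:R * l * D ^+ 2 / 2)%:E + noise)%E ->
    constant_batch c -> segments_le mmax -> (mmax < k)%N ->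
    ('E_P[g2] <= \int[P]_w (128 * Lhat / (k%:R - mmax%:R) ^+ 2 * A w)%:E
       + (64 * k%:R * l * Lhat * D ^+ 2 / (k%:R - mmax%:R) ^+ 2)%R%:E
       + (2 * (11 * k%:R + 3) * k%:R * Lhat * sigma ^+ 2
          / (c%:R * Lbar0 * (k%:R - mmax%:R) ^+ 2))%R%:E)%E.
  rewrite noiseE => iA hT hb hm mk; rewrite unlock.
  have hN := noise_sum_le Hproblem Horacle HLbar0 Hrun
    (constant_noise HLbar0 Hk Hrun hb).
  have := unweighted_bound Hproblem Horacle HLbar0 Hk Hrun Hout iA hT hN hm mk.
  move=> /le_trans; apply; rewrite le_eqVlt; apply/orP; left; apply/eqP.
  have kn := kmN _ mk; have Ln := gt_eqF Lbar0_gt0.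
  have cn : c%:R != 0 :> R.
    by rewrite pnatr_eq0 -lt0n -(hb 1%N point) ?(batch_gt0 Hrun) ?Hk.
  by congr (_ + _%:E + _%:E)%E; rewrite -?/D; field; rewrite ?kn ?Ln ?cn.
have basic : basic_bounds.
  have hT := basic_trajectory Hproblem Horacle HLbar0 Hk Hrun.
  have iA : P.-integrable setT (EFin \o (fun w => (10 + k%:R - (m w)%:R) * Lhat * D ^+ 2 / 2)).
    apply: (segments_fun_integrable Hproblem Horacle HLbar0 Hk Hrun
      (h := fun i => (10 + k%:R - i%:R) * Lhat * D ^+ 2 / 2)) => i ik.
    rewrite divr_ge0// mulr_ge0 ?sqr_ge0// mulr_ge0 ?(ltW Lhat_gt0)//.
    by rewrite subr_ge0 -natrD ler_nat (leq_trans ik)// leq_addl.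
  have scaleA (mmax : nat) : (mmax < k)%N ->
      (\int[P]_w (128 * Lhat / (k%:R - mmax%:R) ^+ 2 *
         ((10 + k%:R - (m w)%:R) * Lhat * D ^+ 2 / 2))%:E =
       'E_P[fun w => (64 * (10 + k%:R - (m w)%:R) * Lhat ^+ 2 * D ^+ 2
                             / (k%:R - mmax%:R) ^+ 2)%R])%E.
    move=> mk; rewrite unlock; apply: eq_integral => w _; congr (_%:E).
    by field; exact: kmN.
  split.
  - by apply: weighted; rewrite noiseE unlock; exact: hT.
  - by move=> alpha mmax a0 hb hm mk; rewrite -scaleA//; apply: adaptive => //; rewrite noiseE.
  - by move=> c mmax hb hm mk; rewrite -scaleA//; apply: constant => //; rewrite noiseE.
split => //.
  by move=> w; apply: Msum_lower => //; exact: (run_Lb0 HLbar0 Hrun).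
move=> estE; split=> // bhat beta1 hlog hb.
have := improved_trajectory Hproblem Horacle HLbar0 Hk Hrun estE beta1 hlog hb.
rewrite -/D -noiseE => hT.
have iA : P.-integrable setT (EFin \o (fun=> 21 * Lhat * D ^+ 2 / 4)).
  exact: finite_measure_integrable_cst.
have hT' := hT; rewrite -(integral_probability_cst P (21 * _ * _ / 4)) in hT'.
have scaleA (mmax : nat) : (mmax < k)%N ->
    (\int[P]_w (128 * Lhat / (k%:R - mmax%:R) ^+ 2 * (21 * Lhat * D ^+ 2 / 4))%:E =
     (672 * Lhat ^+ 2 * D ^+ 2 / (k%:R - mmax%:R) ^+ 2)%:E)%E.
  by move=> mk; rewrite integral_probability_cst; congr (_%:E); field; exact: kmN.
split.
- exact: weighted.
- by move=> alpha mmax a0 hb' hm mk; rewrite -scaleA//; exact: adaptive.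
- by move=> c mmax hb' hm mk; rewrite -scaleA//; exact: constant.
Qed.
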